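(* Let $G$ be a Lie group with Lie algebra $\mathfrak{g}$. For all $p,q\in G$, $v,w\in U(\mathfrak{g})$, $\alpha\in\wedge^k(\mathfrak{g}^-)$ and $\beta\in\wedge^j(\mathfrak{g}^-)$, the convolution product of the currents $(p,v\otimes\alpha)$ and $(q,w\otimes\beta)$ on $G$ is $$(p,v\otimes\alpha)\ast(q,w\otimes\beta)=\big(pq,\ \mathrm{Ad}_q^{-1}(v_{(1)})\,w\otimes\alpha\wedge\mathrm{Ad}_p[v_{(2)},\beta]\big).$$
   Context: $\mathfrak{g}^-$ is $\mathfrak{g}$ with the negative of its Lie bracket; as a graded vector space $\wedge(\mathfrak{g}^-)=\wedge(\mathfrak{g})$. Elements of $U(\mathfrak{g})$ are interpreted as left-invariant differential operators on $C^\infty(G)$ (with $x\in\mathfrak{g}$ the left-invariant vector field equal to $x$ at $e$), extended to differential forms by the Leibniz rule and commutation with $d$, i.e. as iterated Lie derivatives. Elements of $\wedge^k(\mathfrak{g}^-)$ are interpreted as right-invariant $k$-vector fields. $(p,v\otimes\alpha)$ denotes the $k$-dimensional current $\omega\mapsto (v(\omega))_p(\alpha)$, supported in $\{p\}$; it is linear in $v\otimes\alpha$. Convolution: for compactly supported currents $A,B$ on $G$, $(A\ast B)(\omega)=(A\otimes B)(m^*\omega)$, where $m:G\times G\to G$ is the group multiplication and $A\otimes B$ is the current on $G\times G$ uniquely determined by $(A\otimes B)(\pi_1^*\eta\wedge\pi_2^*\zeta)=A(\eta)B(\zeta)$, with $\pi_1,\pi_2:G\times G\to G$ the projections. $v_{(1)}\otimes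 v_{(2)}$ is Sweedler notation for the co-product of the Hopf algebra $U(\mathfrak{g})$. $\mathrm{Ad}$ is extended to $U(\mathfrak{g})$ and $\wedge(\mathfrak{g}^-)$ by algebra automorphisms. $[\cdot,\cdot]:U(\mathfrak{g})\times\wedge(\mathfrak{g}^-)\to\wedge(\mathfrak{g}^-)$ is the extension of the bracket of $\mathfrak{g}$: each $x\in\mathfrak{g}$ acts as the degree-zero derivation extending $y\mapsto[x,y]$, and this is extended to an algebra action of $U(\mathfrak{g})$. *)

(* Defs.v *)
From HB Require Import structures.
From mathcomp Require Import all_boot all_order all_algebra perm.
From mathcomp Require Import all_classical all_reals all_analysis.

Set Implicit Arguments.
Unset Strict Implicit.
Unset Printing Implicit Defensive.

Import Order.TTheory GRing.Theory Num.Theory.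
Import numFieldNormedType.Exports.

Local Open Scope classical_set_scope.
Local Open Scope ring_scope.

Section Ck.
Variables (R : realType) (V W : normedModType R).

(* [f] is of class C^k on the open set [U]. *)
Fixpoint Ck (k : nat) (U : set V) (f : V -> W) : Prop :=
  if k is k'.+1 then
    (forall x, U x -> differentiable f x) /\ (forall v, Ck k' U ('D_v f))
  else forall x, U x -> {for x, continuous f}.

Definition smooth_on (U : set V) (f : V -> W) := forall k, Ck k U f.

Lemma near0_differentiable (e : V -> W) x :
  (\forall y \near x, e y = 0) -> differentiable e x.
Proof.
move=> e0.
have ex : e x = 0 by exact: nbhs_singleton e0.
have e_o : e \o shift x = cst (e x) + 0 +o_ (0 : V) id.
  apply/eqaddoE/eqaddoP => eps eps0.
  have := e0; rewrite (near_shift (0 : V)) /= => e0'.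
  apply: filterS e0' => h /=.
  rewrite subr0 !fctE /= ex !addr0 => ->.
  by rewrite subr0 normr0 mulr_ge0 // ltW.
have de : 'd e x = 0 :> (V -> W).
  by apply: (@diff_unique _ V W e \0) e_o => //; exact: cst_continuous.
by apply/diff_locallyP; rewrite de; split=> //; exact: cst_continuous.
Qed.

Lemma eq_Ck k (U : set V) f g :
  open U -> (forall x, U x -> f x = g x) -> Ck k U f -> Ck k U g.
Proof.
move=> oU; elim: k f g => [|k IH] f g fg /= Cf.
  move=> x Ux; rewrite /prop_for /continuous_at -(fg x Ux).
  have fgn : {near nbhs x, f =1 g}.
    by apply: filterS (open_nbhs_nbhs (conj oU Ux)) => y /fg.
  exact: cvg_trans (near_eq_cvg fgn) (Cf x Ux).
have fgn x : U x -> \near x, f x = g x.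
  by move=> Ux; apply: filterS (open_nbhs_nbhs (conj oU Ux)) => y /fg.
case: Cf => df Cf; split=> [x Ux|v]; last first.
  apply: IH (Cf v) => x Ux; exact: near_eq_derive (fgn x Ux).
have -> : g = f + (g - f) by rewrite addrC subrK.
apply: differentiableD; first exact: df.
apply: near0_differentiable; apply: filterS (fgn x Ux) => y fgy.
by rewrite !fctE fgy subrr.
Qed.

Lemma Ck0 k (U : set V) : Ck k U (fun _ => 0 : W).
Proof.
elim: k => [|k IH] /=; first by move=> x _; exact: cst_continuous.
split=> [x _|v]; first exact: differentiable_cst.
by rewrite (_ : 'D_v _ = fun _ => 0) //; apply/funext => x; exact: derive_cst.
Qed.

Lemma CkD k (U : set V) f g :
  open U -> Ck k U f -> Ck k U g -> Ck k U (f + g).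
Proof.
move=> oU; elim: k f g => [|k IH] f g /=.
  by move=> Cf Cg x Ux; apply: continuousD; [exact: Cf|exact: Cg].
move=> [df Cf] [dg Cg]; split=> [x Ux|v].
  by apply: differentiableD; [exact: df|exact: dg].
apply: eq_Ck (IH _ _ (Cf v) (Cg v)) => // x Ux.
by rewrite deriveD //; apply: diff_derivable; [exact: df|exact: dg].
Qed.

Lemma CkZ k (U : set V) (a : R) f : open U -> Ck k U f -> Ck k U (a *: f).
Proof.
move=> oU; elim: k f => [|k IH] f /=.
  by move=> Cf x Ux; apply: continuousZr; exact: Cf.
move=> [df Cf]; split=> [x Ux|v]; first by apply: differentiableZ; exact: df.
apply: eq_Ck (IH _ (Cf v)) => // x Ux.
by rewrite deriveZ //; apply: diff_derivable; exact: df.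
Qed.

End Ck.

Section ChartedSpaces.
Variable R : realType.

Record chart (T : topologicalType) (n : nat) := Chart {
  cdom : set T;
  ccod : set 'rV[R]_n;
  cmap : T -> 'rV[R]_n;
  cinv : 'rV[R]_n -> T;
  cdom_open : open cdom;
  ccod_open : open ccod;
  cmap_cod : forall x, cdom x -> ccod (cmap x);
  cinv_dom : forall y, ccod y -> cdom (cinv y);
  cmapK : forall x, cdom x -> cinv (cmap x) = x;
  cinvK : forall y, ccod y -> cmap (cinv y) = y;
  cmap_cont : forall x, cdom x -> {for x, continuous cmap};
  cinv_cont : forall y, ccod y -> {for y, continuous cinv} }.

(* The data of an atlas; that it is one is [is_manifold] below. *)
Record chartedSpace := ChartedSpace {
  carrier :> topologicalType;
  space_dim : nat;
  atlas : set (chart carrier space_dim) }.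

Definition is_manifold (M : chartedSpace) :=
  [/\ hausdorff_space M, @second_countable M,
      forall x : M, exists2 c, atlas c & cdom c x
    & forall c d : chart M (space_dim M), atlas c -> atlas d ->
        smooth_on (ccod c `&` cinv c @^-1` cdom d) (cmap d \o cinv c)].

Definition smooth_map (M N : chartedSpace) (F : M -> N) :=
  continuous F /\
  forall (c : chart M (space_dim M)) (d : chart N (space_dim N)), atlas c -> atlas d ->
    smooth_on (ccod c `&` (F \o cinv c) @^-1` cdom d) (cmap d \o F \o cinv c).

Definition smooth_fun (M : chartedSpace) (f : M -> R) :=
  forall c : chart M (space_dim M), atlas c -> smooth_on (ccod c) (f \o cinv c).

End ChartedSpaces.

Section ProductCharts.
Variable R : realType.

Lemma row_mx_continuous m n :
  continuous (fun z : 'rV[R]_m * 'rV[R]_n => row_mx z.1 z.2).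
Proof.
move=> z A /nbhs_ballP[e /= e0 eA].
apply/nbhs_ballP; exists e => //= y zy.
have [zy1 zy2] : ball z.1 e y.1 /\ ball z.2 e y.2 by exact: zy.
apply: eA; split => // i j.
rewrite !mxE; case: (fintype.split j) => k; [exact: (proj2 zy1)|exact: (proj2 zy2)].
Qed.

Variables (S T : topologicalType) (m n : nat) (c : chart R S m) (d : chart R T n).

Let dom := cdom c `*` cdom d.
Let cod := [set z : 'rV[R]_(m + n) | ccod c (lsubmx z) /\ ccod d (rsubmx z)].
Let map (z : S * T) := row_mx (cmap c z.1) (cmap d z.2).
Let inv (z : 'rV[R]_(m + n)) := (cinv c (lsubmx z), cinv d (rsubmx z)).

Let dom_open : open dom.
Proof.
rewrite openE => -[x y] [/= cx dy].
by exists (cdom c, cdom d) => //; split;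
  apply: open_nbhs_nbhs; split=> //; exact: cdom_open.
Qed.

Let cod_open : open cod.
Proof.
apply: openI.
  have /continuousP := @continuous_lsubmx R 1 m n.
  by apply; exact: ccod_open.
have /continuousP := @continuous_rsubmx R 1 m n.
by apply; exact: ccod_open.
Qed.

Let map_cod z : dom z -> cod (map z).
Proof.
by move=> [cz dz]; split; rewrite ?row_mxKl ?row_mxKr; exact: cmap_cod.
Qed.

Let inv_dom y : cod y -> dom (inv y).
Proof. by move=> [cy dy]; split; exact: cinv_dom. Qed.

Let mapK z : dom z -> inv (map z) = z.
Proof.
by case: z => x y [cx dy]; rewrite /inv row_mxKl row_mxKr !cmapK.
Qed.

Let invK y : cod y -> map (inv y) = y.
Proof. by move=> [cy dy]; rewrite /map !cinvK // hsubmxK. Qed.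

Let map_cont z : dom z -> {for z, continuous map}.
Proof.
move=> [cz dz]; apply: (@continuous_comp _ _ _
  (fun z : S * T => (cmap c z.1, cmap d z.2)) (fun z => row_mx z.1 z.2)).
  apply: (@cvg_pair _ _ _ _ (nbhs (cmap c z.1)) (nbhs (cmap d z.2))).
    by apply: (@continuous_comp _ _ _ fst (cmap c)); [exact: cvg_fst|exact: cmap_cont].
  by apply: (@continuous_comp _ _ _ snd (cmap d)); [exact: cvg_snd|exact: cmap_cont].
exact: row_mx_continuous.
Qed.

Let inv_cont y : cod y -> {for y, continuous inv}.
Proof.
move=> [cy dy].
have hc : {for y, continuous (cinv c \o (lsubmx : 'rV[R]_(m + n) -> _))}.
  apply: continuous_comp; first exact: continuous_lsubmx.
  exact: (cinv_cont cy).
have hd : {for y, continuous (cinv d \o (rsubmx : 'rV[R]_(m + n) -> _))}.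
  apply: continuous_comp; first exact: continuous_rsubmx.
  exact: (cinv_cont dy).
exact: cvg_pair hc hd.
Qed.

Definition prod_chart : chart R (S * T)%type (m + n) :=
  Chart dom_open cod_open map_cod inv_dom mapK invK map_cont inv_cont.

End ProductCharts.

Definition prod_space (R : realType) (M N : chartedSpace R) : chartedSpace R :=
  ChartedSpace [set prod_chart c d | c in @atlas R M & d in @atlas R N].

Section Tangent.
Variables (R : realType) (M : chartedSpace R) (p : M).

(* A tangent vector at [p] is given by its derivation f |-> (f o gamma)'(0),   *)
(* gamma a curve at [p]: in every chart, a directional derivative.  It        *)
(* is made a function of all [f] by the value 0 where [f] is not smooth.      *)
Definition is_tangent (D : (M -> R) -> R) :=
  (forall f, ~ smooth_fun f -> D f = 0) /\
  (forall c : chart R M (space_dim M), atlas c -> cdom c p ->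
     exists u, forall f, smooth_fun f -> D f = 'D_u (f \o cinv c) (cmap c p)).

Definition tangent_pred : {pred (M -> R) -> R} := fun D => `[< is_tangent D >].

Lemma tangent_closed : subsemimod_closed tangent_pred.
Proof.
have df f c u : smooth_fun f -> @atlas _ M c -> cdom c p ->
    derivable (f \o cinv c) (cmap c p) u.
  move=> sf ac cp; apply: diff_derivable.
  by have [+ _] := sf c ac 1%N; apply; exact: cmap_cod.
split; first split.
- apply/asboolP; split=> // c ac cp; exists 0 => f sf.
  by rewrite derive0.
- move=> D E /asboolP[D0 DT] /asboolP[E0 ET]; apply/asboolP; split.
    by move=> f nf; rewrite !fctE D0 // E0 // addr0.
  move=> c ac cp; have [u Du] := DT c ac cp; have [v Ev] := ET c ac cp.
  exists (u + v) => f sf; rewrite !fctE Du // Ev //.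
  have dfp : differentiable (f \o cinv c) (cmap c p).
    by have [+ _] := sf c ac 1%N; apply; exact: cmap_cod.
  by rewrite !deriveE // linearD.
move=> a D /asboolP[D0 DT]; apply/asboolP; split.
  by move=> f nf; rewrite !fctE D0 // scaler0.
move=> c ac cp; have [u Du] := DT c ac cp.
exists (a *: u) => f sf; rewrite !fctE Du //.
have dfp : differentiable (f \o cinv c) (cmap c p).
  by have [+ _] := sf c ac 1%N; apply; exact: cmap_cod.
by rewrite !deriveE // linearZ.
Qed.

HB.instance Definition _ :=
  GRing.isSubSemiModClosed.Build R ((M -> R) -> R) tangent_pred tangent_closed.

Definition tangent : Type := {D | tangent_pred D}.
HB.instance Definition _ := SubChoice.on tangent.
HB.instance Definition _ := [SubChoice_isSubLmodule of tangent by <:].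

End Tangent.

Section Pushforward.
Variable R : realType.

(* The junk value 0 of [insubd] is only used when [D] is not tangent at [p]   *)
(* on smooth functions.                                                       *)
Definition mk_tangent (M : chartedSpace R) (p : M) (D : (M -> R) -> R) :
    tangent p :=
  insubd 0 (fun f => if `[< smooth_fun f >] then D f else 0).

(* The differential of [F] at [p]; meant for [q = F p], but [q] is a separate *)
(* argument to allow for non definitional equality.                           *)
Definition pushforward (M N : chartedSpace R) (F : M -> N) (p : M) (q : N)
    (v : tangent p) : tangent q :=
  mk_tangent q (fun f => val v (f \o F)).

Definition coord_vec (M : chartedSpace R) (c : chart R M (space_dim M))
    (y u : 'rV[R]_(space_dim M)) : tangent (cinv c y) :=
  mk_tangent (cinv c y) (fun f => 'D_u (f \o cinv c) y).

End Pushforward.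

Section Forms.
Variables (R : realType) (M : chartedSpace R) (k : nat).

Definition rawform : Type := forall p : M, ('I_k -> tangent p) -> R.

HB.instance Definition _ := gen_eqMixin rawform.
HB.instance Definition _ := gen_choiceMixin rawform.

Let add (w z : rawform) : rawform := fun p v => w p v + z p v.
Let opp (w : rawform) : rawform := fun p v => - w p v.
Let scale (a : R) (w : rawform) : rawform := fun p v => a * w p v.

Let rawform_ext (w z : rawform) : (forall p v, w p v = z p v) -> w = z.
Proof. by move=> wz; apply/functional_extensionality_dep => p; apply/funext. Qed.

Let addA : associative add.
Proof. by move=> *; apply: rawform_ext => p v; exact: addrA. Qed.
Let addC : commutative add.
Proof. by move=> *; apply: rawform_ext => p v; exact: addrC. Qed.
Let add0 : left_id (fun _ _ => 0 : R) add.
Proof. by move=> *; apply: rawform_ext => p v; exact: add0r. Qed.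
Let addN : left_inverse (fun _ _ => 0 : R) opp add.
Proof. by move=> *; apply: rawform_ext => p v; exact: addNr. Qed.
HB.instance Definition _ := GRing.isZmodule.Build rawform addA addC add0 addN.

Let scaleA a b w : scale a (scale b w) = scale (a * b) w.
Proof. by apply: rawform_ext => p v; exact: mulrA. Qed.
Let scale1 : left_id 1 scale.
Proof. by move=> w; apply: rawform_ext => p v; exact: mul1r. Qed.
Let scaleDr : right_distributive scale +%R.
Proof. by move=> *; apply: rawform_ext => p v; exact: mulrDr. Qed.
Let scaleDl w : {morph scale^~ w : a b / a + b}.
Proof. by move=> *; apply: rawform_ext => p v; exact: mulrDl. Qed.
HB.instance Definition _ :=
  GRing.Zmodule_isLmodule.Build R rawform scaleA scale1 scaleDr scaleDl.

Definition upd (T : Type) (v : 'I_k -> T) (i : 'I_k) (x : T) : 'I_k -> T :=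
  fun j => if j == i then x else v j.

(* The coefficient of [w] along constant coordinate fields in a chart. *)
Definition form_coef (w : rawform) (c : chart R M (space_dim M))
    (u : 'I_k -> 'rV[R]_(space_dim M)) (y : 'rV[R]_(space_dim M)) : R :=
  w (cinv c y) (fun i => coord_vec c y (u i)).

Definition is_form (w : rawform) :=
  [/\ forall p (v : 'I_k -> tangent p) i j, i != j -> v i = v j -> w p v = 0,
      forall p (v : 'I_k -> tangent p) i a x y,
        w p (upd v i (a *: x + y)) = a * w p (upd v i x) + w p (upd v i y)
    & forall c u, atlas c -> smooth_on (ccod c) (form_coef w c u)].

Definition form_pred : {pred rawform} := fun w => `[< is_form w >].

Lemma form_closed : subsemimod_closed form_pred.
Proof.
split; first split.
- apply/asboolP; split=> // [p v i a x y|c u ac m].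
    by rewrite mulr0 addr0.
  exact: Ck0.
- move=> w z /asboolP[wA wL wS] /asboolP[zA zL zS]; apply/asboolP; split.
  + move=> p v i j ij vij.
    by rewrite -[LHS]/(w p v + z p v) (wA _ _ _ _ ij vij) (zA _ _ _ _ ij vij) addr0.
  + move=> p v i a x y; rewrite -[LHS]/(w _ _ + z _ _) wL zL.
    by rewrite -[(w + z) _ _]/(w _ _ + z _ _) mulrDr addrACA.
  + by move=> c u ac m; apply: CkD; [exact: ccod_open|exact: wS|exact: zS].
move=> b w /asboolP[wA wL wS]; apply/asboolP; split.
- move=> p v i j ij vij.
  by rewrite -[LHS]/(b * w p v) (wA _ _ _ _ ij vij) mulr0.
- move=> p v i a x y; rewrite -[LHS]/(b * w _ _) wL mulrDr.
  by rewrite mulrCA.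
- by move=> c u ac m; apply: CkZ; [exact: ccod_open|exact: wS].
Qed.

HB.instance Definition _ :=
  GRing.isSubSemiModClosed.Build R rawform form_pred form_closed.

Definition diff_form : Type := {w | form_pred w}.
HB.instance Definition _ := SubChoice.on diff_form.
HB.instance Definition _ := [SubChoice_isSubLmodule of diff_form by <:].

Definition form_val (w : diff_form) : forall p : M, ('I_k -> tangent p) -> R := val w.
Coercion form_val : diff_form >-> Funclass.

(* As for tangent vectors, the junk value 0 is for a [w] that is not a form.  *)
Definition mk_form (w : rawform) : diff_form := insubd 0 w.

End Forms.

Section Calculus.
Variable R : realType.
Implicit Types M N : chartedSpace R.

Definition pullback M N (F : M -> N) k (w : diff_form N k) : diff_form M k :=
  mk_form (fun p v => w (F p) (fun i => pushforward F (F p) (v i))).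

(* Normalised so that (dx /\ dy)(u, v) = dx u * dy v - dx v * dy u. *)
Definition wedge_form M k j (w : diff_form M k) (z : diff_form M j) :
    diff_form M (k + j) :=
  mk_form (fun p v => (k`!%:R * j`!%:R)^-1 *
    \sum_(s : 'S_(k + j)) (-1) ^+ s *
      w p (fun i => v (s (lshift j i))) * z p (fun i => v (s (rshift k i)))).

(* [z] is the exterior derivative of [w], by the formula in coordinates. *)
Definition is_exterior_derivative M k
    (w : diff_form M k) (z : diff_form M k.+1) :=
  forall (c : chart R M (space_dim M)) u y, atlas c -> ccod c y ->
    form_coef z c u y =
    \sum_(i < k.+1) (-1) ^+ i * 'D_(u i) (form_coef w c (fun j => u (lift i j))) y.

Definition fun_of_form0 M (w : diff_form M 0) (p : M) : R := w p (fun _ => 0).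

Definition current M := forall k, diff_form M k -> R.

Fixpoint iter_partial n (s : seq 'I_n) (f : 'rV[R]_n -> R) : 'rV[R]_n -> R :=
  if s is i :: s' then 'D_(delta_mx 0 i) (iter_partial s' f) else f.

(* A current is graded: a k-dimensional one is 0 on forms of other degrees.   *)
(* Continuity is for the C^infty topology, of uniform convergence on compact  *)
(* subsets of charts of all the partial derivatives of the coefficients; such *)
(* currents are the compactly supported ones.                                 *)
Definition is_current M (A : current M) :=
  forall k,
    (forall (a : R) (w z : diff_form M k), A k (a *: w + z) = a * A k w + A k z) /\
    exists (r m : nat) (c : 'I_r -> chart R M (space_dim M))
           (K : 'I_r -> set 'rV[R]_(space_dim M)) (C : R),
      (forall i, [/\ atlas (c i), compact (K i) & K i `<=` ccod (c i)]) /\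
      forall (w : diff_form M k) (b : R), 0 <= b ->
        (forall i y (e : 'I_k -> 'I_(space_dim M)) s, K i y -> (size s <= m)%N ->
          `|iter_partial s (form_coef w (c i) (fun l => delta_mx 0 (e l))) y| <= b) ->
        `|A k w| <= C * b.

(* [T] is the tensor product of [A] and [B]; as the forms below span a dense  *)
(* subspace of the forms on the product, at most one current [T] satisfies it. *)
Definition is_tensor M N (A : current M) (B : current N)
    (T : current (prod_space M N)) :=
  is_current T /\
  forall k j (w : diff_form M k) (z : diff_form N j),
    T (k + j)%N (wedge_form (pullback (fst : prod_space M N -> M) w)
                       (pullback (snd : prod_space M N -> N) z)) =
    A k w * B j z.

End Calculus.

#[short(type="topologicalGroupCarrier")]
HB.structure Definition TopologicalGroupCarrier := {G of Group G & Topological G}.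

Record lieGroup (R : realType) := LieGroup {
  lie_carrier :> topologicalGroupCarrier;
  lie_dim : nat;
  lie_atlas : set (chart R lie_carrier lie_dim);
  lie_space := ChartedSpace lie_atlas;
  lie_manifold : is_manifold lie_space;
  lie_mulP : smooth_map
    (fun z : prod_space lie_space lie_space => (z.1 * z.2)%g : lie_space);
  lie_invP : smooth_map (fun g : lie_space => (g : lie_carrier)^-1%g : lie_space) }.

Section LieAlgebra.
Variables (R : realType) (G : lieGroup R).

Definition lie_algebra : lmodType R := tangent (1%g : lie_space G).
Implicit Types (x y : lie_algebra) (p g : G).

(* The left-invariant vector field equal to [x] at 1, on functions. *)
Definition left_inv x (f : G -> R) : G -> R :=
  fun p => val x (fun h => f (p * h)%g).

Definition bracket x y : lie_algebra :=
  mk_tangent (1%g : lie_space G)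
    (fun f => val x (left_inv y f) - val y (left_inv x f)).

(* The value at [p] of the right-invariant vector field equal to [x] at 1. *)
Definition right_inv x (p : lie_space G) : tangent p :=
  pushforward (fun h : lie_space G => (h * p)%g : lie_space G) p x.

Definition Ad g x : lie_algebra :=
  pushforward (fun h : lie_space G => (g * h * g^-1)%g : lie_space G)
    (1%g : lie_space G) x.

End LieAlgebra.

Section AlgebraicData.
Variables (R : realType) (G : lieGroup R).
Notation gg := (lie_algebra G).

Definition is_enveloping (U : algType R) (iU : {linear gg -> U}) :=
  let lie_hom (A : algType R) (f : gg -> A) :=
    forall x y, f (bracket x y) = f x * f y - f y * f x in
  lie_hom U iU /\
  forall (A : algType R) (f : {linear gg -> A}), lie_hom A f ->
    (exists h : {lrmorphism U -> A}, forall x, h (iU x) = f x) /\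
    (forall h h' : {lrmorphism U -> A},
       (forall x, h (iU x) = h' (iU x)) -> h =1 h').

(* The bracket plays no role in the algebra structure: this is the exterior   *)
(* algebra of the Lie algebra and of its opposite.                            *)
Definition is_exterior (E : algType R) (iE : {linear gg -> E}) :=
  (forall x, iE x * iE x = 0) /\
  forall (A : algType R) (f : {linear gg -> A}), (forall x, f x * f x = 0) ->
    (exists h : {lrmorphism E -> A}, forall x, h (iE x) = f x) /\
    (forall h h' : {lrmorphism E -> A},
       (forall x, h (iE x) = h' (iE x)) -> h =1 h').

Definition is_homogeneous (E : algType R) (iE : {linear gg -> E}) k (a : E) :=
  exists s : seq (R * ('I_k -> gg)),
    a = \sum_(t <- s) t.1 *: \prod_(i < k) iE (t.2 i).

(* Lists of pairs stand for sums of elementary tensors; [tensor_eq] is        *)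
(* equality of these sums in the tensor product.                              *)
Definition tensor_eq (V : lmodType R) (s t : seq (V * V)) :=
  forall (W : lmodType R) (b : {bilinear V -> V -> W}),
    \sum_(x <- s) b x.1 x.2 = \sum_(x <- t) b x.1 x.2.

(* [Delta v] is a Sweedler representative of the coproduct of [v]. *)
Definition is_coproduct (U : algType R) (iU : {linear gg -> U})
    (Delta : U -> seq (U * U)) :=
  [/\ forall a u v, tensor_eq (Delta (a *: u + v))
        ([seq (a *: x.1, x.2) | x <- Delta u] ++ Delta v),
      tensor_eq (Delta 1) [:: (1, 1)],
      forall u v, tensor_eq (Delta (u * v))
        [seq (x.1 * y.1, x.2 * y.2) | x <- Delta u, y <- Delta v]
    & forall x, tensor_eq (Delta (iU x)) [:: (iU x, 1); (1, iU x)]].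

Definition is_algebra_action (U : algType R) (V : lmodType R)
    (act : U -> {linear V -> V}) :=
  [/\ forall a u v z, act (a *: u + v) z = a *: act u z + act v z,
      forall z, act 1 z = z
    & forall u v z, act (u * v) z = act u (act v z)].

Definition extends_bracket (U : algType R) (iU : {linear gg -> U})
    (E : algType R) (iE : {linear gg -> E}) (br : U -> {linear E -> E}) :=
  [/\ is_algebra_action br,
      forall x a b, br (iU x) (a * b) = br (iU x) a * b + a * br (iU x) b
    & forall x y, br (iU x) (iE y) = iE (bracket x y)].

(* [rho] is the action of [U] on forms by iterated Lie derivatives along      *)
(* left-invariant vector fields.                                              *)
Definition is_lie_derivative (U : algType R) (iU : {linear gg -> U})
    (rho : forall k,
       U -> {linear diff_form (lie_space G) k -> diff_form (lie_space G) k}) :=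
  [/\ forall k, is_algebra_action (rho k),
      forall x w p, fun_of_form0 (rho 0%N (iU x) w) p =
        left_inv x (fun_of_form0 w) p,
      forall x k j (w : diff_form _ k) (z : diff_form _ j),
        rho (k + j)%N (iU x) (wedge_form w z) =
        wedge_form (rho k (iU x) w) z + wedge_form w (rho j (iU x) z)
    & forall x k (w : diff_form _ k) (z : diff_form _ k.+1),
        is_exterior_derivative w z ->
        is_exterior_derivative (rho k (iU x) w) (rho k.+1 (iU x) z)].

(* [ev k w p] evaluates the k-form [w] at [p] on elements of the exterior     *)
(* algebra viewed as right-invariant multivector fields.                      *)
Definition is_right_inv_eval (E : algType R) (iE : {linear gg -> E})
    (ev : forall k, diff_form (lie_space G) k -> G -> {scalar E}) :=
  forall k (w : diff_form _ k) p,
    (forall x : 'I_k -> gg,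
       ev k w p (\prod_(i < k) iE (x i)) =
       form_val w (p := p) (fun i => right_inv (x i) p)) /\
    (forall j (x : 'I_j -> gg), j <> k -> ev k w p (\prod_(i < j) iE (x i)) = 0).

Definition point_current (U E : algType R)
    (rho : forall k,
       U -> {linear diff_form (lie_space G) k -> diff_form (lie_space G) k})
    (ev : forall k, diff_form (lie_space G) k -> G -> {scalar E})
    (p : G) (v : U) (a : E) : current (lie_space G) :=
  fun k w => ev k (rho k v w) p a.

(* [C] is the image of the tensor product of [A] and [B] under multiplication. *)
Definition is_convolution (A B C : current (lie_space G)) :=
  exists2 T : current (prod_space (lie_space G) (lie_space G)),
    is_tensor A B T &
    forall k (w : diff_form (lie_space G) k),
      C k w = T k (pullback
        (fun z : prod_space (lie_space G) (lie_space G) =>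
           (z.1 * z.2)%g : lie_space G) w).

End AlgebraicData.

(* Main.v *)
From HB Require Import structures.
Require Import Defs.
From mathcomp Require Import all_boot all_order all_algebra perm.
From mathcomp Require Import all_classical all_reals all_analysis.
From mathcomp Require Import ring lra.

(** Differentiating along left-invariant fields commutes with right-invariant
    fields, so [(p, v (x) alpha)(om)] is [v] applied at [p] to the function
    [om(alpha^R)], where [alpha^R] is the right-invariant multivector field.
    For monomials [v] and [w], [A (x) B] is therefore explicit on forms of the
    product [G x G]: evaluate on the right-invariant fields of both factors, then
    differentiate along the left-invariant fields of [v] (first factor) and [w]
    (second factor).  On [m^* om] the evaluation gives the function
    [(g, h) |-> om_{gh}(alpha /\ Ad_g beta)]; a left derivative along [x] in [g]
    acts on the base point through [Ad_q^-1 x] and on [Ad_g beta] through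
    [Ad_g [x, beta]], which is the coproduct formula.

    The commutation is proved by induction on the degree of [om], from the Leibniz
    rule and the identity
    [chi om = 1/(k+1) sum_l d gamma_l /\ i_{E_l} om]
    for coordinate functions [gamma_l] and coordinate fields [E_l] cut off by bump
    functions, which reduces it to the 1-forms [d gamma_l], hence to the symmetry
    of second derivatives. *)

Set Implicit Arguments.
Unset Strict Implicit.
Unset Printing Implicit Defensive.

Import Order.TTheory GRing.Theory Num.Theory.
Import numFieldNormedType.Exports.

Local Open Scope classical_set_scope.
Local Open Scope ring_scope.

(** * Smooth functions on open subsets of normed spaces *)

(** The operators of the statement are given by axioms, and each axiom shapes a part of the proof.
    [rho] is known on functions, wedge products and differentials, and locality is not among its
    axioms: multiplying a form by a cut-off [chi] with value 1 at the point, then cancelling the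
    extra Leibniz term, takes its place. [ev] is prescribed on products of generators and [U] by its
    universal property, so everything is reduced by linearity to words in the generators;
    [monomial_span] records that this is possible. [Delta] is a list of pairs determined up to
    [tensor_eq], so it can only be manipulated inside a bilinear expression. [E] carries no
    topology, so a derivative of an [E]-valued function is taken on the scalar coefficients of a
    finite expansion. Finally, [is_convolution] asks for a tensor product that is a current, hence
    for a seminorm estimate: the candidate is a composite of vector fields taken at one point, and
    it is expanded there into finitely many partial derivatives of coefficients of the form. *)

Section SmoothAt.
Variable R : realType.
Implicit Types V W : normedModType R.

Lemma Ck_sub V W k (U U' : set V) (f : V -> W) :
  U' `<=` U -> Ck k U f -> Ck k U' f.
Proof.
move=> sU; elim: k f => [|k IH] f /= Cf; first by move=> x /sU; exact: Cf.
by case: Cf => df Cf; split=> [x /sU|v]; [exact: df|exact/IH/Cf].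
Qed.

Lemma CkSP V W k (U : set V) (f : V -> W) : Ck k.+1 U f <->
  (forall x, U x -> differentiable f x) /\ (forall v, Ck k U ('D_v f)).
Proof. by []. Qed.

(** [Ck] asks for derivatives of [f] as a function on the whole space, taken at the points of the
    set, so it is a pointwise condition and passes to unions of arbitrary sets. *)
Lemma Ck_local V W k (U : set V) (f : V -> W) :
  (forall x, U x -> exists2 N, N x & Ck k N f) -> Ck k U f.
Proof.
elim: k f => [|k IH] f /= H; first by move=> x /H[N Nx]; apply.
split=> [x /H[N Nx []]|v]; first by move=> + _; apply.
by apply: IH => x /H[N Nx [_ Cf]]; exists N.
Qed.

Lemma CkS V W k (U : set V) (f : V -> W) : Ck k.+1 U f -> Ck k U f.
Proof.
elim: k f => [|k IH] f /= [df Cf].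
  by move=> x Ux; exact/differentiable_continuous/df.
by split=> [x|v]; [exact: df|exact/IH/Cf].
Qed.

Lemma Ck_cst V W k (U : set V) (a : W) : Ck k U (fun _ => a).
Proof.
case: k => [|k] /=; first by move=> x _; exact: cst_continuous.
split=> [x _|v]; first exact: differentiable_cst.
rewrite (_ : 'D_v _ = fun _ => 0); first exact: Ck0.
by apply/funext => x; exact: derive_cst.
Qed.

Lemma Ck_sum V W k (U : set V) (I : Type) (r : seq I) (P : pred I)
    (f : I -> V -> W) : open U ->
  (forall i, P i -> Ck k U (f i)) -> Ck k U (fun x => \sum_(i <- r | P i) f i x).
Proof.
move=> oU Cf; elim: r => [|i r IH].
  by apply: (eq_Ck oU _ (@Ck0 _ _ _ k U)) => x _; rewrite big_nil.
case Pi: (P i); last first.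
  by apply: (eq_Ck oU _ IH) => x _; rewrite big_cons Pi.
by apply: (eq_Ck oU _ (CkD oU (Cf i Pi) IH)) => x _; rewrite big_cons Pi.
Qed.

Lemma CkM V k (U : set V) (f g : V -> R) :
  open U -> Ck k U f -> Ck k U g -> Ck k U (fun x => f x * g x).
Proof.
move=> oU; elim: k f g => [|k IH] f g.
  by move=> /= Cf Cg x Ux; apply: continuousM; [exact: Cf|exact: Cg].
move=> Sf Sg; have /CkSP[df Cf] := Sf; have /CkSP[dg Cg] := Sg.
apply/CkSP; split=> [x Ux|v].
  by apply: differentiableM; [exact: df|exact: dg].
apply: (@eq_Ck _ _ _ _ _ (fun x => f x * 'D_v g x + g x * 'D_v f x)) => //.
  move=> x Ux; rewrite deriveM //; apply: diff_derivable; [exact: df|exact: dg].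
by apply: CkD => //; apply: IH => //; exact: CkS.
Qed.

Lemma differentiable_expansion V W n (g : 'I_n -> V -> R) (e : 'I_n -> W) x :
  (forall i, differentiable (g i) x) ->
  differentiable (fun x => \sum_i g i x *: e i) x.
Proof.
move=> dg; have -> : (fun x => \sum_i g i x *: e i) = \sum_i (fun x => g i x *: e i).
  by apply/funext => y; rewrite fct_sumE.
by apply: differentiable_sum => i; exact: differentiableZl.
Qed.

Lemma derive_comp_expansion V W W' n (g : 'I_n -> V -> R) (e : 'I_n -> W)
    (f : W -> W') x v :
  (forall i, differentiable (g i) x) ->
  differentiable f (\sum_i g i x *: e i) ->
  'D_v (fun x => f (\sum_i g i x *: e i)) x =
  \sum_i 'D_v (g i) x *: 'D_(e i) f (\sum_i g i x *: e i).
Proof.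
move=> dg df; have dG := differentiable_expansion e dg.
set G := (fun x => \sum_i g i x *: e i) in dG.
have -> : (fun x => f (\sum_i g i x *: e i)) = f \o G by [].
rewrite deriveE; last exact: differentiable_comp.
rewrite diff_comp //=.
have -> : 'd G x v = \sum_i 'D_v (g i) x *: e i.
  rewrite -deriveE // /G.
  have -> : (fun x => \sum_i g i x *: e i) = \sum_i (fun x => g i x *: e i).
    by apply/funext => y; rewrite fct_sumE.
  rewrite derive_sum => [|i]; last first.
    by apply: diff_derivable; exact: differentiableZl.
  apply: eq_bigr => i _; rewrite deriveE; last exact: differentiableZl.
  by rewrite diffZl // deriveE.
by rewrite linear_sum; apply: eq_bigr => i _; rewrite linearZ -deriveE.
Qed.

Lemma continuous_expansion V W n (g : 'I_n -> V -> R) (e : 'I_n -> W) x :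
  (forall i, {for x, continuous (g i)}) ->
  {for x, continuous (fun x => \sum_i g i x *: e i)}.
Proof.
move=> cg; have -> : (fun x => \sum_i g i x *: e i) = \sum_i (fun x => g i x *: e i).
  by apply/funext => y; rewrite fct_sumE.
elim/big_ind: _ => [|u v cu cv|i _]; first exact: cst_continuous.
  exact: continuousD.
by apply: continuousZr_tmp; exact: cg.
Qed.

(** The inner map is given by finitely many scalar coefficients along fixed vectors, so the chain
    rule yields a finite sum of products of scalar functions, and the induction on [k] closes with
    [CkM] and [Ck_sum]. *)
Lemma Ck_comp_expansion V W k (U : set V) (N : set W) n (g : 'I_n -> V -> R)
    (e : 'I_n -> W) (f : W -> R) :
  open U -> (forall x, U x -> N (\sum_i g i x *: e i)) ->
  (forall i, Ck k U (g i)) -> Ck k N f ->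
  Ck k U (fun x => f (\sum_i g i x *: e i)).
Proof.
move=> oU gUN; elim: k f => [|k IH] f Cg.
  move: Cg => /= Cg Cf x Ux.
  apply: (@continuous_comp _ _ _ (fun x => \sum_i g i x *: e i) f); last exact/Cf/gUN.
  by apply: continuous_expansion => i; exact: Cg.
move=> /CkSP[df Cf]; have dg i x : U x -> differentiable (g i) x.
  by move=> Ux; have /CkSP[+ _] := Cg i; apply.
apply/CkSP; split=> [x Ux|v].
  apply: (@differentiable_comp _ _ _ _ (fun x => \sum_i g i x *: e i) f).
    by apply: differentiable_expansion => i; exact: dg.
  exact/df/gUN.
apply: (@eq_Ck _ _ _ _ _ (fun x =>
  \sum_i 'D_v (g i) x * 'D_(e i) f (\sum_i g i x *: e i))) => //.
  move=> x Ux; rewrite derive_comp_expansion // => [i|]; first exact: dg.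
  exact/df/gUN.
apply: Ck_sum => // i _; apply: CkM => //; first by have /CkSP[_ Ci] := Cg i; exact: Ci.
by apply: (IH ('D_(e i) f)) => [j|]; [exact: CkS|exact: Cf].
Qed.

(** Smoothness on a neighbourhood of the point, which makes the notion stable under derivatives and
    under changing the function away from the point. *)
Definition smooth_at V W (f : V -> W) (x : V) :=
  exists N, [/\ open N, N x & smooth_on N f].

Lemma smooth_onP V W (U : set V) (f : V -> W) : open U ->
  smooth_on U f <-> forall x, U x -> smooth_at f x.
Proof.
move=> oU; split=> [sf x Ux|sf k]; first by exists U.
by apply: Ck_local => x /sf[N [_ Nx Cf]]; exists N => //; exact: Cf.
Qed.

Lemma smooth_on_at V W (U : set V) (f : V -> W) x :
  open U -> smooth_on U f -> U x -> smooth_at f x.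
Proof. by move=> oU /(smooth_onP _ oU); exact. Qed.

Lemma smooth_at_near V W (f : V -> W) x :
  smooth_at f x -> \near x, smooth_at f x.
Proof.
move=> [N [oN Nx sf]]; apply: filterS (open_nbhs_nbhs (conj oN Nx)) => y Oy.
by exists N.
Qed.

Lemma near_open (T : topologicalType) (P : T -> Prop) x :
  (\near x, P x) -> exists N, [/\ open N, N x & forall y, N y -> P y].
Proof.
move=> Px; have : nbhs x P by exact: Px.
by rewrite nbhsE => -[N [oN Nx] NP]; exists N; split.
Qed.

Lemma eq_smooth_at V W (f g : V -> W) x :
  (\near x, f x = g x) -> smooth_at f x -> smooth_at g x.
Proof.
move=> /near_open[P [oP Px fg]] [N [oN Nx sf]].
exists (N `&` P); split; [exact: openI|by []|move=> k].
apply: (@eq_Ck _ _ _ _ _ f); first exact: openI.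
  by move=> y [_ /fg].
by apply: Ck_sub (sf k) => y [].
Qed.

Lemma smooth_at_differentiable V W (f : V -> W) x :
  smooth_at f x -> differentiable f x.
Proof. by move=> [N [oN Nx /(_ 1%N)[+ _]]]; exact. Qed.

Lemma smooth_at_continuous V W (f : V -> W) x :
  smooth_at f x -> {for x, continuous f}.
Proof.
by move=> /smooth_at_differentiable; exact: differentiable_continuous.
Qed.

Lemma smooth_at_derivable V W (f : V -> W) x v :
  smooth_at f x -> derivable f x v.
Proof. by move=> /smooth_at_differentiable; exact: diff_derivable. Qed.

Lemma smooth_at_derive V W (f : V -> W) x v :
  smooth_at f x -> smooth_at ('D_v f) x.
Proof.
move=> [N [oN Nx sf]]; exists N; split=> // k.
by have /CkSP[_ Ckf] := sf k.+1; exact: Ckf.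
Qed.

Lemma smooth_at_cst V W (a : W) (x : V) : smooth_at (fun _ => a) x.
Proof. by exists setT; split=> [|//|k]; [exact: openT|exact: Ck_cst]. Qed.

Lemma smooth_atD V W (f g : V -> W) x : smooth_at f x -> smooth_at g x ->
  smooth_at (fun x => f x + g x) x.
Proof.
move=> [N [oN Nx sf]] [P [oP Px sg]]; exists (N `&` P).
split; [exact: openI|by []|move=> k]; apply: CkD; first exact: openI.
  by apply: Ck_sub (sf k) => y [].
by apply: Ck_sub (sg k) => y [].
Qed.

Lemma smooth_atM V (f g : V -> R) x : smooth_at f x -> smooth_at g x ->
  smooth_at (fun x => f x * g x) x.
Proof.
move=> [N [oN Nx sf]] [P [oP Px sg]]; exists (N `&` P).
split; [exact: openI|by []|move=> k]; apply: CkM; first exact: openI.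
  by apply: Ck_sub (sf k) => y [].
by apply: Ck_sub (sg k) => y [].
Qed.

Lemma smooth_at_sum V W (I : Type) (r : seq I) (P : pred I) (f : I -> V -> W) x :
  (forall i, P i -> smooth_at (f i) x) ->
  smooth_at (fun x => \sum_(i <- r | P i) f i x) x.
Proof.
move=> sf; elim: r => [|i r IH].
  rewrite (_ : (fun _ => _) = fun _ => 0); first exact: smooth_at_cst.
  by apply/funext => y; rewrite big_nil.
case Pi: (P i).
  rewrite (_ : (fun _ => _) = fun y => f i y + \sum_(i <- r | P i) f i y).
    by apply: smooth_atD => //; exact: sf.
  by apply/funext => y; rewrite big_cons Pi.
by under eq_fun do rewrite big_cons Pi.
Qed.

Lemma smooth_at_prod V (I : Type) (r : seq I) (P : pred I) (f : I -> V -> R) x :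
  (forall i, P i -> smooth_at (f i) x) ->
  smooth_at (fun x => \prod_(i <- r | P i) f i x) x.
Proof.
move=> sf; elim: r => [|i r IH].
  rewrite (_ : (fun _ => _) = fun _ => 1); first exact: smooth_at_cst.
  by apply/funext => y; rewrite big_nil.
case Pi: (P i).
  rewrite (_ : (fun _ => _) = fun y => f i y * \prod_(i <- r | P i) f i y).
    by apply: smooth_atM => //; exact: sf.
  by apply/funext => y; rewrite big_cons Pi.
by under eq_fun do rewrite big_cons Pi.
Qed.

Lemma smooth_at_linear V W (f : V -> W) x :
  linear f -> continuous f -> smooth_at f x.
Proof.
move=> lf cf; exists setT; split=> //; first exact: openT.
pose fM := GRing.isLinear.Build _ _ _ _ _ lf.
pose fL : {linear _ -> _} := HB.pack f fM.
have df y : differentiable f y by exact: (@linear_differentiable _ _ _ fL).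
have Df v : 'D_v f = fun _ => f v.
  by apply/funext => y; rewrite deriveE // (@diff_lin _ _ _ fL).
case=> [|k] /=; first by move=> y _; exact: cf.
by split=> [//|v]; rewrite Df; exact: Ck_cst.
Qed.

Lemma smooth_at_comp_expansion V W n (g : 'I_n -> V -> R) (e : 'I_n -> W)
    (f : W -> R) x :
  (forall i, smooth_at (g i) x) -> smooth_at f (\sum_i g i x *: e i) ->
  smooth_at (fun x => f (\sum_i g i x *: e i)) x.
Proof.
move=> sg [N [oN Nx sf]].
have : \near x, (forall i, smooth_at (g i) x) /\ N (\sum_i g i x *: e i).
  near=> y; split; last first.
    near: y; apply: continuous_expansion => [i|]; last exact: open_nbhs_nbhs.
    exact: smooth_at_continuous.
  by near: y; apply: filter_forall => i; exact: smooth_at_near.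
move=> /near_open[P [oP Px Psg]].
exists P; split=> // k.
apply: (@Ck_comp_expansion _ _ _ _ N) => // [y|i]; first by case/Psg.
by move: k; apply/(smooth_onP _ oP) => y /Psg[].
Unshelve. all: by end_near. Qed.

Lemma smooth_at_row n (f : 'rV[R]_n -> R) V (g : V -> 'rV[R]_n) x :
  (forall i, smooth_at (fun x => g x 0 i) x) -> smooth_at f (g x) ->
  smooth_at (fun x => f (g x)) x.
Proof.
move=> sg sf.
have ge y : g y = \sum_i g y 0 i *: delta_mx 0 i by exact: row_sum_delta.
under eq_fun do rewrite ge.
by apply: smooth_at_comp_expansion => //; rewrite -ge.
Qed.

Lemma derive_row n (f : 'rV[R]_n -> R) V (g : V -> 'rV[R]_n) x v :
  (forall i, smooth_at (fun x => g x 0 i) x) -> smooth_at f (g x) ->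
  'D_v (fun x => f (g x)) x =
  \sum_i 'D_v (fun x => g x 0 i) x * 'D_(delta_mx 0 i) f (g x).
Proof.
move=> sg sf.
have ge y : g y = \sum_i g y 0 i *: delta_mx 0 i by exact: row_sum_delta.
under eq_fun do rewrite ge.
rewrite derive_comp_expansion => [|i|]; last 2 first.
- exact: smooth_at_differentiable.
- by rewrite -ge; exact: smooth_at_differentiable.
by under eq_bigr do rewrite -ge.
Qed.

Lemma smooth_at_scalar (f : R -> R) V (g : V -> R) x :
  smooth_at g x -> smooth_at f (g x) -> smooth_at (fun x => f (g x)) x.
Proof.
move=> sg sf.
have ge y : g y = \sum_(i < 1) g y *: 1 by rewrite big_ord1 [LHS](esym (mulr1 _)).
under eq_fun do rewrite ge.
by apply: (@smooth_at_comp_expansion _ _ _ (fun=> g)) => //; rewrite -ge.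
Qed.

Lemma smooth_at_coord n (x : 'rV[R]_n) i :
  smooth_at (fun y : 'rV[R]_n => y 0 i : R) x.
Proof.
apply: smooth_at_linear; first by move=> a u v; rewrite !mxE.
exact: coord_continuous.
Qed.

Lemma derive_coord n (x u : 'rV[R]_n) i :
  'D_u (fun y : 'rV[R]_n => y 0 i : R) x = u 0 i.
Proof.
have lf : linear (fun y : 'rV[R]_n => y 0 i : R) by move=> a v w; rewrite !mxE.
pose fM := GRing.isLinear.Build _ _ _ _ _ lf.
pose fL : {linear _ -> _} := HB.pack (fun y : 'rV[R]_n => y 0 i : R) fM.
rewrite deriveE; last by apply: smooth_at_differentiable; exact: smooth_at_coord.
by rewrite (@diff_lin _ _ _ fL) //; exact: coord_continuous.
Qed.

Lemma derive_expand n (f : 'rV[R]_n -> R) x u : differentiable f x ->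
  'D_u f x = \sum_i u 0 i * 'D_(delta_mx 0 i) f x.
Proof.
move=> df; rewrite deriveE // {1}(row_sum_delta u) linear_sum.
by apply: eq_bigr => i _; rewrite linearZ -deriveE.
Qed.

(** The derivative of the inverse is a product of inverses and a constant, so the induction on [k]
    feeds on itself. *)
Lemma smooth_at_inv (x : R) : x != 0 -> smooth_at (fun y : R => y^-1) x.
Proof.
have oN : open [set y : R | y != 0] by exact: open_neq.
move=> x0; exists [set y | y != 0]; split=> // k.
have dV y : y != 0 -> differentiable (fun y : R => y^-1) y.
  by move=> y0; apply: differentiableV.
elim: k => [y /dV|k IH]; first exact: differentiable_continuous.
apply/CkSP; split=> [//|v].
apply: (@eq_Ck _ _ _ _ _ (fun y : R => y^-1 * y^-1 * - v)) => //.
  move=> y y0; rewrite (@deriveV _ _ id) //.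
  by rewrite derive_id scaleNr /GRing.scale /= mulrN -invfM.
by do 2?apply: CkM => //; exact: Ck_cst.
Qed.

End SmoothAt.

(** * Symmetry of second derivatives *)

Section Schwarz.
Variables (R : realType) (V : normedModType R).

Lemma is_derive_line (f : V -> R) c u (s : R) :
  differentiable f (c + s *: u) ->
  is_derive s 1 (fun s => f (c + s *: u)) ('D_u f (c + s *: u)).
Proof.
move=> df; pose l (s : R) := c + s *: u.
have dl : is_diff s l ( *:%R^~ u).
  rewrite (_ : l = cst c + ( *:%R^~ u)); last by apply/funext.
  by apply: is_diff_eq; rewrite add0r.
have dfl : differentiable (f \o l) s by apply: differentiable_comp.
apply: DeriveDef; first by apply: diff_derivable.
rewrite deriveE // diff_comp // /= diff_val scale1r -deriveE //.
Qed.

Lemma mean_value_line (f : V -> R) c u (h : R) : 0 < h ->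
  (forall s, 0 <= s <= h -> differentiable f (c + s *: u)) ->
  exists2 s, 0 <= s <= h & f (c + h *: u) - f c = h * 'D_u f (c + s *: u).
Proof.
move=> h0 df.
have [| |s] := @MVT_segment R (fun s => f (c + s *: u))
  (fun s => 'D_u f (c + s *: u)) 0 h (ltW h0).
- move=> s; rewrite in_itv /= => /andP[s0 sh].
  by apply: is_derive_line; apply: df; rewrite !ltW.
- apply: derivable_within_continuous => s; rewrite in_itv /= => sh.
  by have := is_derive_line (df s sh).
rewrite in_itv /= => sh; rewrite scale0r addr0 subr0 mulrC => E.
by exists s.
Qed.

(* Two applications of the mean value theorem; the left-hand side is symmetric in
   [u] and [v]. *)
Lemma second_difference (f : V -> R) x u v (h : R) : 0 < h ->
  (forall s t, 0 <= s <= h -> 0 <= t <= h -> smooth_at f (x + s *: u + t *: v)) ->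
  exists s t, [/\ 0 <= s <= h, 0 <= t <= h &
    f (x + h *: u + h *: v) - f (x + h *: u) - f (x + h *: v) + f x =
    h * h * 'D_v ('D_u f) (x + s *: u + t *: v)].
Proof.
move=> h0 sf; have hh : 0 <= h <= h by rewrite lexx ltW.
have h00 : 0 <= (0 : R) <= h by rewrite lexx ltW.
pose g y := f (y + h *: v) - f y.
have dg s : 0 <= s <= h -> differentiable (fun y => f (y + h *: v)) (x + s *: u).
  move=> sh; apply: (@differentiable_comp _ _ _ _ (fun y => y + h *: v)).
    by apply: differentiableD.
  exact/smooth_at_differentiable/sf.
have dg' s : 0 <= s <= h -> differentiable f (x + s *: u).
  move=> sh; apply: smooth_at_differentiable.
  by have := sf s 0 sh h00; rewrite scale0r addr0.
have [s sh] := @mean_value_line g x u h h0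
  (fun s sh => differentiableB (dg s sh) (dg' s sh)).
have -> : 'D_u g (x + s *: u) =
    'D_u f (x + s *: u + h *: v) - 'D_u f (x + s *: u).
  rewrite /g (_ : (fun y => f (y + h *: v) - f y) = (fun y => f (y + h *: v)) - f);
    last by [].
  rewrite deriveB; [|exact/diff_derivable/dg|exact/diff_derivable/dg'].
  congr (_ - _).
  have dfs : differentiable f (x + s *: u + h *: v) by exact/smooth_at_differentiable/sf.
  have ds : is_diff (x + s *: u) (fun y => y + h *: v) id.
    by rewrite (_ : (fun y => y + h *: v) = id + cst (h *: v)) //;
       apply: is_diff_eq; rewrite addr0.
  rewrite deriveE; last exact: dg.
  rewrite (_ : (fun y => f (y + h *: v)) = f \o (fun y => y + h *: v)) //.
  by rewrite diff_comp //= diff_val -deriveE.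
have [|t th E2] := @mean_value_line ('D_u f) (x + s *: u) v h h0.
  by move=> t th; apply/smooth_at_differentiable/smooth_at_derive/sf.
rewrite E2 => E1; exists s, t; split=> //.
by rewrite -mulrA -E1 /g opprB addrA addrAC.
Qed.

(** One second difference over a small parallelogram equals [h * h] times either mixed derivative,
    each taken at some point of the parallelogram; continuity compares both with their values at
    [x]. *)
Lemma schwarz (f : V -> R) x u v : smooth_at f x ->
  'D_u ('D_v f) x = 'D_v ('D_u f) x.
Proof.
have swap (a b c d : R) : a - b - c + d = a - c - b + d by rewrite (addrAC a).
have close (a b c e : R) : `|a - c| < e / 2 -> `|b - c| < e / 2 -> `|a - b| <= e.
  move=> ac bc; have -> : a - b = (a - c) - (b - c) by ring.
  by rewrite (le_trans (ler_normB _ _)) // (splitr e) lerD // ltW.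
move=> sf; apply/eqP; rewrite -subr_eq0 -normr_le0; apply/ler_addgt0Pl => e e0.
have C1 : {for x, continuous ('D_u ('D_v f))}.
  by apply: smooth_at_continuous; do 2!apply: smooth_at_derive.
have C2 : {for x, continuous ('D_v ('D_u f))}.
  by apply: smooth_at_continuous; do 2!apply: smooth_at_derive.
have e20 : 0 < e / 2 by rewrite divr_gt0.
have : \forall y \near x, [/\ smooth_at f y,
    `|'D_u ('D_v f) x - 'D_u ('D_v f) y| < e / 2 &
    `|'D_v ('D_u f) x - 'D_v ('D_u f) y| < e / 2].
  have N1 := smooth_at_near sf.
  have /cvgrPdist_lt/(_ _ e20) N2 := C1.
  have /cvgrPdist_lt/(_ _ e20) N3 := C2.
  apply: filterS3 N1 N2 N3.
  move=> y A1 A2 A3; exact: And3 A1 A2 A3.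
move=> /nbhs_ballP[d /= d0 dP].
(* With this [h] the parallelogram lies within [d / 2] of [x]; the summand 1 keeps the denominator
   positive when [u] and [v] vanish. *)
pose h := d / (2 * (`|u| + `|v| + 1)).
have uv0 : 0 < `|u| + `|v| + 1 by rewrite ltr_wpDl // addr_ge0.
have h0 : 0 < h by rewrite divr_gt0 // mulr_gt0.
have inb s t : 0 <= s <= h -> 0 <= t <= h -> ball x d (x + s *: u + t *: v).
  move=> /andP[s0 sh] /andP[t0 th].
  rewrite -ball_normE /ball_ /= -addrA opprD addrA subrr add0r normrN.
  rewrite (le_lt_trans (ler_normD _ _)) // !normrZ !ger0_norm //.
  have : s * `|u| + t * `|v| <= h * (`|u| + `|v| + 1).
    rewrite !mulrDr -[leLHS]addr0; apply: lerD; last by rewrite mulr1 ltW.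
    by apply: lerD; apply: ler_wpM2r.
  move=> /le_lt_trans; apply; rewrite /h invfM mulrA mulfVK ?gt_eqF //.
  by rewrite ltr_pdivrMr // ltr_pMr // ltr1n.
have smo s t : 0 <= s <= h -> 0 <= t <= h -> smooth_at f (x + s *: u + t *: v).
  by move=> sh th; have [] := dP _ (inb s t sh th).
have smo' s t : 0 <= s <= h -> 0 <= t <= h -> smooth_at f (x + s *: v + t *: u).
  by move=> sh th; rewrite addrAC; exact: smo.
have [s [t [sh th E1]]] := second_difference h0 smo.
have [s' [t' [sh' th' E2]]] := second_difference h0 smo'.
have [_ _] := dP _ (inb _ _ sh th).
have [_ + _] := dP _ (inb _ _ th' sh').
(* The two second differences have the same terms in another order, so the mixed derivatives agree,
   though at two different points. *)
have -> : 'D_v ('D_u f) (x + s *: u + t *: v) =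
          'D_u ('D_v f) (x + t' *: u + s' *: v).
  rewrite (addrAC x (t' *: u)); apply: (@mulfI _ (h * h)).
    by rewrite mulf_neq0 // gt_eqF.
  apply: (etrans (esym E1)); apply: (etrans _ E2).
  rewrite (addrAC x (h *: v) (h *: u)); exact: swap.
move=> ac bc; rewrite addr0; exact: close ac bc.
Qed.

End Schwarz.

(** * Bump functions *)

Section Bump.
Variable R : realType.

(** All exponents are kept because the derivative of [flat n] is a combination of [flat n.+2] and
    [flat n.+1]: the whole family is shown smooth by one induction. *)
Definition flat n (x : R) : R := if 0 < x then x^-1 ^+ n * expR (- x^-1) else 0.

(** Raise [t / n.+1 <= exp (t / n.+1)], for [t = x^-1], to the power [n.+1]. The spare factor [x] on
    the right gives the limits at 0. *)
Lemma flat_bound n (x : R) : 0 < x ->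
  x^-1 ^+ n * expR (- x^-1) <= n.+1%:R ^+ n.+1 * x.
Proof.
move=> x0; have t0 : 0 < x^-1 by rewrite invr_gt0.
have E : (x^-1 / n.+1%:R) ^+ n.+1 <= expR x^-1.
  have -> : expR x^-1 = expR (x^-1 / n.+1%:R) ^+ n.+1.
    by rewrite -expRM_natl mulrC divfK // pnatr_eq0.
  rewrite lerXn2r ?nnegrE ?expR_ge0 ?divr_ge0 // ?(ltW t0) //.
  by rewrite (le_trans _ (expR_ge1Dx _)) // lerDr.
rewrite expRN -ler_pdivlMr ?invr_gt0 ?expR_gt0 // invrK.
move: E; rewrite expr_div_n ler_pdivrMr ?exprn_gt0 //.
rewrite exprSr ler_pdivrMr // => /le_trans; apply.
by rewrite le_eqVlt; apply/orP; left; apply/eqP; ring.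
Qed.

Lemma flat_derive n (x : R) :
  is_derive x 1 (flat n) (flat n.+2 x - n%:R * flat n.+1 x).
Proof.
have [x0|x0|->] := ltgtP x 0.
- rewrite /flat !ltNge (ltW x0) /= mulr0 subr0.
  apply: near_eq_is_derive (is_derive_cst 0 x 1).
  near=> y; rewrite ifF //; apply/negbTE; rewrite -leNgt ltW //.
  by near: y; exact: lt_nbhsl.
- rewrite /flat x0.
  apply: (@near_eq_is_derive _ _ _ (fun y : R => y^-1 ^+ n * expR (- y^-1))).
    near=> y; rewrite ifT //.
    by near: y; exact: lt_nbhsr.
  have x0' : x != 0 by rewrite gt_eqF.
  have dV : is_derive x 1 (fun y : R => y^-1) (- x ^- 2).
    apply: DeriveDef; first exact: (@derivableV _ _ id).
    by rewrite (@deriveV _ _ id) // derive_id /GRing.scale /= mulr1.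
  have dN : is_derive x 1 (fun y : R => - y^-1) (x ^- 2).
    by rewrite -[x ^- 2]opprK; apply: (@is_deriveN _ _ _ (fun y : R => y^-1)).
  have dE := @is_derive1_comp _ expR (fun y : R => - y^-1) x _ _ (is_derive_expR _) dN.
  have dX := @is_deriveX _ _ (fun y : R => y^-1) n x 1 _ dV.
  have := is_deriveM dX dE.
  rewrite mulrfctE exprfctE /= => D; apply: is_derive_eq.
  rewrite /GRing.scale /= -!exprVn.
  case: n {dX D} => [|n]; last by rewrite /= !exprS; ring.
  by rewrite !exprS expr0; ring.
rewrite /flat ltxx mulr0 subr0.
have L : (fun h : R => h^-1 *: (flat n (h *: 1 + 0) - flat n 0)) @ 0^' --> (0 : R).
  apply/cvgrPdist_le => e e0.
  (* For [h > 0] the difference quotient at 0 is [h^-1 ^+ n.+1 * expR (- h^-1)], and [c] is the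
     constant of [flat_bound] at [n.+1]. *)
  pose c : R := n.+2%:R ^+ n.+2.
  have c0 : 0 < c by rewrite exprn_gt0.
  near=> h; rewrite sub0r normrN addr0 /flat ltxx subr0 /GRing.scale /= mulr1.
  case: ifPn => [h0|_]; last by rewrite mulr0 normr0 ltW.
  rewrite mulrA -exprS ger0_norm; last first.
    by rewrite mulr_ge0 ?expR_ge0 // exprn_ge0 // invr_ge0 ltW.
  rewrite (le_trans (flat_bound _ h0)) // -/c -ler_pdivlMl // mulrC.
  rewrite (le_trans (ler_norm _)) //; near: h.
  apply: nbhs_dnbhs; apply/nbhs_ballP; exists (e / c); first by rewrite /= divr_gt0.
  by move=> y; rewrite /ball /= sub0r normrN => /ltW.
apply: DeriveDef; first by apply/cvg_ex; exists 0.
exact: cvg_lim.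
Unshelve. all: by end_near. Qed.

Lemma smooth_flat n (x : R) : smooth_at (flat n) x.
Proof.
have dF m y : differentiable (flat m) y.
  by apply/derivable1_diffP; have := flat_derive m y.
exists setT; split=> //; first exact: openT.
move=> k; elim: k n => [|k IH] n.
  by move=> y _; exact: differentiable_continuous.
apply/CkSP; split=> [y _|v]; first exact: dF.
apply: (@eq_Ck _ _ _ _ _
  (fun y => v * (flat n.+2 y + - n%:R * flat n.+1 y))); first exact: openT.
  move=> y _; rewrite deriveE //.
  have -> : v = v *: (1 : R) by rewrite /GRing.scale /= mulr1.
  rewrite linearZ -deriveE //; have D := flat_derive n y.
  by rewrite derive_val /GRing.scale /= mulr1 mulNr.
apply: CkM; [exact: openT|exact: Ck_cst|].
by apply: CkD; [exact: openT|exact: IH|apply: CkM; [exact: openT|exact: Ck_cst|]].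
Qed.

(** The usual smooth transition from 0 to 1; the denominator is positive because [x] and [1 - x] are
    never both nonpositive. *)
Definition step (x : R) : R := flat 0 x / (flat 0 x + flat 0 (1 - x)).

Lemma flat_gt0 (x : R) : 0 < x -> 0 < flat 0 x.
Proof. by move=> x0; rewrite /flat x0 mul1r expR_gt0. Qed.

Lemma flat_le0 n (x : R) : x <= 0 -> flat n x = 0.
Proof. by move=> x0; rewrite /flat ltNge x0. Qed.

Lemma flat_ge0 (x : R) : 0 <= flat 0 x.
Proof.
by have [x0|x0] := leP x 0; [rewrite flat_le0|rewrite ltW // flat_gt0].
Qed.

Lemma step0 (x : R) : x <= 0 -> step x = 0.
Proof. by move=> x0; rewrite /step flat_le0 // mul0r. Qed.

Lemma step1 (x : R) : 1 <= x -> step x = 1.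
Proof.
move=> x1; rewrite /step (@flat_le0 _ (1 - x)) ?subr_le0 // addr0 divff //.
by rewrite gt_eqF // flat_gt0 // (lt_le_trans ltr01).
Qed.

Lemma smooth_step (x : R) : smooth_at step x.
Proof.
have sid : smooth_at (@id R) x.
  by apply: smooth_at_linear => [a u v|y] //; exact: cvg_id.
have s1 : smooth_at (fun y : R => 1 - y) x.
  apply: (@eq_smooth_at _ _ _ (fun y : R => 1 + (-1) * y)).
    by near=> y; rewrite mulN1r.
  apply: smooth_atD; first exact: smooth_at_cst.
  by apply: smooth_atM => //; exact: smooth_at_cst.
have sd : smooth_at (fun y => flat 0 y + flat 0 (1 - y)) x.
  apply: smooth_atD; first exact: smooth_flat.
  by apply: (@smooth_at_scalar _ (flat 0)) => //; exact: smooth_flat.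
apply: smooth_atM; first exact: smooth_flat.
apply: (@smooth_at_scalar _ (fun y : R => y^-1)) => //.
apply: smooth_at_inv; rewrite gt_eqF //.
have [x0|x0] := leP x 0.
  by rewrite ltr_wpDl ?flat_ge0 // flat_gt0 // subr_gt0 (le_lt_trans x0).
by rewrite ltr_pwDl ?flat_ge0 // flat_gt0.
Unshelve. all: by end_near. Qed.

Lemma rV_bump n (y0 : 'rV[R]_n) (U : set 'rV[R]_n) : open U -> U y0 ->
  exists chi K, [/\ forall y, smooth_at chi y, \near y0, chi y0 = 1 :> R,
    compact K, K `<=` U & forall y, ~ K y -> chi y = 0].
Proof.
move=> oU Uy0; have /nbhs_ballP[e /= e0 eU] := open_nbhs_nbhs (conj oU Uy0).
(* The bump is 1 on the cube of half side [r] and 0 outside the cube [K] of half side [2 r]; since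
   [2 r < e], [K] stays in the ball of radius [e], which is a cube for the sup norm. *)
pose r := e / 4%:R; have r0 : 0 < r by rewrite divr_gt0.
pose c i (y : 'rV[R]_n) := r^-1 * (y 0 i - y0 0 i).
pose chi y := \prod_i (step (2%:R - c i y) * step (2%:R + c i y)).
pose K := [set y : 'rV[R]_n |
  forall i, `[y0 0 i - 2%:R * r, y0 0 i + 2%:R * r]%classic (y 0 i)].
have sc i y : smooth_at (c i) y.
  apply: smooth_atM; first exact: smooth_at_cst.
  by apply: smooth_atD; [exact: smooth_at_coord|exact: smooth_at_cst].
exists chi, K; split.
- move=> y; apply: smooth_at_prod => i _; apply: smooth_atM.
    apply: (@smooth_at_scalar _ step _ (fun y => 2%:R - c i y)); last exact: smooth_step.
    apply: (@eq_smooth_at _ _ _ (fun y => 2%:R + (-1) * c i y)).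
      by near=> z; rewrite mulN1r.
    apply: smooth_atD; first exact: smooth_at_cst.
    by apply: smooth_atM => //; exact: smooth_at_cst.
  apply: (@smooth_at_scalar _ step _ (fun y => 2%:R + c i y)); last exact: smooth_step.
  by apply: smooth_atD => //; exact: smooth_at_cst.
- near=> y; rewrite /chi big1 // => i _.
  have : `|c i y| <= 1.
    rewrite /c normrM normfV (gtr0_norm r0) ler_pdivrMl // mulr1 distrC ltW //.
    have : ball y0 r y by near: y; exact: nbhsx_ballx.
    by case=> _ /(_ 0 i).
  rewrite ler_norml => /andP[c1 c2].
  by rewrite !step1 ?mulr1 //; lra.
- apply: (@rV_compact R n (fun i => `[y0 0 i - 2%:R * r, y0 0 i + 2%:R * r]%classic)).
  by move=> i; exact: segment_compact.
- move=> y Ky; apply: eU; split=> // i j.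
  rewrite ord1; have := Ky j; rewrite /= in_itv /= => /andP[k1 k2].
  rewrite /ball /= ltr_norml; have : 2%:R * r < e by rewrite /r; lra.
  by move=> re; apply/andP; split; lra.
- move=> y Ky; apply/eqP; apply: contra_notT Ky => chi0 i /=.
  have : step (2%:R - c i y) * step (2%:R + c i y) != 0.
    by apply: contraNneq chi0 => E; rewrite /chi (bigD1 i) //= E mul0r.
  rewrite mulf_eq0 negb_or => /andP[s1 s2].
  have c2 : c i y < 2%:R.
    by rewrite ltNge; apply: contraNN s1 => ci; rewrite step0 // subr_le0.
  have c1 : - 2%:R < c i y.
    rewrite ltNge; apply: contraNN s2 => ci; rewrite step0 //; lra.
  rewrite in_itv /=; move: c1 c2; rewrite /c.
  rewrite ltr_pdivlMl // ltr_pdivrMl // => c1 c2.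
  by apply/andP; split; lra.
Unshelve. all: by end_near. Qed.

End Bump.

(** * Functions on manifolds *)

Lemma Ck_linear_comp (R : realType) (V W W' : normedModType R) k (U : set V)
    (f : V -> W) (l : W -> W') :
  linear l -> continuous l -> open U -> Ck k U f -> Ck k U (l \o f).
Proof.
move=> ll cl oU; pose lM := GRing.isLinear.Build _ _ _ _ _ ll.
pose lL : {linear _ -> _} := HB.pack l lM.
have dl y : differentiable l y by exact: (@linear_differentiable _ _ _ lL).
elim: k f => [|k IH] f.
  by move=> /= Cf x Ux; apply: continuous_comp; [exact: Cf|exact: cl].
move=> /CkSP[df Cf]; apply/CkSP; split=> [x Ux|v].
  by apply: differentiable_comp => //; exact: df.
apply: (eq_Ck oU _ (IH _ (Cf v))) => x Ux.
rewrite deriveE; last by apply: differentiable_comp => //; exact: df.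
rewrite diff_comp //=; last exact: df.
by rewrite (@diff_lin _ _ _ lL) // deriveE //; exact: df.
Qed.

Lemma smooth_at_component (R : realType) (V : normedModType R) n
    (f : V -> 'rV[R]_n) x i :
  smooth_at f x -> smooth_at (fun x => f x 0 i) x.
Proof.
move=> [N [oN Nx sf]]; exists N; split=> // k.
apply: (@Ck_linear_comp _ _ _ _ _ _ f (fun y : 'rV[R]_n => y 0 i : R)) => //.
  by move=> a u v; rewrite !mxE.
exact: coord_continuous.
Qed.

Section Functions.
Variables (R : realType) (M : chartedSpace R).
Notation n := (space_dim M).

Definition smooth_manifold := [/\ hausdorff_space M,
  forall x : M, exists2 c, atlas c & cdom c x
  & forall c d : chart R M n, atlas c -> atlas d ->
      smooth_on (ccod c `&` cinv c @^-1` cdom d) (cmap d \o cinv c)].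

Lemma smooth_funP (f : M -> R) : smooth_fun f <->
  forall c y, @atlas R M c -> ccod c y -> smooth_at (f \o cinv c) y.
Proof.
split=> [sf c y ac|sf c ac].
  by move: y; apply/smooth_onP; [exact: ccod_open|exact: sf].
by apply/smooth_onP; [exact: ccod_open|move=> y; exact: sf].
Qed.

Lemma smooth_fun_at (f : M -> R) c p : smooth_fun f -> atlas c -> cdom c p ->
  smooth_at (f \o cinv c) (cmap c p).
Proof. by move=> /smooth_funP sf ac cp; apply: sf => //; exact: cmap_cod. Qed.

Lemma smooth_fun_cst (a : R) : smooth_fun (fun _ : M => a).
Proof. by apply/smooth_funP => c y _ _; exact: smooth_at_cst. Qed.

Lemma smooth_funD (f g : M -> R) : smooth_fun f -> smooth_fun g ->
  smooth_fun (fun p => f p + g p).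
Proof.
move=> /smooth_funP sf /smooth_funP sg; apply/smooth_funP => c y ac cy.
by apply: (@smooth_atD _ _ _ (f \o cinv c) (g \o cinv c)); [exact: sf|exact: sg].
Qed.

Lemma smooth_funM (f g : M -> R) : smooth_fun f -> smooth_fun g ->
  smooth_fun (fun p => f p * g p).
Proof.
move=> /smooth_funP sf /smooth_funP sg; apply/smooth_funP => c y ac cy.
by apply: (@smooth_atM _ _ (f \o cinv c) (g \o cinv c)); [exact: sf|exact: sg].
Qed.

Lemma smooth_fun_sum (I : Type) (r : seq I) (P : pred I) (f : I -> M -> R) :
  (forall i, P i -> smooth_fun (f i)) ->
  smooth_fun (fun p => \sum_(i <- r | P i) f i p).
Proof.
move=> sf; apply/smooth_funP => c y ac cy.
apply: (@smooth_at_sum _ _ _ _ _ _ (fun i => f i \o cinv c)) => i Pi.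
by move/smooth_funP : (sf i Pi); apply.
Qed.

Lemma near_cinv (c : chart R M n) p (P : M -> Prop) : cdom c p ->
  (\near p, P p) -> \forall y \near cmap c p, P (cinv c y).
Proof.
move=> cp Pp; have := cinv_cont (cmap_cod cp); apply.
by rewrite cmapK.
Qed.

Lemma near_cmap (c : chart R M n) p (P : 'rV[R]_n -> Prop) : cdom c p ->
  (\forall y \near cmap c p, P y) -> \forall p \near p, P (cmap c p).
Proof. by move=> cp Pp; have := cmap_cont cp; apply. Qed.

Lemma near_cdom (c : chart R M n) p : cdom c p -> \forall p \near p, cdom c p.
Proof. by move=> cp; apply: open_nbhs_nbhs; split=> //; exact: cdom_open. Qed.

Lemma near_ccod (c : chart R M n) y : ccod c y -> \forall y \near y, ccod c y.
Proof. by move=> cp; apply: open_nbhs_nbhs; split=> //; exact: ccod_open. Qed.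

Definition extend0 (c : chart R M n) (g : 'rV[R]_n -> R) : M -> R :=
  fun p => if `[< cdom c p >] then g (cmap c p) else 0.

Lemma extend0E c g p : cdom c p -> extend0 c g p = g (cmap c p).
Proof. by move=> cp; rewrite /extend0; case: asboolP. Qed.

Lemma smooth_transition (c d : chart R M n) y :
  smooth_manifold -> atlas c -> atlas d -> ccod c y -> cdom d (cinv c y) ->
  smooth_at (cmap d \o cinv c) y.
Proof.
move=> [_ _ comp] ac ad cy dy.
have : \forall z \near y, (ccod c `&` cinv c @^-1` cdom d) z.
  near=> z; split; first by near: z; exact: near_ccod.
  near: z; apply: (cinv_cont cy); exact: near_cdom.
move=> /near_open[N [oN Ny NU]]; exists N; split=> // k.
exact: (Ck_sub NU (comp c d ac ad k)).
Unshelve. all: by end_near. Qed.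

(** The delicate points are those outside [cdom c]. The image of [K] under [cinv c] is compact,
    hence closed in a Hausdorff space, so the extension vanishes near such a point. *)
Lemma smooth_extend0 c g K : smooth_manifold -> atlas c ->
  (forall y, ccod c y -> smooth_at g y) -> compact K -> K `<=` ccod c ->
  (forall y, ~ K y -> g y = 0) -> smooth_fun (extend0 c g).
Proof.
move=> mM ac sg cK Kc g0; apply/smooth_funP => d y ad dy.
have [cy|ncy] := pselect (cdom c (cinv d y)).
  apply: (@eq_smooth_at _ _ _ (g \o (cmap c \o cinv d))).
    have : \forall z \near y, cdom c (cinv d z).
      by apply: (cinv_cont dy); exact: near_cdom.
    by apply: filterS => z cz; rewrite /= extend0E.
  have st := smooth_transition mM ad ac dy cy.
  apply: (@smooth_at_row _ _ g _ (cmap c \o cinv d)) => [i|].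
    exact: smooth_at_component.
  exact/sg/cmap_cod.
have [haus _ _] := mM.
have cl : closed (cinv c @` K).
  apply: compact_closed => //; apply: continuous_compact => //.
  apply: continuous_in_subspaceT => z; rewrite inE => Kz.
  exact/cinv_cont/Kc.
apply: (@eq_smooth_at _ _ _ (fun _ => 0)); last exact: smooth_at_cst.
have nK : (~` (cinv c @` K)) (cinv d y).
  by move=> [z Kz zy]; apply: ncy; rewrite -zy; exact/cinv_dom/Kc.
have : \forall z \near y, (~` (cinv c @` K)) (cinv d z).
  apply: (cinv_cont dy); apply: open_nbhs_nbhs; split=> //.
  exact: closed_openC.
apply: filterS => z nz; rewrite /= /extend0; case: asboolP => // cz.
by rewrite g0 // => Kz; apply: nz; exists (cmap c (cinv d z)) => //; rewrite cmapK.
Qed.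

(** Two nested bumps: [b] cuts off the coordinates and [chi] is supported where [b] is 1, so the
    cut-off coordinates are genuine near every point at which [chi] is nonzero. *)
Lemma local_coordinates (c : chart R M n) (p0 : M) : smooth_manifold -> atlas c -> cdom c p0 ->
  exists (chi : 'rV[R]_n -> R) (gam : 'I_n -> M -> R),
  [/\ exists K, [/\ compact K, K `<=` ccod c,
        forall y, ~ K y -> chi y = 0 & forall y, smooth_at chi y],
      forall l, smooth_fun (gam l),
      \forall p \near p0, cdom c p /\ chi (cmap c p) = 1
    & forall p, cdom c p -> chi (cmap c p) != 0 ->
        \forall q \near p, cdom c q /\ forall l, gam l q = cmap c q 0 l].
Proof.
move=> mM ac cp0; have cy0 := cmap_cod cp0.
have [b [K [sb b1 cK KU b0]]] := rV_bump (@ccod_open _ _ _ c) cy0.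
have [N [oN Ny0 bN]] := near_open b1.
have [chi [K' [schi chi1 cK' KU' chi0]]] :=
  rV_bump (openI oN (@ccod_open _ _ _ c)) (conj Ny0 cy0).
exists chi, (fun l => extend0 c (fun y => b y * y 0 l)); split.
- by exists K'; split=> // y /KU'[].
- move=> l; apply: (@smooth_extend0 _ _ K) => // [y _|y /b0 ->].
    by apply: smooth_atM => //; exact: smooth_at_coord.
  by rewrite mul0r.
- near=> p; split; near: p; first exact: near_cdom.
  exact: (near_cmap cp0 chi1).
- move=> p cp np; near=> q.
  have cq : cdom c q by near: q; exact: near_cdom.
  split=> // l; rewrite extend0E // bN ?mul1r //; near: q.
  apply: (@near_cmap c p N cp); apply: open_nbhs_nbhs; split=> //.
  apply: contrapT => nN; move/eqP: np; apply; apply: chi0.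
  by move=> /KU'[].
Unshelve. all: by end_near. Qed.

Lemma near_coordinates (c : chart R M n) (p0 : M) : smooth_manifold -> atlas c -> cdom c p0 ->
  exists gam : 'I_n -> M -> R, (forall l, smooth_fun (gam l)) /\
    \forall q \near p0, cdom c q /\ forall l, gam l q = cmap c q 0 l.
Proof.
move=> mM ac cp; have [chi [gam [_ sg chi1 H]]] := local_coordinates mM ac cp.
exists gam; split=> //; apply: H => //.
by have [_ ->] := nbhs_singleton chi1; rewrite oner_neq0.
Qed.

End Functions.

(** * Tangent vectors *)

Section TangentVectors.
Variables (R : realType) (M : chartedSpace R).
Hypothesis mM : smooth_manifold M.
Notation n := (space_dim M).

Lemma tangent_ext (p : M) (v w : tangent p) :
  (forall f, smooth_fun f -> val v f = val w f) -> v = w.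
Proof.
move=> vw; apply: val_inj; apply/funext => f.
have [/vw //|nf] := pselect (smooth_fun f).
have /asboolP[v0 _] := valP v; have /asboolP[w0 _] := valP w.
by rewrite v0 // w0.
Qed.

Lemma tangentP (p : M) (v : tangent p) c : atlas c -> cdom c p ->
  exists u, forall f, smooth_fun f -> val v f = 'D_u (f \o cinv c) (cmap c p).
Proof. by move=> ac cp; have /asboolP[_] := valP v; apply. Qed.

Lemma some_chart (p : M) : exists2 c : chart R M n, atlas c & cdom c p.
Proof. by have [_ + _] := mM; apply. Qed.

Lemma tangent_valD (p : M) (v w : tangent p) f : val (v + w) f = val v f + val w f.
Proof. by []. Qed.

Lemma tangent_valZ (p : M) a (v : tangent p) f : val (a *: v) f = a * val v f.
Proof. by []. Qed.

Lemma tangent_val_sum (p : M) (I : Type) (r : seq I) (P : pred I)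
    (v : I -> tangent p) f :
  val (\sum_(i <- r | P i) v i) f = \sum_(i <- r | P i) val (v i) f.
Proof.
elim: r => [|i r IH]; first by rewrite !big_nil.
by rewrite !big_cons; case: ifP; rewrite ?tangent_valD IH.
Qed.

Lemma tangentD (p : M) (v : tangent p) f g : smooth_fun f -> smooth_fun g ->
  val v (fun p => f p + g p) = val v f + val v g.
Proof.
move=> sf sg; have [c ac cp] := some_chart p; have [u vE] := tangentP v ac cp.
rewrite !vE //; last exact: smooth_funD.
by rewrite -deriveD //; apply: smooth_at_derivable; exact: smooth_fun_at.
Qed.

Lemma tangentM (p : M) (v : tangent p) f g : smooth_fun f -> smooth_fun g ->
  val v (fun p => f p * g p) = f p * val v g + g p * val v f.
Proof.
move=> sf sg; have [c ac cp] := some_chart p; have [u vE] := tangentP v ac cp.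
rewrite !vE //; last exact: smooth_funM.
have := @deriveM _ _ (f \o cinv c) (g \o cinv c) (cmap c p) u.
rewrite /= cmapK // => -> //; apply: smooth_at_derivable; exact: smooth_fun_at.
Qed.

Lemma tangent_cst (p : M) (v : tangent p) a : val v (fun _ => a) = 0.
Proof.
have [c ac cp] := some_chart p; have [u vE] := tangentP v ac cp.
by rewrite vE; [exact: derive_cst|exact: smooth_fun_cst].
Qed.

Lemma tangentZ (p : M) (v : tangent p) a f : smooth_fun f ->
  val v (fun p => a * f p) = a * val v f.
Proof.
move=> sf; rewrite (@tangentM p v (fun _ => a)) //; last exact: smooth_fun_cst.
by rewrite tangent_cst mulr0 addr0.
Qed.

Lemma tangent_sum (p : M) (v : tangent p) (I : Type) (r : seq I) (f : I -> M -> R) :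
  (forall i, smooth_fun (f i)) ->
  val v (fun p => \sum_(i <- r) f i p) = \sum_(i <- r) val v (f i).
Proof.
move=> sf; elim: r => [|i r IH].
  rewrite big_nil; apply: (etrans _ (tangent_cst v 0)); apply: (congr1 (val v)).
  by apply/funext => q; rewrite big_nil.
rewrite big_cons -IH -tangentD //; last exact: smooth_fun_sum.
by apply: (congr1 (val v)); apply/funext => q; rewrite big_cons.
Qed.

(** Smoothness of a map out of a normed space, tested on global smooth functions because these are
    what tangent vectors act on. *)
Definition pulls_smooth (V : normedModType R) (F : V -> M) (y : V) :=
  {for y, continuous F} /\ forall f, smooth_fun f -> smooth_at (f \o F) y.

Lemma pulls_smooth_coords (V : normedModType R) (F : V -> M) y
    c (gam : 'I_n -> M -> R) :
  pulls_smooth F y -> cdom c (F y) ->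
  (\forall q \near F y, cdom c q /\ forall l, gam l q = cmap c q 0 l) ->
  forall f : M -> R, 
  \forall z \near y, f (F z) = (f \o cinv c) (\row_l gam l (F z)).
Proof.
move=> [cF _] cy gc f.
have Fz : \forall z \near y, cdom c (F z) /\ forall l, gam l (F z) = cmap c (F z) 0 l.
  exact: cF _ gc.
apply: filterS Fz => z [cz gz] /=.
rewrite (_ : \row_l _ = cmap c (F z)) ?cmapK //.
by apply/rowP => l; rewrite mxE gz.
Qed.

(** By the chain rule, the direction in a chart is the row of derivatives of the coordinates
    [gam l \o F]. This is what keeps [mk_tangent] away from its default value 0. *)
Lemma tangent_of_curve (V : normedModType R) (F : V -> M) y v :
  pulls_smooth F y ->
  is_tangent (F y)
    (fun f => if `[< smooth_fun f >] then 'D_v (f \o F) y else 0).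
Proof.
move=> pF; split=> [f nf|c ac cy]; first by case: asboolP.
have [gam [sg gc]] := near_coordinates mM ac cy.
exists (\row_l 'D_v (gam l \o F) y) => f sf; case: asboolP => // _.
have E := pulls_smooth_coords pF cy gc f.
have row0 : \row_l gam l (F y) = cmap c (F y).
  by apply/rowP => l; rewrite mxE; have [_ ->] := nbhs_singleton gc.
rewrite (near_eq_derive _ E) (@derive_row _ _ _ _ (fun z => \row_l gam l (F z))).
- rewrite row0 [RHS]derive_expand; last first.
    exact/smooth_at_differentiable/smooth_fun_at.
  apply: eq_bigr => i _; rewrite mxE; congr (_ * _).
  by congr ('D_v _ y); apply/funext => z; rewrite mxE.
- move=> i; under eq_fun do rewrite mxE.
  by have [_] := pF; apply.
by rewrite row0; exact: smooth_fun_at.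
Qed.

Lemma mk_tangentE (p : M) D f :
  is_tangent p (fun f => if `[< smooth_fun f >] then D f else 0) ->
  smooth_fun f -> val (mk_tangent p D) f = D f.
Proof.
move=> tD sf; rewrite /mk_tangent val_insubd.
have -> : tangent_pred p (fun f => if `[< smooth_fun f >] then D f else 0).
  exact/asboolP.
by case: asboolP.
Qed.

Lemma curve_tangentE (V : normedModType R) (F : V -> M) y v f :
  pulls_smooth F y -> smooth_fun f ->
  val (mk_tangent (F y) (fun f => 'D_v (f \o F) y)) f = 'D_v (f \o F) y.
Proof. by move=> pF sf; rewrite mk_tangentE //; exact: tangent_of_curve. Qed.

Lemma cinv_pulls_smooth c y : @atlas R M c -> ccod c y -> pulls_smooth (cinv c) y.
Proof.
move=> ac cy; split; first exact: cinv_cont.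
by move=> f /smooth_funP; apply.
Qed.

(** Counterpart of [coord_vec] typed at [p], since [cinv c (cmap c p)] is equal to [p] but not
    convertible to it. *)
Definition chart_vec (c : chart R M n) (p : M) (u : 'rV[R]_n) : tangent p :=
  mk_tangent p (fun f => 'D_u (f \o cinv c) (cmap c p)).

Lemma chart_vecE (c : chart R M n) (p : M) u f : atlas c -> cdom c p -> smooth_fun f ->
  val (chart_vec c p u) f = 'D_u (f \o cinv c) (cmap c p).
Proof.
move=> ac cp sf; rewrite mk_tangentE //.
have := tangent_of_curve u (cinv_pulls_smooth ac (cmap_cod cp)).
by rewrite cmapK.
Qed.

Lemma coord_vecE (c : chart R M n) (y : 'rV[R]_n) u : ccod c y ->
  coord_vec c y u = chart_vec c (cinv c y) u.
Proof. by move=> cy; rewrite /chart_vec cinvK. Qed.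

Lemma coord_vec_val (c : chart R M n) (y : 'rV[R]_n) u f :
  atlas c -> ccod c y -> smooth_fun f ->
  val (coord_vec c y u) f = 'D_u (f \o cinv c) y.
Proof. by move=> ac cy sf; rewrite curve_tangentE //; exact: cinv_pulls_smooth. Qed.

Lemma tangent_chart_vec (p : M) (v : tangent p) c : atlas c -> cdom c p ->
  exists u, v = chart_vec c p u.
Proof.
move=> ac cp; have [u vE] := tangentP v ac cp; exists u.
by apply: tangent_ext => f sf; rewrite vE // chart_vecE.
Qed.

Lemma chart_vec_linear (c : chart R M n) (p : M) :
  atlas c -> cdom c p -> linear (chart_vec c p).
Proof.
move=> ac cp a u v; apply: tangent_ext => f sf.
rewrite tangent_valD tangent_valZ !chart_vecE //.
have df := smooth_at_differentiable (smooth_fun_at sf ac cp).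
by rewrite !deriveE // linearP.
Qed.

(* The coordinate functions [gam] and coordinate fields [E] are cut off to be
   global, because tangent vectors only act on global functions. *)
Lemma local_frame (c : chart R M n) (p0 : M) : @atlas R M c -> cdom c p0 ->
  exists (chi : M -> R) (gam : 'I_n -> M -> R)
    (E : 'I_n -> forall p : M, tangent p),
  [/\ smooth_fun chi /\ (forall l, smooth_fun (gam l)),
      forall l f, smooth_fun f -> smooth_fun (fun p => val (E l p) f),
      forall p (v : tangent p), chi p *: v = \sum_l val v (gam l) *: E l p,
      \forall p \near p0, [/\ cdom c p, chi p = 1,
          forall l, E l p = chart_vec c p (delta_mx 0 l)
        & forall l, gam l p = cmap c p 0 l]
    & forall k (w : diff_form M k) (e : 'I_k -> 'I_n),
        smooth_fun (fun p => chi p * w p (fun i => chart_vec c p (delta_mx 0 (e i))))].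
Proof.
move=> ac cp0.
have [chi [gam [[K [cK Kc chi0 schi]] sg chi1 chig]]] := local_coordinates mM ac cp0.
exists (extend0 c chi), gam.
exists (fun l p => extend0 c chi p *: chart_vec c p (delta_mx 0 l)).
have ext_smooth g : (forall y, ccod c y -> smooth_at g y) ->
    smooth_fun (extend0 c (fun y => chi y * g y)).
  move=> sgg; apply: (@smooth_extend0 _ _ _ _ K) => // [y cy|y /chi0 ->].
    by apply: smooth_atM => //; exact: sgg.
  by rewrite mul0r.
split.
- split=> //; rewrite (_ : extend0 c chi = extend0 c (fun y => chi y * 1)).
    by apply: ext_smooth => y _; exact: smooth_at_cst.
  by apply/funext => p; rewrite /extend0; case: asboolP; rewrite ?mulr1.
- move=> l f sf.
  rewrite (_ : (fun p => _) =
      extend0 c (fun y => chi y * 'D_(delta_mx 0 l) (f \o cinv c) y)).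
    apply: ext_smooth => y cy; apply: smooth_at_derive.
    by move/smooth_funP : sf; apply.
  apply/funext => p; rewrite tangent_valZ /extend0.
  by case: asboolP => cp; rewrite ?mul0r // chart_vecE.
- move=> p v; rewrite /extend0; case: asboolP => cp; last first.
    by rewrite scale0r big1 // => l _; rewrite scale0r scaler0.
  have [->|np] := eqVneq (chi (cmap c p)) 0.
    by rewrite scale0r big1 // => l _; rewrite scale0r scaler0.
  (* Where [chi] is nonzero the [gam l] are coordinates near [p], so [val v (gam l)] is the
     component [u 0 l]. *)
  have [u vE] := tangent_chart_vec v ac cp.
  pose cM := GRing.isLinear.Build _ _ _ _ _ (chart_vec_linear ac cp).
  pose cL : {linear _ -> _} := HB.pack (chart_vec c p) cM.
  rewrite {1}vE (row_sum_delta u) -[chart_vec c p]/(cL : _ -> _) linear_sum scaler_sumr.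
  apply: eq_bigr => l _; rewrite linearZ /= !scalerA; congr (_ *: _).
  rewrite mulrC; congr (_ * _); rewrite vE chart_vecE //.
  rewrite -(derive_coord (cmap c p) u l); apply: near_eq_derive.
  have gl := near_cinv cp (chig p cp np).
  have cl := near_ccod (cmap_cod cp).
  by apply: filterS2 gl cl => y [cy gy] ccy /=; rewrite gy cinvK.
- apply: filterS chi1 => p [cp chip]; rewrite extend0E // chip; split=> //.
    by move=> l; rewrite scale1r.
  have := chig p cp; rewrite chip oner_neq0 => /(_ isT) /nbhs_singleton.
  by case.
move=> k w e.
have /asboolP[_ _ sw] := valP w.
rewrite (_ : (fun p => _) = extend0 c (fun y => chi y *
    form_coef (val w) c (fun i => delta_mx 0 (e i)) y)).
  apply: ext_smooth => y cy; apply: smooth_on_at (sw _ _ ac) cy; exact: ccod_open.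
apply/funext => p; rewrite /extend0; case: asboolP => cp; rewrite ?mul0r //.
congr (_ * _); rewrite /form_coef /form_val.
(* Generalising over [q] allows the rewriting of the base point on which the types of the vectors
   depend. *)
have H q : cinv c (cmap c p) = q -> (val w q (fun i => chart_vec c q (delta_mx 0 (e i)))) =
   val w (cinv c (cmap c p)) (fun i => coord_vec c (cmap c p) (delta_mx 0 (e i))).
  move=> <-; congr (val w _ _); apply/funext => i.
  by rewrite coord_vecE //; exact: cmap_cod.
by apply: H; exact: cmapK.
Qed.

End TangentVectors.

(** * Smooth maps and their differentials *)

Section SmoothMaps.
Variable R : realType.
Implicit Types M N P : chartedSpace R.

Definition smap M N (F : M -> N) :=
  continuous F /\ forall f, smooth_fun f -> smooth_fun (f \o F).

Lemma smap_comp M N P (F : M -> N) (H : N -> P) :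
  smap F -> smap H -> smap (H \o F).
Proof.
move=> [cF sF] [cH sH]; split.
  by move=> x; apply: continuous_comp; [exact: cF|exact: cH].
by move=> f sf; apply: (sF (f \o H)); exact: sH.
Qed.

Lemma smap_id M : smap (@id M).
Proof. by split=> // x; exact: cvg_id. Qed.

Lemma smap_cst M N (q : N) : smap (fun _ : M => q).
Proof. by split=> [x|f sf]; [exact: cvg_cst|exact: smooth_fun_cst]. Qed.

Lemma smooth_map_smap M N (F : M -> N) :
  smooth_manifold N -> smooth_map F -> smap F.
Proof.
move=> mN [cF sF]; split=> // f sf; apply/smooth_funP => c y ac cy.
have [d ad dy] := some_chart mN (F (cinv c y)).
have near_d : \forall z \near y, cdom d (F (cinv c z)).
  have cFc : {for y, continuous (F \o cinv c)}.
    by apply: continuous_comp; [exact: cinv_cont|exact: cF].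
  by apply: cFc; exact: near_cdom.
apply: (@eq_smooth_at _ _ _ (fun z => (f \o cinv d) ((cmap d \o F \o cinv c) z))).
  by apply: filterS near_d => z dz /=; rewrite cmapK.
have st : smooth_at (cmap d \o F \o cinv c) y.
  have : \forall z \near y, (ccod c `&` (F \o cinv c) @^-1` cdom d) z.
    by apply: filterS2 near_d (near_ccod cy) => z.
  move=> /near_open[N' [oN Ny NU]]; exists N'; split=> // k.
  exact: (Ck_sub NU (sF c d ac ad k)).
apply: smooth_at_row => [i|]; first exact: smooth_at_component.
by apply: (smooth_fun_at (p := F (cinv c y))).
Qed.

Lemma smap_pulls_smooth M N (F : M -> N) c y :
  smap F -> @atlas R M c -> ccod c y -> pulls_smooth (F \o cinv c) y.
Proof.
move=> [cF sF] ac cy; split.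
  by apply: continuous_comp; [exact: cinv_cont|exact: cF].
by move=> f /sF /smooth_funP; apply.
Qed.

Lemma pushforwardE M N (F : M -> N) p q (v : tangent p) (f : N -> R) :
  smooth_manifold M -> smooth_manifold N -> smap F -> q = F p ->
  smooth_fun f -> val (Defs.pushforward F q v) f = val v (f \o F).
Proof.
move=> mM mN sF -> sf; rewrite mk_tangentE //.
have [c ac cp] := some_chart mM p; have [u vE] := tangentP v ac cp.
have := tangent_of_curve mN u (smap_pulls_smooth sF ac (cmap_cod cp)).
rewrite /= cmapK // => H; congr (is_tangent _ _): H.
apply/funext => g; case: asboolP => // sg.
by rewrite vE //; have [_] := sF; apply.
Qed.

End SmoothMaps.

(** * Differential forms *)

Section Alternating.
Variables (R : realType) (V : lmodType R).

Definition is_alternating k (f : ('I_k -> V) -> R) :=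
  (forall v i j, i != j -> v i = v j -> f v = 0) /\
  (forall v i a x y, f (upd v i (a *: x + y)) = a * f (upd v i x) + f (upd v i y)).

Lemma upd_id k (v : 'I_k -> V) i x : v i = x -> upd v i x = v.
Proof. by move=> <-; apply/funext => j; rewrite /upd; case: eqP => [->|]. Qed.

Lemma alternating_swap k (f : ('I_k -> V) -> R) v i j :
  is_alternating f -> i != j -> f (v \o tperm i j) = - f v.
Proof.
move=> [fa fl] ij; pose F x y := f (upd (upd v i x) j y).
have updC x y : upd (upd v i x) j y = upd (upd v j y) i x.
  apply/funext => l; rewrite /upd; case: eqP => [->|//].
  by rewrite eq_sym (negbTE ij).
have F0 x : F x x = 0.
  by apply: (fa _ i j ij); rewrite /upd (negbTE ij) !eqxx.
have FDr x y z : F x (y + z) = F x y + F x z.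
  by rewrite /F -[y]scale1r fl mul1r scale1r.
have FDl x y z : F (y + z) x = F y x + F z x.
  by rewrite /F !updC -[y]scale1r fl mul1r scale1r.
have : F (v i + v j) (v i + v j) = 0 by exact: F0.
rewrite FDl !FDr !F0 add0r addr0 => /eqP; rewrite addr_eq0 => /eqP E.
have -> : f v = F (v i) (v j) by rewrite /F !upd_id.
rewrite E opprK /F; congr f; apply/funext => l; rewrite /= /upd.
have [->|lj] := eqVneq l j; first by rewrite tpermR.
have [->|li] := eqVneq l i; first by rewrite tpermL.
by rewrite tpermD // eq_sym.
Qed.

Lemma alternating_perm k (f : ('I_k -> V) -> R) v (s : 'S_k) :
  is_alternating f -> f (v \o s) = (-1) ^+ s * f v.
Proof.
move=> af; have [ts -> ts_ok] := prod_tpermP s.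
elim: ts ts_ok v => [|[i j] ts IH] /= dts v.
  rewrite big_nil odd_perm1 mul1r; congr f.
  by apply/funext => l; rewrite /= perm1.
case/andP: dts => /= ij dts; rewrite big_cons /= odd_permM odd_tperm ij.
set s' := (\prod_(t <- ts) _)%g.
have -> : v \o (tperm i j * s')%g = (v \o s') \o tperm i j.
  by apply/funext => l; rewrite /= permM.
by rewrite alternating_swap // IH // signr_addb expr1 mulN1r mulNr.
Qed.

Lemma alternating0 k (f : ('I_k -> V) -> R) v i :
  is_alternating f -> v i = 0 -> f v = 0.
Proof.
move=> [_ fl] vi; have := fl v i 0 0 0.
by rewrite scale0r addr0 upd_id // mul0r add0r => _; have := fl v i (-1) 0 0;
  rewrite scaler0 addr0 upd_id // mulN1r addNr.
Qed.

Lemma alternating_sum k (f : ('I_k -> V) -> R) v i (I : Type) (r : seq I)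
    (a : I -> R) (x : I -> V) : is_alternating f ->
  f (upd v i (\sum_(l <- r) a l *: x l)) = \sum_(l <- r) a l * f (upd v i (x l)).
Proof.
move=> af; elim: r => [|l r IH].
  by rewrite !big_nil (alternating0 (i := i)) // /upd eqxx.
by rewrite !big_cons -IH; case: af.
Qed.

(** The formula of [wedge_form] at one point, over an arbitrary module, so that its algebra is free
    of the dependent tangent spaces. *)
Definition wedge_alt k j (f : ('I_k -> V) -> R) (g : ('I_j -> V) -> R)
    (v : 'I_(k + j) -> V) : R :=
  (k`!%:R * j`!%:R)^-1 *
    \sum_(s : 'S_(k + j)) (-1) ^+ s *
      f (fun i => v (s (lshift j i))) * g (fun i => v (s (rshift k i))).

Lemma upd_inj k m (v : 'I_m -> V) (h : 'I_k -> 'I_m) i x :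
  injective h -> (fun l => upd v (h i) x (h l)) = upd (fun l => v (h l)) i x.
Proof. by move=> hi; apply/funext => l; rewrite /upd (inj_eq hi). Qed.

Lemma upd_out k m (v : 'I_m -> V) (h : 'I_k -> 'I_m) i x :
  (forall l, h l != i) -> (fun l => upd v i x (h l)) = (fun l => v (h l)).
Proof. by move=> hi; apply/funext => l; rewrite /upd (negbTE (hi l)). Qed.

Lemma wedge_alternating k j (f : ('I_k -> V) -> R) (g : ('I_j -> V) -> R) :
  is_alternating f -> is_alternating g -> is_alternating (wedge_alt f g).
Proof.
move=> [_ fl] [_ gl]; split.
- move=> v i1 i2 i12 vi; rewrite /wedge_alt.
  set S := \sum_s _; suff -> : S = 0 by rewrite mulr0.
  have vt l : v (tperm i1 i2 l) = v l by case: tpermP => // ->.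
  (* Composing with the transposition leaves the vectors unchanged, as the two exchanged ones are
     equal, and flips the sign: the sum is its own opposite. *)
  have SN : S = - S.
    rewrite {1}/S (reindex_inj (mulIg (tperm i1 i2))) /= -sumrN.
    apply: eq_bigr => s _; rewrite odd_permM odd_tperm i12 signr_addb expr1.
    rewrite mulrN1 !mulNr; congr (- (_ * _ * _)).
      by congr f; apply/funext => l; rewrite permM vt.
    by congr g; apply/funext => l; rewrite permM vt.
  by move/eqP: SN; rewrite -addr_eq0 -mulr2n mulrn_eq0 /= => /eqP.
move=> v i a x y; rewrite /wedge_alt mulrCA -mulrDr; congr (_ * _).
rewrite mulr_sumr -big_split /=; apply: eq_bigr => s _.
(* The slot [i] occurs in exactly one of the two factors, according to the block containing its
   preimage under [s]. *)
have -> : i = s (s^-1%g i) by rewrite permKV.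
case: (split_ordP (s^-1%g i)) => l ->.
- have hi : injective (fun l => s (lshift j l)) by move=> ? ? /perm_inj/lshift_inj.
  rewrite !(upd_inj _ _ _ hi) fl.
  have ho l' : s (rshift k l') != s (lshift j l) by rewrite (inj_eq perm_inj) eq_rlshift.
  rewrite !(upd_out _ _ ho) mulrDr mulrDl -!mulrA; congr (_ + _); exact: mulrCA.
- have hi : injective (fun l => s (rshift k l)) by move=> ? ? /perm_inj/rshift_inj.
  rewrite !(upd_inj _ _ _ hi) gl.
  have ho l' : s (lshift j l') != s (rshift k l) by rewrite (inj_eq perm_inj) eq_lrshift.
  rewrite !(upd_out _ _ ho) mulrDr; congr (_ + _); exact: mulrCA.
Qed.

End Alternating.

Section FormTheory.
Variables (R : realType) (M : chartedSpace R).
Hypothesis mM : smooth_manifold M.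
Notation n := (space_dim M).

Lemma diff_formP k (w : diff_form M k) : is_form (val w).
Proof. by have /asboolP := valP w. Qed.

Lemma form_alternating k (w : diff_form M k) p : is_alternating (w p).
Proof.
have [wa wl _] := diff_formP w.
by split=> [v i j|v i a x y]; [exact: wa|exact: wl].
Qed.

Lemma form_ext k (w z : diff_form M k) : (forall p v, w p v = z p v) -> w = z.
Proof.
move=> wz; apply: val_inj; apply: functional_extensionality_dep => p.
by apply/funext => v; exact: wz.
Qed.

Lemma form_valD k (w z : diff_form M k) p (v : 'I_k -> tangent p) :
  form_val (w + z) v = w p v + z p v.
Proof. by []. Qed.

Lemma form_valZ k a (w : diff_form M k) p (v : 'I_k -> tangent p) :
  form_val (a *: w) v = a * w p v.
Proof. by []. Qed.

Lemma form_val_sum k (I : Type) (r : seq I) (P : pred I) (w : I -> diff_form M k) p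
    (v : 'I_k -> tangent p) :
  form_val (\sum_(i <- r | P i) w i) v = \sum_(i <- r | P i) w i p v.
Proof.
elim: r => [|i r IH]; first by rewrite !big_nil.
by rewrite !big_cons; case: ifP; rewrite ?form_valD IH.
Qed.

Lemma mk_formE k (w : rawform M k) p v : is_form w -> mk_form w p v = w p v.
Proof.
move=> fw; rewrite /mk_form /form_val val_insubd.
by have -> : form_pred w by exact/asboolP.
Qed.

Lemma is_formP k (w : rawform M k) :
  (forall p, is_alternating (@w p)) ->
  (forall c u y, @atlas R M c -> ccod c y -> smooth_at (form_coef w c u) y) ->
  is_form w.
Proof.
move=> aw sw; split.
- by move=> p v i j; have [+ _] := aw p; apply.
- by move=> p v i a x y; have [_] := aw p; apply.
- by move=> c u ac; apply/smooth_onP; [exact: ccod_open|move=> y; exact: sw].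
Qed.

(** Multilinear expansion along a finite frame, phrased as an induction principle: [Q] is smoothness
    in one use and being a differential operator in another. The form may vary with the parameter
    [y], which the second use needs. *)
Lemma eval_expansion_ind (Y : Type) k (w : Y -> diff_form M k) m (F : Y -> M)
    (E : 'I_m -> forall p : M, tangent p) (a : 'I_k -> 'I_m -> Y -> R)
    (Q Good : (Y -> R) -> Prop) :
  Q (fun _ => 0) -> (forall f g, Q f -> Q g -> Q (fun y => f y + g y)) ->
  (forall b f, Good b -> Q f -> Q (fun y => b y * f y)) ->
  (forall i l, Good (a i l)) ->
  (forall e : 'I_k -> 'I_m, Q (fun y => w y (F y) (fun i => E (e i) (F y)))) ->
  Q (fun y => w y (F y) (fun i => \sum_l a i l y *: E l (F y))).
Proof.
move=> Q0 QD QM Ga QE.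
have Qsum (I : Type) (r : seq I) (f : I -> Y -> R) :
    (forall i, Q (f i)) -> Q (fun y => \sum_(i <- r) f i y).
  move=> Qf; elim: r => [|i r IH].
    by rewrite (_ : (fun _ => _) = fun _ => 0) //; apply/funext => y; rewrite big_nil.
  rewrite (_ : (fun _ => _) = fun y => f i y + \sum_(i <- r) f i y).
    exact: QD.
  by apply/funext => y; rewrite big_cons.
(* With an empty frame there is no [e] to start from: either there are no arguments at all, or an
   argument is an empty sum and the value is 0. *)
case: m => [|m] in E a Ga QE *.
  case: k => [|k] in w a Ga QE *.
    have := QE id; congr Q; apply/funext => y.
    by congr (form_val (w y) _); apply/funext => -[].
  rewrite (_ : (fun _ => _) = fun _ => 0) //; apply/funext => y.
  apply: (alternating0 (i := ord0) (form_alternating (w y) _)).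
  by rewrite big_ord0.
(* Only the first [r] arguments are still sums; each induction step expands the argument of index
   [r] by linearity. *)
suff H r : (r <= k)%N -> forall e : 'I_k -> 'I_m.+1, Q (fun y => w y (F y)
    (fun i : 'I_k => if (i < r)%N then \sum_l a i l y *: E l (F y) else E (e i) (F y))).
  have := H k (leqnn k) (fun=> ord0).
  congr Q; apply/funext => y; congr (form_val (w y) _); apply/funext => i.
  by rewrite ltn_ord.
elim: r => [_ e|r IH rk e]; first exact: QE.
pose i0 := Ordinal rk.
rewrite (_ : (fun _ => _) = fun y => \sum_l a i0 l y * w y (F y)
    (fun i : 'I_k => if (i < r)%N then \sum_l a i l y *: E l (F y)
              else E (if i == i0 then l else e i) (F y))).
  by apply: Qsum => l; apply: QM => //; exact: (IH (ltnW rk)).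
apply/funext => y.
pose v (i : 'I_k) := if (i < r)%N then \sum_l a i l y *: E l (F y) else E (e i) (F y).
have -> : (fun i : 'I_k => if (i < r.+1)%N then \sum_l a i l y *: E l (F y)
     else E (e i) (F y)) = upd v i0 (\sum_l a i0 l y *: E l (F y)).
  apply/funext => i; rewrite /upd /v ltnS leq_eqVlt.
  have [->|ni] := eqVneq i i0; first by rewrite eqxx.
  rewrite (_ : (nat_of_ord i == r) = false) //.
  by apply: contraNF ni => /eqP ir; exact/eqP/val_inj.
rewrite (alternating_sum _ _ _ _ _ (form_alternating (w y) _)).
apply: eq_bigr => l _; congr (_ * form_val (w y) _); apply/funext => i.
rewrite /upd /v; have [->|//] := eqVneq i i0.
by rewrite ltnn.
Qed.

End FormTheory.

(** * Evaluation of forms on smooth fields, differentials of functions, contraction *)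

Section EvalSmooth.
Variables (R : realType) (M : chartedSpace R).
Hypothesis mM : smooth_manifold M.
Notation n := (space_dim M).

(** Near [y0] the arguments are combinations of the coordinate frame with coefficients
    [val (X i y) (gam l)], and on frame vectors the form is one of its smooth coefficients. *)
Lemma form_eval_smooth (V : normedModType R) (F : V -> M) y0 k
    (w : diff_form M k) (X : 'I_k -> forall y, tangent (F y)) :
  pulls_smooth F y0 ->
  (forall i f, smooth_fun f -> smooth_at (fun y => val (X i y) f) y0) ->
  smooth_at (fun y => w (F y) (fun i => X i y)) y0.
Proof.
move=> pF sX; have [c ac cy] := some_chart mM (F y0).
have [chi [gam [E [[schi sg] sE EE E1 Ew]]]] := local_frame mM ac cy.
have [cF sF] := pF.
have N1 : \forall y \near y0, [/\ cdom c (F y), chi (F y) = 1,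
    forall l, E l (F y) = chart_vec c (F y) (delta_mx 0 l) &
    forall l, gam l (F y) = cmap c (F y) 0 l] := cF _ E1.
apply: (@eq_smooth_at _ _ _ (fun y => w (F y)
   (fun i => \sum_l val (X i y) (gam l) *: E l (F y)))).
  apply: filterS N1 => y [_ chi1 _ _]; congr (form_val w _).
  by apply/funext => i; rewrite -EE chi1 scale1r.
apply: (@eval_expansion_ind _ _ _ _ (fun=> w) _ F E (fun i l y => val (X i y) (gam l))
  (fun f => smooth_at f y0) (fun f => smooth_at f y0)).
- exact: smooth_at_cst.
- by move=> f g; exact: smooth_atD.
- by move=> f g; exact: smooth_atM.
- by move=> i l; exact: sX.
move=> e; apply: (@eq_smooth_at _ _ _ ((fun p => chi p *
    w p (fun i => chart_vec c p (delta_mx 0 (e i)))) \o F)).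
  apply: filterS N1 => y [_ chi1 El _] /=; rewrite chi1 mul1r.
  by congr (form_val w _); apply/funext => i; rewrite El.
exact: sF.
Qed.

Definition smooth_field (X : forall p : M, tangent p) :=
  forall f, smooth_fun f -> smooth_fun (fun p => val (X p) f).

Lemma form_fields_smooth k (w : diff_form M k) (X : 'I_k -> forall p : M, tangent p) :
  (forall i, smooth_field (X i)) -> smooth_fun (fun p => w p (fun i => X i p)).
Proof.
move=> sX; apply/smooth_funP => c y ac cy.
apply: (@form_eval_smooth _ (cinv c) y k w (fun i y => X i (cinv c y))).
  exact: cinv_pulls_smooth.
by move=> i f sf; move/smooth_funP : (sX i f sf); apply.
Qed.

Lemma coord_vec_smooth (c : chart R M n) y u f : atlas c -> ccod c y ->
  smooth_fun f -> smooth_at (fun y => val (coord_vec c y u) f) y.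
Proof.
move=> ac cy sf; apply: (@eq_smooth_at _ _ _ ('D_u (f \o cinv c))).
  by apply: filterS (near_ccod cy) => z cz; rewrite coord_vec_val.
by apply: smooth_at_derive; move/smooth_funP : sf; apply.
Qed.

Definition form0 (g : M -> R) : diff_form M 0 := mk_form (fun p _ => g p).

Lemma form0E g p v : smooth_fun g -> form0 g p v = g p.
Proof.
move=> sg; rewrite mk_formE //; apply: is_formP.
  by move=> q; split=> [? []|? []].
by move=> c u y ac cy; move/smooth_funP : sg; apply.
Qed.

Definition dform (g : M -> R) : diff_form M 1 :=
  mk_form (fun p v => val (v ord0) g).

Lemma dformE g p v : smooth_fun g -> dform g p v = val (v ord0) g.
Proof.
move=> sg; rewrite mk_formE //; apply: is_formP.
  move=> q; split=> [? i j|? i a x y]; first by rewrite (ord1 i) (ord1 j) eqxx.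
  by rewrite (ord1 i) /upd eqxx tangent_valD tangent_valZ.
by move=> c u y ac cy; exact: coord_vec_smooth.
Qed.

Lemma dform_derivative g : smooth_fun g -> is_exterior_derivative (form0 g) (dform g).
Proof.
move=> sg c u y ac cy.
rewrite big_ord1 expr0 mul1r /form_coef dformE // coord_vec_val //.
by apply: near_eq_derive; near=> z; rewrite form0E.
Unshelve. all: by end_near. Qed.

(** Coordinate vectors exhaust each tangent space, so the relation [is_exterior_derivative] has at
    most one solution. This turns commutation with d, stated as a relation, into an equation between
    1-forms. *)
Lemma exterior_derivative_fun (z : diff_form M 1) g : smooth_fun g ->
  is_exterior_derivative (form0 g) z -> z = dform g.
Proof.
move=> sg dz; apply: form_ext => p v; rewrite dformE //.
have [c ac cp] := some_chart mM p.
suff H q (v' : 'I_1 -> tangent q) : q = cinv c (cmap c p) -> z q v' = val (v' ord0) g.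
  by apply: H; rewrite cmapK.
move=> qE; rewrite {}qE in v' *; have cy := cmap_cod cp.
have [u vE] := tangent_chart_vec mM (v' ord0) ac (cinv_dom cy).
have := dz c (fun=> u) (cmap c p) ac cy.
rewrite -(dform_derivative sg) // /form_coef dformE // coord_vecE // -vE => <-.
by congr (form_val z _); apply/funext => i; rewrite (ord1 i).
Qed.

(* [fcons x v] is the family (x, v_0, ..., v_(k-1)). *)
Definition fcons (T : Type) k (x : T) (v : 'I_k -> T) : 'I_k.+1 -> T :=
  fun i => if unlift ord0 i is Some j then v j else x.

Definition interior_product k (X : forall p : M, tangent p) (w : diff_form M k.+1) :
    diff_form M k :=
  mk_form (fun p v => w p (fcons (X p) v)).

Lemma interior_productE k X (w : diff_form M k.+1) p v : smooth_field X ->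
  interior_product X w p v = w p (fcons (X p) v).
Proof.
move=> sX; rewrite mk_formE //; apply: is_formP.
  move=> q; have [wa wl] := form_alternating w q; split=> [v' i j ij vij|v' i a x y].
    apply: (wa _ (lift ord0 i) (lift ord0 j)); first by rewrite (inj_eq lift_inj).
    by rewrite /fcons !liftK.
  have E z : fcons (X q) (upd v' i z) = upd (fcons (X q) v') (lift ord0 i) z.
    apply/funext => l; rewrite /fcons /upd; case: unliftP => [j|] ->.
      by rewrite (inj_eq lift_inj).
    by rewrite (negbTE (neq_lift _ _)).
  by rewrite !E wl.
move=> c u y ac cy.
apply: (@form_eval_smooth _ (cinv c) y _ w
  (fun i y => fcons (X (cinv c y)) (fun i => coord_vec c y (u i)) i)).
  exact: cinv_pulls_smooth.
move=> i f sf; rewrite /fcons; case: (unlift ord0 i) => [j|].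
  exact: coord_vec_smooth.
by move/smooth_funP : (sX f sf); apply.
Qed.

Lemma wedge_formE k j (w : diff_form M k) (z : diff_form M j) p v :
  wedge_form w z p v = wedge_alt (w p) (z p) v.
Proof.
rewrite mk_formE //; apply: is_formP => [q|c u y ac cy].
  exact: wedge_alternating (form_alternating w q) (form_alternating z q).
apply: smooth_atM; first exact: smooth_at_cst.
apply: smooth_at_sum => s _; apply: smooth_atM; first apply: smooth_atM.
- exact: smooth_at_cst.
- have [_ _ sw] := diff_formP w.
  apply: smooth_on_at (sw c (fun i => u (s (lshift j i))) ac) cy; exact: ccod_open.
- have [_ _ sz] := diff_formP z.
  apply: smooth_on_at (sz c (fun i => u (s (rshift k i))) ac) cy; exact: ccod_open.
Qed.

End EvalSmooth.

Section Pullback.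
Variables (R : realType) (M N : chartedSpace R).
Hypotheses (mM : smooth_manifold M) (mN : smooth_manifold N).

Lemma pushforward_linear (F : M -> N) p q : smap F -> q = F p ->
  linear (Defs.pushforward F q : tangent p -> tangent q).
Proof.
move=> sF qE a u v; apply: tangent_ext => f sf.
by rewrite tangent_valD tangent_valZ !pushforwardE.
Qed.

Lemma pullbackE (F : M -> N) k (w : diff_form N k) p v : smap F ->
  pullback F w p v = w (F p) (fun i => Defs.pushforward F (F p) (v i)).
Proof.
move=> sF; rewrite mk_formE //; apply: is_formP => [q|c u y ac cy].
  have [wa wl] := form_alternating w (F q); split=> [v' i j ij vij|v' i a x y].
    by apply: (wa _ i j) => //; rewrite vij.
  have E z : (fun l => Defs.pushforward F (F q) (upd v' i z l)) =
      upd (fun l => Defs.pushforward F (F q) (v' l)) i (Defs.pushforward F (F q) z).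
    by apply/funext => l; rewrite /upd; case: eqP.
  by rewrite !E (pushforward_linear sF) // wl.
apply: (@form_eval_smooth _ _ mN _ (F \o cinv c) y _ w
  (fun i y => Defs.pushforward F (F (cinv c y)) (coord_vec c y (u i)))).
  exact: smap_pulls_smooth.
move=> i f sf; apply: (@eq_smooth_at _ _ _ (fun y => val (coord_vec c y (u i)) (f \o F))).
  by near=> z; rewrite pushforwardE.
by apply: coord_vec_smooth => //; have [_] := sF; apply.
Unshelve. all: by end_near. Qed.

End Pullback.

(** * Products of manifolds *)

Section RowFunctions.
Variable R : realType.

Lemma Ck_row (V : normedModType R) n k (U : set V) (f : V -> 'rV[R]_n) :
  open U -> (forall i, Ck k U (fun x => f x 0 i)) -> Ck k U f.
Proof.
move=> oU Cf.
apply: (@eq_Ck _ _ _ _ _ (fun x => \sum_i f x 0 i *: (delta_mx 0 i : 'rV[R]_n))) => //.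
  by move=> x _; rewrite -row_sum_delta.
apply: Ck_sum => // i _.
apply: (@Ck_linear_comp _ _ _ _ _ _ (fun x => f x 0 i)
  ( *:%R^~ (delta_mx 0 i : 'rV[R]_n))) => //.
  by move=> a u v /=; rewrite scalerDl scalerA.
exact: scalel_continuous.
Qed.

Lemma smooth_at_rowP (V : normedModType R) n (f : V -> 'rV[R]_n) x :
  (forall i, smooth_at (fun x => f x 0 i) x) -> smooth_at f x.
Proof.
move=> sf; have : \near x, forall i, smooth_at (fun x => f x 0 i) x.
  by apply: filter_forall => i; exact: smooth_at_near.
move=> /near_open[N [oN Nx sN]]; exists N; split=> // k.
by apply: Ck_row => // i; move: k; apply/(smooth_onP _ oN) => y /sN.
Qed.

Lemma smooth_at_lsubmx m n (y : 'rV[R]_(m + n)) i :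
  smooth_at (fun y : 'rV[R]_(m + n) => lsubmx y 0 i : R) y.
Proof.
by under eq_fun do rewrite mxE; exact: smooth_at_coord.
Qed.

Lemma smooth_at_rsubmx m n (y : 'rV[R]_(m + n)) i :
  smooth_at (fun y : 'rV[R]_(m + n) => rsubmx y 0 i : R) y.
Proof.
by under eq_fun do rewrite mxE; exact: smooth_at_coord.
Qed.

Lemma smooth_at_row_mx (V : normedModType R) m n (f : V -> 'rV[R]_m)
    (g : V -> 'rV[R]_n) x i :
  (forall i, smooth_at (fun x => f x 0 i) x) ->
  (forall i, smooth_at (fun x => g x 0 i) x) ->
  smooth_at (fun x => row_mx (f x) (g x) 0 i) x.
Proof.
move=> sf sg; case: (split_ordP i) => l ->.
  by under eq_fun do rewrite row_mxEl.
by under eq_fun do rewrite row_mxEr.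
Qed.

(** Both sides are limits of the same difference quotients, because the inner map is affine along
    [w]. *)
Lemma derive_row_mx m n (f : 'rV[R]_(m + n) -> R) (V : normedModType R)
    (g : V -> 'rV[R]_m) (h : V -> 'rV[R]_n) u v w y :
  (forall a : R, g (a *: w + y) = a *: u + g y) ->
  (forall a : R, h (a *: w + y) = a *: v + h y) ->
  'D_w (fun y => f (row_mx (g y) (h y))) y = 'D_(row_mx u v) f (row_mx (g y) (h y)).
Proof.
move=> gE hE; rewrite /derive.
set A := (X in lim (X @ _) = _); set B := (X in _ = lim (X @ _)).
suff -> : A = B by [].
by apply/funext => a; rewrite /A /B /= gE hE scale_row_mx add_row_mx.
Qed.

End RowFunctions.

Lemma hausdorff_prod (S T : topologicalType) :
  hausdorff_space S -> hausdorff_space T -> hausdorff_space (S * T)%type.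
Proof.
move=> hS hT [p1 p2] [q1 q2] cl.
have nX x y C D : nbhs x C -> nbhs y D -> nbhs ((x, y) : S * T) (C `*` D).
  by move=> xC yD; exists (C, D).
congr pair; [apply: hS => A B pA qB|apply: hT => A B pA qB].
  have [[x1 x2] [[Ax _] [Bx _]]] :=
    cl _ _ (nX p1 p2 A setT pA filterT) (nX q1 q2 B setT qB filterT).
  by exists x1.
have [[x1 x2] [[_ Ax] [_ Bx]]] :=
  cl _ _ (nX p1 p2 setT A filterT pA) (nX q1 q2 setT B filterT qB).
by exists x2.
Qed.

Section Products.
Variable R : realType.
Implicit Types M N P : chartedSpace R.

Lemma prod_manifold M N :
  smooth_manifold M -> smooth_manifold N -> smooth_manifold (prod_space M N).
Proof.
move=> mM mN; have [hM cM _] := mM; have [hN cN _] := mN.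
split; first exact: hausdorff_prod.
  move=> [x y]; have [c ac cx] := cM x; have [d ad dy] := cN y.
  by exists (prod_chart c d) => //; exists c => //; exists d.
move=> _ _ [c1 ac1 [d1 ad1 <-]] [c2 ac2 [d2 ad2 <-]].
move=> k; apply: Ck_local => y [[/= cy dy] [cy2 dy2]].
suff [N' [_ Ny' sN']] : smooth_at (cmap (prod_chart c2 d2) \o cinv (prod_chart c1 d1)) y.
  by exists N' => //; exact: sN'.
apply: smooth_at_rowP => i; apply: smooth_at_row_mx => l.
  apply: (@smooth_at_row _ _ (fun z => (cmap c2 \o cinv c1) z 0 l) _ lsubmx).
    by move=> ?; exact: smooth_at_lsubmx.
  by apply: smooth_at_component; exact: smooth_transition.
apply: (@smooth_at_row _ _ (fun z => (cmap d2 \o cinv d1) z 0 l) _ rsubmx).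
  by move=> ?; exact: smooth_at_rsubmx.
by apply: smooth_at_component; exact: smooth_transition.
Qed.

Lemma smap_fst M N : smap (fst : prod_space M N -> M).
Proof.
split=> [x|f sf]; first exact: cvg_fst.
apply/smooth_funP => _ y [c ac [d ad <-]] [cy dy].
apply: (@smooth_at_row _ _ (f \o cinv c) _ lsubmx).
  by move=> ?; exact: smooth_at_lsubmx.
by move/smooth_funP : sf; apply.
Qed.

Lemma smap_snd M N : smap (snd : prod_space M N -> N).
Proof.
split=> [x|f sf]; first exact: cvg_snd.
apply/smooth_funP => _ y [c ac [d ad <-]] [cy dy].
apply: (@smooth_at_row _ _ (f \o cinv d) _ rsubmx).
  by move=> ?; exact: smooth_at_rsubmx.
by move/smooth_funP : sf; apply.
Qed.

Lemma prod_smooth_at M N (f : prod_space M N -> R) c d y z :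
  smooth_fun f -> @atlas R M c -> @atlas R N d -> ccod c y -> ccod d z ->
  smooth_at (f \o cinv (prod_chart c d)) (row_mx y z).
Proof.
move=> /smooth_funP sf ac ad cy dz; apply: sf; first by exists c => //; exists d.
by split; rewrite /= ?row_mxKl ?row_mxKr.
Qed.

(** A smooth function on the product need not split into functions of the factors, hence the passage
    through coordinates of both factors at once. *)
Lemma pulls_smooth_pair M N (V : normedModType R) (F : V -> M) (H : V -> N) y :
  smooth_manifold M -> smooth_manifold N ->
  pulls_smooth F y -> pulls_smooth H y ->
  pulls_smooth ((fun x => (F x, H x)) : V -> prod_space M N) y.
Proof.
move=> mM mN [cF sF] [cH sH]; split; first exact: (cvg_pair cF cH).
move=> f sf; have [c ac cy] := some_chart mM (F y).
have [d ad dy] := some_chart mN (H y).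
have [gam [sg gc]] := near_coordinates mM ac cy.
have [del [sd dc]] := near_coordinates mN ad dy.
have N1 : \forall z \near y, cdom c (F z) /\ forall l, gam l (F z) = cmap c (F z) 0 l := cF _ gc.
have N2 : \forall z \near y, cdom d (H z) /\ forall l, del l (H z) = cmap d (H z) 0 l := cH _ dc.
have rowE n (g : 'I_n -> R) (z : 'rV[R]_n) : (forall l, g l = z 0 l) -> \row_l g l = z.
  by move=> gz; apply/rowP => l; rewrite mxE.
apply: (@eq_smooth_at _ _ _ (fun z => (f \o cinv (prod_chart c d))
  (row_mx (\row_l gam l (F z)) (\row_l del l (H z))))).
  apply: filterS2 N1 N2 => z [cz gz] [dz ddz] /=.
  by rewrite row_mxKl row_mxKr (rowE _ _ _ gz) (rowE _ _ _ ddz) !cmapK.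
apply: smooth_at_row => [i|].
  apply: smooth_at_row_mx => l; under eq_fun do rewrite mxE; first exact: sF.
  exact: sH.
have [_ gy] := nbhs_singleton N1; have [_ ddy] := nbhs_singleton N2.
rewrite (rowE _ _ _ gy) (rowE _ _ _ ddy).
by apply: prod_smooth_at => //; exact: cmap_cod.
Qed.

Lemma smap_pair M N P (F : P -> M) (H : P -> N) :
  smooth_manifold M -> smooth_manifold N -> smap F -> smap H ->
  smap ((fun x => (F x, H x)) : P -> prod_space M N).
Proof.
move=> mM mN sF sH; split.
  by move=> x; apply: cvg_pair; [case: sF => + _|case: sH => + _]; apply.
move=> f sf; apply/smooth_funP => c y ac cy.
have := pulls_smooth_pair mM mN (smap_pulls_smooth sF ac cy) (smap_pulls_smooth sH ac cy).
by move=> [_]; apply.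
Qed.

Lemma tangent_sndE M N (f : prod_space M N -> R)
    (c : chart R M (space_dim M)) (d : chart R N (space_dim N)) q (w : tangent q) u y :
  smooth_manifold M -> smooth_manifold N -> smooth_fun f ->
  @atlas R M c -> ccod c y ->
  (forall g, smooth_fun g -> val w g = 'D_u (g \o cinv d) (cmap d q)) ->
  val w (fun s => f (cinv c y, s)) =
  'D_(row_mx 0 u) (f \o cinv (prod_chart c d)) (row_mx y (cmap d q)).
Proof.
move=> mM mN sf ac cy wE; rewrite wE; last first.
  have := smap_pair mM mN (smap_cst N (cinv c y)) (smap_id N).
  by move=> [_ /(_ f sf)].
rewrite -(@derive_row_mx _ _ _ _ _ (fun=> y) id 0 u u (cmap d q)) //; last first.
  by move=> a; rewrite scaler0 add0r.
by congr ('D_u _ _); apply/funext => z /=; rewrite row_mxKl row_mxKr.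
Qed.

Lemma tangent_fstE M N (f : prod_space M N -> R)
    (c : chart R M (space_dim M)) (d : chart R N (space_dim N)) p (v : tangent p) u z :
  smooth_manifold M -> smooth_manifold N -> smooth_fun f ->
  @atlas R N d -> ccod d z ->
  (forall g, smooth_fun g -> val v g = 'D_u (g \o cinv c) (cmap c p)) ->
  val v (fun s => f (s, cinv d z)) =
  'D_(row_mx u 0) (f \o cinv (prod_chart c d)) (row_mx (cmap c p) z).
Proof.
move=> mM mN sf ad dz vE; rewrite vE; last first.
  have := smap_pair mM mN (smap_id M) (smap_cst M (cinv d z)).
  by move=> [_ /(_ f sf)].
rewrite -(@derive_row_mx _ _ _ _ _ id (fun=> z) u 0 u (cmap c p)) //; last first.
  by move=> a; rewrite scaler0 add0r.
by congr ('D_u _ _); apply/funext => y /=; rewrite row_mxKl row_mxKr.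
Qed.

Lemma smooth_partial_snd M N (f : prod_space M N -> R) q (w : tangent q) :
  smooth_manifold M -> smooth_manifold N -> smooth_fun f ->
  smooth_fun (fun a : M => val w (fun s : N => f (a, s))).
Proof.
move=> mM mN sf; apply/smooth_funP => c y ac cy.
have [d ad dq] := some_chart mN q.
have [u wE] := tangentP w ad dq.
apply: (@eq_smooth_at _ _ _ (fun y => 'D_(row_mx 0 u)
    (f \o cinv (prod_chart c d)) (row_mx y (cmap d q)))).
  by apply: filterS (near_ccod cy) => z cz /=; rewrite (tangent_sndE mM mN sf ac cz wE).
apply: (@smooth_at_row _ _ ('D_(row_mx 0 u) (f \o cinv (prod_chart c d))) _
  (fun y => row_mx y (cmap d q))) => [i|].
  by apply: smooth_at_row_mx => l; [exact: smooth_at_coord|exact: smooth_at_cst].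
by apply: smooth_at_derive; apply: prod_smooth_at => //; exact: cmap_cod.
Qed.

Lemma smooth_partial_fst M N (f : prod_space M N -> R) p (v : tangent p) :
  smooth_manifold M -> smooth_manifold N -> smooth_fun f ->
  smooth_fun (fun b : N => val v (fun s : M => f (s, b))).
Proof.
move=> mM mN sf; apply/smooth_funP => d z ad dz.
have [c ac cp] := some_chart mM p.
have [u vE] := tangentP v ac cp.
apply: (@eq_smooth_at _ _ _ (fun z => 'D_(row_mx u 0)
    (f \o cinv (prod_chart c d)) (row_mx (cmap c p) z))).
  by apply: filterS (near_ccod dz) => y cy /=; rewrite (tangent_fstE mM mN sf ad cy vE).
apply: (@smooth_at_row _ _ ('D_(row_mx u 0) (f \o cinv (prod_chart c d))) _
  (fun z => row_mx (cmap c p) z)) => [i|].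
  by apply: smooth_at_row_mx => l; [exact: smooth_at_cst|exact: smooth_at_coord].
by apply: smooth_at_derive; apply: prod_smooth_at => //; exact: cmap_cod.
Qed.

(** In a product chart the two sides are the iterated derivatives along [row_mx u 0] and
    [row_mx 0 t], in opposite orders. *)
Lemma tangent_schwarz M N (f : prod_space M N -> R) p q (v : tangent p) (w : tangent q) :
  smooth_manifold M -> smooth_manifold N -> smooth_fun f ->
  val v (fun a : M => val w (fun b : N => f (a, b))) =
  val w (fun b : N => val v (fun a : M => f (a, b))).
Proof.
move=> mM mN sf.
have [c ac cp] := some_chart mM p; have [d ad dq] := some_chart mN q.
have cp' := cmap_cod cp; have dq' := cmap_cod dq.
have [u vE] := tangentP v ac cp; have [t wE] := tangentP w ad dq.
rewrite vE; last exact: smooth_partial_snd.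
rewrite wE; last exact: smooth_partial_fst.
rewrite (@near_eq_derive _ _ _ _ (fun y => 'D_(row_mx 0 t)
    (f \o cinv (prod_chart c d)) (row_mx y (cmap d q)))); last first.
  by apply: filterS (near_ccod cp') => y cy /=; rewrite (tangent_sndE mM mN sf ac cy wE).
rewrite [RHS](@near_eq_derive _ _ _ _ (fun z => 'D_(row_mx u 0)
    (f \o cinv (prod_chart c d)) (row_mx (cmap c p) z))); last first.
  by apply: filterS (near_ccod dq') => y cy /=; rewrite (tangent_fstE mM mN sf ad cy vE).
apply: etrans.
  apply: (@derive_row_mx _ _ _ ('D_(row_mx 0 t) (f \o cinv (prod_chart c d))) _
    id (fun=> cmap d q) u 0 u) => // a.
  by rewrite scaler0 add0r.
apply: esym; apply: etrans.
  apply: (@derive_row_mx _ _ _ ('D_(row_mx u 0) (f \o cinv (prod_chart c d))) _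
    (fun=> cmap c p) id 0 t t) => // a.
  by rewrite scaler0 add0r.
by apply: schwarz; exact: prod_smooth_at.
Qed.

(** The diagonal direction is the sum of the two factor directions. This differentiates any group
    expression in which the variable occurs twice. *)
Lemma tangent_diag M (f : prod_space M M -> R) p (v : tangent p) :
  smooth_manifold M -> smooth_fun f ->
  val v (fun a : M => f (a, a)) =
  val v (fun a : M => f (a, p)) + val v (fun a : M => f (p, a)).
Proof.
move=> mM sf; have [c ac cp] := some_chart mM p; have cp' := cmap_cod cp.
have [u vE] := tangentP v ac cp.
have slice (F H : M -> M) : smap F -> smap H -> smooth_fun (fun a : M => f (F a, H a)).
  by move=> sF sH; have [_ /(_ f sf)] := smap_pair mM mM sF sH.
have y0 : smooth_at (f \o cinv (prod_chart c c)) (row_mx (cmap c p) (cmap c p)).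
  exact: prod_smooth_at.
have := tangent_fstE mM mM sf ac cp' vE; have := tangent_sndE mM mM sf ac cp' vE.
rewrite cmapK // => -> ->.
rewrite vE; last by apply: (slice id id); exact: smap_id.
transitivity ('D_(row_mx u u) (f \o cinv (prod_chart c c)) (row_mx (cmap c p) (cmap c p))).
  rewrite -(@derive_row_mx _ _ _ _ _ id id u u u) //.
  by congr ('D_u _ _); apply/funext => y /=; rewrite row_mxKl row_mxKr.
have dy0 := smooth_at_differentiable y0.
rewrite !deriveE // -linearD; congr ('d _ _ _).
by rewrite add_row_mx addr0 add0r.
Qed.

End Products.

(** * Lie groups *)

Section LieGroups.
Variables (R : realType) (G : lieGroup R).
Notation L := (lie_space G).
Notation gg := (lie_algebra G).
Implicit Types (x y : gg) (p q : G).

Lemma lie_smooth_manifold : smooth_manifold L.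
Proof. by have [hG _ cG tG] := lie_manifold G. Qed.
Let mG := lie_smooth_manifold.
Let mGG := prod_manifold mG mG.

Lemma smap_mul (M : chartedSpace R) (F H : M -> L) : smap F -> smap H ->
  smap ((fun z => (F z * H z)%g) : M -> L).
Proof.
move=> sF sH.
exact: (smap_comp (smap_pair mG mG sF sH) (smooth_map_smap mG (lie_mulP G))).
Qed.

Lemma smap_inv (M : chartedSpace R) (F : M -> L) : smap F ->
  smap ((fun z => (F z)^-1%g) : M -> L).
Proof.
by move=> sF; exact: (smap_comp sF (smooth_map_smap mG (lie_invP G))).
Qed.

Lemma smooth_comp (M N : chartedSpace R) (F : M -> N) f :
  smooth_fun f -> smap F -> smooth_fun (fun z => f (F z)).
Proof. by move=> sf [_]; apply. Qed.

Lemma smooth_mull p (f : L -> R) : smooth_fun f ->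
  smooth_fun (fun h : L => f (p * h)%g).
Proof.
move=> sf; apply: (@smooth_comp _ _ (fun h : L => (p * h)%g : L)) => //.
by apply: smap_mul; [exact: smap_cst|exact: smap_id].
Qed.

Lemma smooth_mulr p (f : L -> R) : smooth_fun f ->
  smooth_fun (fun h : L => f (h * p)%g).
Proof.
move=> sf; apply: (@smooth_comp _ _ (fun h : L => (h * p)%g : L)) => //.
by apply: smap_mul; [exact: smap_id|exact: smap_cst].
Qed.

Lemma smooth_left_inv x (f : L -> R) : smooth_fun f ->
  smooth_fun (left_inv x f : L -> R).
Proof.
move=> sf; apply: (@smooth_partial_snd _ _ _ (fun z : prod_space L L => f (z.1 * z.2)%g)) => //.
apply: (@smooth_comp _ _ (fun z : prod_space L L => (z.1 * z.2)%g : L)) => //.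
by apply: smap_mul; [exact: smap_fst|exact: smap_snd].
Qed.

Lemma right_invE y p (f : L -> R) : smooth_fun f ->
  val (right_inv y (p : L)) f = val y (fun h : L => f (h * p)%g).
Proof.
move=> sf; rewrite pushforwardE ?mul1g //.
by apply: smap_mul; [exact: smap_id|exact: smap_cst].
Qed.

Lemma smooth_right_inv y : smooth_field (fun p : L => right_inv y p).
Proof.
move=> f sf; under eq_fun do rewrite right_invE //.
apply: (@smooth_partial_snd _ _ _ (fun z : prod_space L L => f (z.2 * z.1)%g)) => //.
apply: (@smooth_comp _ _ (fun z : prod_space L L => (z.2 * z.1)%g : L)) => //.
by apply: smap_mul; [exact: smap_snd|exact: smap_fst].
Qed.

Lemma smap_conj p : smap (fun h : L => (p * h * p^-1)%g : L).
Proof.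
apply: smap_mul; last exact: smap_cst.
by apply: smap_mul; [exact: smap_cst|exact: smap_id].
Qed.

Lemma Ad_val p y (f : L -> R) : smooth_fun f ->
  val (Ad p y) f = val y (fun h : L => f (p * h * p^-1)%g).
Proof.
by move=> sf; rewrite pushforwardE ?mulg1 ?mulgV //; exact: smap_conj.
Qed.

(** Apply [tangent_diag] to [f (a * b^-1)], which is constant on the diagonal. *)
Lemma tangent1_inv x (f : L -> R) : smooth_fun f ->
  val x (fun h : L => f h^-1%g) = - val x f.
Proof.
move=> sf; have := @tangent_diag _ _ (fun z : prod_space L L => f (z.1 * z.2^-1)%g) _ x mG.
have sF : smooth_fun (fun z : prod_space L L => f (z.1 * z.2^-1)%g).
  apply: (@smooth_comp _ _ (fun z : prod_space L L => (z.1 * z.2^-1)%g : L)) => //.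
  by apply: smap_mul; [exact: smap_fst|apply: smap_inv; exact: smap_snd].
move=> /(_ sF) /=.
have -> : (fun a : L => f (a * a^-1)%g) = fun _ => f 1%g.
  by apply/funext => a; rewrite mulgV.
have -> : (fun a : L => f (a * 1^-1)%g) = f.
  by apply/funext => a; rewrite invg1 mulg1.
have -> : (fun a : L => f (1 * a^-1)%g) = fun a => f (a^-1)%g.
  by apply/funext => a; rewrite mul1g.
by rewrite (tangent_cst mG) => /esym/eqP; rewrite addr_eq0 => /eqP ->; rewrite opprK.
Qed.

(* Differentiate separately in the two occurrences of [t]. *)
Lemma conj_derivative x y (f : L -> R) : smooth_fun f ->
  val x (fun t : L => val y (fun s : L => f (t * s * t^-1)%g)) =
  val x (left_inv y f) - val y (left_inv x f).
Proof.
move=> sf; pose F (z : prod_space L L) := val y (fun s : L => f (z.1 * s * z.2^-1)%g).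
have sF : smooth_fun F.
  apply: (@smooth_partial_snd _ _ _ (fun u : prod_space (prod_space L L) L =>
    f (u.1.1 * u.2 * u.1.2^-1)%g)) => //.
  apply: (@smooth_comp _ _ (fun u : prod_space (prod_space L L) L =>
    (u.1.1 * u.2 * u.1.2^-1)%g : L)) => //.
  apply: smap_mul; first apply: smap_mul.
  - exact: (smap_comp (smap_fst _ _) (smap_fst _ _)).
  - exact: smap_snd.
  - by apply: smap_inv; exact: (smap_comp (smap_fst _ _) (smap_snd _ _)).
rewrite (@tangent_diag _ _ F _ x mG sF); congr (_ + _).
  apply: (congr1 (val x)); apply/funext => t; apply: (congr1 (val y)).
  by apply/funext => s /=; rewrite invg1 mulg1.
rewrite /F /=.
rewrite (@tangent_schwarz _ _ _ (fun z : prod_space L L => f (1 * z.2 * z.1^-1)%g)) //.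
  rewrite -mulN1r -(tangentZ mG); last exact: smooth_left_inv.
  apply: (congr1 (val y)); apply/funext => s; rewrite mulN1r.
  rewrite /= mul1g /left_inv -tangent1_inv //; exact: smooth_mull.
apply: (@smooth_comp _ _ (fun z : prod_space L L => (1 * z.2 * z.1^-1)%g : L)) => //.
apply: smap_mul; last by apply: smap_inv; exact: smap_fst.
by apply: smap_mul; [exact: smap_cst|exact: smap_snd].
Qed.

Lemma smooth_Ad_val y (f : L -> R) : smooth_fun f ->
  smooth_fun (fun t : L => val (Ad t y) f).
Proof.
move=> sf; under eq_fun do rewrite Ad_val //.
apply: (@smooth_partial_snd _ _ _ (fun z : prod_space L L => f (z.1 * z.2 * z.1^-1)%g)) => //.
apply: (@smooth_comp _ _ (fun z : prod_space L L => (z.1 * z.2 * z.1^-1)%g : L)) => //.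
apply: smap_mul; last by apply: smap_inv; exact: smap_fst.
by apply: smap_mul; [exact: smap_fst|exact: smap_snd].
Qed.

(* The commutator of the two derivations is a tangent vector because it is the
   derivative at 1 of the curve [t |-> Ad t y] in the tangent space at 1. *)
Lemma bracketE x y (f : L -> R) : smooth_fun f ->
  val (bracket x y) f = val x (left_inv y f) - val y (left_inv x f).
Proof.
move=> sf; rewrite mk_tangentE //; split=> [g ng|c ac c1]; first by case: asboolP.
have [gam [sg gc]] := near_coordinates mG ac c1.
exists (\row_l val x (fun t : L => val (Ad t y) (gam l))) => g {}sf.
case: asboolP => // _; rewrite -conj_derivative //.
have dg : differentiable (g \o cinv c) (cmap c (1%g : L)).
  exact/smooth_at_differentiable/smooth_fun_at.
transitivity (val x (fun t : L => \sum_l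
    'D_(delta_mx 0 l) (g \o cinv c) (cmap c (1%g : L)) * val (Ad t y) (gam l))).
  apply: (congr1 (val x)); apply/funext => t; rewrite -Ad_val //.
  have [u uE] := tangentP (Ad t y) ac c1.
  rewrite uE // derive_expand //; apply: eq_bigr => l _; rewrite mulrC; congr (_ * _).
  rewrite uE // -(derive_coord (cmap c (1%g : L)) u l); apply: near_eq_derive.
  have cl := near_ccod (cmap_cod c1).
  apply: filterS2 (near_cinv c1 gc) cl => z [cz gz] ccz /=.
  by rewrite gz cinvK.
have sAd l : smooth_fun (fun t : L => val (Ad t y) (gam l)) by exact: smooth_Ad_val.
rewrite tangent_sum // => [|l]; last first.
  by apply: smooth_funM => //; exact: smooth_fun_cst.
rewrite [RHS]derive_expand //; apply: eq_bigr => l _.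
by rewrite tangentZ // mxE mulrC.
Qed.

(** Since [Ad] of [p * t] is [Ad p] after [Ad t], the derivative at [p] reduces to the one at 1,
    which [conj_derivative] computes. *)
Lemma left_inv_Ad x y p (f : L -> R) : smooth_fun f ->
  left_inv x (fun t : L => val (Ad t y) f) p = val (Ad p (bracket x y)) f.
Proof.
move=> sf; have sfp : smooth_fun (fun h : L => f (p * h * p^-1)%g).
  by apply: (@smooth_comp _ _ (fun h : L => (p * h * p^-1)%g : L)) => //; exact: smap_conj.
rewrite Ad_val // bracketE // -conj_derivative // /left_inv.
apply: (congr1 (val x)); apply/funext => t; rewrite Ad_val //.
by apply: (congr1 (val y)); apply/funext => s; rewrite invgM !mulgA.
Qed.

(** From [p h q = (p q) (q^-1 h q)]; this is the origin of the inverse adjoint action of [q] on the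
    first coproduct factor. *)
Lemma left_inv_translate x q (f : L -> R) p : smooth_fun f ->
  left_inv x (fun t : L => f (t * q)%g) p = left_inv (Ad q^-1%g x) f (p * q)%g.
Proof.
move=> sf; rewrite /left_inv Ad_val; last exact: smooth_mull.
apply: (congr1 (val x)); apply/funext => h.
by rewrite invgK !mulgA mulgK.
Qed.

Lemma right_left_commute x y p (f : L -> R) : smooth_fun f ->
  val (right_inv y (p : L)) (left_inv x f) =
  left_inv x (fun t : L => val (right_inv y t) f) p.
Proof.
move=> sf; rewrite right_invE; last exact: smooth_left_inv.
rewrite /left_inv (@tangent_schwarz _ _ _ (fun z : prod_space L L => f (z.1 * p * z.2)%g)) //.
  apply: (congr1 (val x)); apply/funext => s; rewrite right_invE //.
  by apply: (congr1 (val y)); apply/funext => t; rewrite mulgA.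
apply: (@smooth_comp _ _ (fun z : prod_space L L => (z.1 * p * z.2)%g : L)) => //.
apply: smap_mul; last exact: smap_snd.
by apply: smap_mul; [exact: smap_fst|exact: smap_cst].
Qed.

Lemma left_invD x (f g : L -> R) p : smooth_fun f -> smooth_fun g ->
  left_inv x (fun t : L => f t + g t) p = left_inv x f p + left_inv x g p.
Proof. by move=> sf sg; apply: tangentD => //; exact: smooth_mull. Qed.

Lemma left_invM x (f g : L -> R) p : smooth_fun f -> smooth_fun g ->
  left_inv x (fun t : L => f t * g t) p = f p * left_inv x g p + g p * left_inv x f p.
Proof.
move=> sf sg; rewrite /left_inv (@tangentM _ _ mG _ x (fun h : L => f (p * h)%g)
  (fun h : L => g (p * h)%g)) ?mulg1 //; exact: smooth_mull.
Qed.

Lemma left_invZ x a (f : L -> R) p : smooth_fun f ->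
  left_inv x (fun t : L => a * f t) p = a * left_inv x f p.
Proof. by move=> sf; apply: tangentZ => //; exact: smooth_mull. Qed.

Lemma left_inv_sum x (I : Type) (r : seq I) (f : I -> L -> R) p :
  (forall i, smooth_fun (f i)) ->
  left_inv x (fun t : L => \sum_(i <- r) f i t) p = \sum_(i <- r) left_inv x (f i) p.
Proof. by move=> sf; apply: tangent_sum => // i; exact: smooth_mull. Qed.

End LieGroups.

(** * Left-invariant derivations of forms *)

Section WedgeIdentities.
Variables (R : realType) (M : chartedSpace R).
Hypothesis mM : smooth_manifold M.

(** Every permutation contributes the same term, its sign being cancelled by the alternation of [w],
    and the number of permutations cancels the normalisation. *)
Lemma wedge_form0E k (f : M -> R) (w : diff_form M k) (p : M)
    (v : 'I_k -> tangent p) : smooth_fun f ->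
  form_val (wedge_form (form0 f) w : diff_form M k) v = f p * w p v.
Proof.
move=> sf.
rewrite -[LHS]/(wedge_form (form0 f) w p (v : 'I_(0 + k) -> tangent p)).
rewrite wedge_formE // /wedge_alt mul1r.
have E (s : 'S_(0 + k)) : (-1) ^+ s * form0 f p (fun i => v (s (lshift k i))) *
    w p (fun i => v (s (rshift 0 i))) = f p * w p v.
  rewrite form0E // (_ : (fun i => v (s (rshift 0 i))) = v \o s).
    rewrite (alternating_perm _ _ (form_alternating w p)).
    by rewrite mulrACA -expr2 sqrr_sign mul1r.
  by apply/funext => i; congr (v (s _)); apply: val_inj.
rewrite (eq_bigr (fun=> f p * w p v)) // sumr_const card_Sn.
by rewrite -[_ *+ (0 + k)`!]mulr_natl add0n mulKf // pnatr_eq0 -lt0n fact_gt0.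
Qed.

Lemma fcons_linear (V : lmodType R) k (f : ('I_k.+1 -> V) -> R) (I : Type)
    (r : seq I) (a : I -> R) (x : I -> V) (v : 'I_k -> V) : is_alternating f ->
  f (fcons (\sum_(l <- r) a l *: x l) v) = \sum_(l <- r) a l * f (fcons (x l) v).
Proof.
move=> af; have E y : fcons y v = upd (fcons 0 v) ord0 y.
  apply/funext => i; rewrite /fcons /upd; case: unliftP => [j|] ->.
    by rewrite eq_sym (negbTE (neq_lift _ _)).
  by rewrite eqxx.
by rewrite E alternating_sum //; apply: eq_bigr => l _; rewrite E.
Qed.

(** For a fixed permutation, summing over [l] reassembles the first argument into [chi p] times
    itself, so each permutation gives [chi p * w p v]. There are [k.+1] factorial of them against a
    normalisation by [k] factorial, hence the factor [k.+1]. *)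
Lemma frame_expansion k m (w : diff_form M k.+1) (chi : M -> R)
    (gam : 'I_m -> M -> R) (E : 'I_m -> forall p : M, tangent p) :
  smooth_fun chi -> (forall l, smooth_fun (gam l)) ->
  (forall l, smooth_field (E l)) ->
  (forall p (v : tangent p), chi p *: v = \sum_l val v (gam l) *: E l p) ->
  (wedge_form (form0 chi) w : diff_form M k.+1) =
  k.+1%:R^-1 *: \sum_l (wedge_form (dform (gam l)) (interior_product (E l) w)
                        : diff_form M k.+1).
Proof.
move=> schi sg sE EE; apply: form_ext => p v.
rewrite -[LHS]/(form_val (wedge_form (form0 chi) w : diff_form M k.+1) v).
rewrite wedge_form0E // form_valZ form_val_sum.
have wE (s : 'S_(1 + k)) :
    fcons (v (s (lshift k ord0))) (fun i => v (s (rshift 1 i))) = v \o s.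
  apply/funext => i; rewrite /fcons; case: unliftP => [j|] ->.
    by congr (v (s _)); apply: val_inj.
  by congr (v (s _)); apply: val_inj.
have -> : \sum_l form_val
    (wedge_form (dform (gam l)) (interior_product (E l) w) : diff_form M k.+1) v =
    k`!%:R^-1 * \sum_(s : 'S_(1 + k)) chi p * w p v.
  transitivity (\sum_l (k`!%:R^-1 * \sum_(s : 'S_(1 + k)) (-1) ^+ s *
      (val (v (s (lshift k ord0))) (gam l) *
       w p (fcons (E l p) (fun i => v (s (rshift 1 i))))))).
    apply: eq_bigr => l _.
    rewrite -[LHS]/(wedge_form (dform (gam l)) (interior_product (E l) w) p v).
    rewrite wedge_formE // /wedge_alt mul1r; congr (_ * _); apply: eq_bigr => s _.
    by rewrite dformE // interior_productE // mulrA.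
  rewrite -mulr_sumr exchange_big /=; congr (_ * _); apply: eq_bigr => s _.
  rewrite -mulr_sumr -(fcons_linear _ _ _ _ (form_alternating w p)) -EE.
  (* A one-term sum: this pulls the scalar [chi p] out of the first argument. *)
  have := fcons_linear [:: tt] (fun=> chi p) (fun=> v (s (lshift k ord0)))
    (fun i => v (s (rshift 1 i))) (form_alternating w p).
  rewrite !big_seq1 => ->; rewrite wE (alternating_perm _ _ (form_alternating w p)).
  by rewrite mulrA mulrACA -expr2 sqrr_sign mul1r.
rewrite sumr_const card_Sn add1n factS -[_ *+ (k.+1 * _)]mulr_natl natrM.
rewrite (mulrC k.+1%:R) -mulrA mulKf ?pnatr_eq0 -?lt0n ?fact_gt0 //.
by rewrite mulKf // pnatr_eq0.
Qed.

End WedgeIdentities.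

Section LeftInvariantDerivation.
Variables (R : realType) (G : lieGroup R).
Notation L := (lie_space G).
Notation gg := (lie_algebra G).
Let mG := lie_smooth_manifold G.
Variables (x : gg) (D : forall k, {linear diff_form L k -> diff_form L k}).
Hypothesis D_fun : forall w p, fun_of_form0 (D 0%N w) p = left_inv x (fun_of_form0 w) p.
Hypothesis D_wedge : forall k j (w : diff_form L k) (z : diff_form L j),
  D (k + j)%N (wedge_form w z) = wedge_form (D k w) z + wedge_form w (D j z).
Hypothesis D_d : forall k (w : diff_form L k) (z : diff_form L k.+1),
  is_exterior_derivative w z -> is_exterior_derivative (D k w) (D k.+1 z).

Definition on_right_inv k (w : diff_form L k) (y : 'I_k -> gg) (p : L) : R :=
  w p (fun i => right_inv (y i) p).

Lemma smooth_on_right_inv k (w : diff_form L k) y : smooth_fun (on_right_inv w y).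
Proof.
apply: (form_fields_smooth mG w (X := fun i p => right_inv (y i) p)) => i.
exact: smooth_right_inv.
Qed.

Let commutes k (w : diff_form L k) :=
  forall y p, on_right_inv (D k w) y p = left_inv x (on_right_inv w y) p.

Let commutes0 (w : diff_form L 0) : commutes w.
Proof.
have E z y p : on_right_inv z y p = fun_of_form0 z p.
  by congr (form_val z _); apply/funext => -[].
move=> y p; rewrite E D_fun; congr (left_inv x _ p).
by apply/funext => q; rewrite E.
Qed.

Let D_form0 g : smooth_fun g -> D 0%N (form0 g) = form0 (left_inv x g : L -> R).
Proof.
move=> sg; apply: form_ext => p v.
rewrite form0E //; last exact: smooth_left_inv.
transitivity (fun_of_form0 (D 0%N (form0 g)) p).
  by congr (form_val _ _); apply/funext => -[].
by rewrite D_fun; congr (left_inv x _ p); apply/funext => q; exact: form0E.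
Qed.

(** Commutation with d identifies [D] of the differential of [g] with the differential of
    [left_inv x g]; what remains is [right_left_commute]. *)
Let commutes_dform g : smooth_fun g -> commutes (dform g).
Proof.
move=> sg y p; have sxg := smooth_left_inv x sg.
have -> : D 1%N (dform g) = dform (left_inv x g : L -> R).
  apply: (exterior_derivative_fun mG) => //.
  by rewrite -D_form0 //; apply: D_d; exact: dform_derivative.
rewrite /on_right_inv dformE // right_left_commute //.
by congr (left_inv x _ p); apply/funext => q; rewrite dformE.
Qed.

Let commutesD k (w z : diff_form L k) : commutes w -> commutes z -> commutes (w + z).
Proof.
move=> cw cz y p; rewrite linearD.
rewrite -[LHS]/(on_right_inv (D k w) y p + on_right_inv (D k z) y p) cw cz.
by rewrite -left_invD //; exact: smooth_on_right_inv.
Qed.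

Let commutesZ k a (w : diff_form L k) : commutes w -> commutes (a *: w).
Proof.
move=> cw y p; rewrite linearZ.
rewrite -[LHS]/(a * on_right_inv (D k w) y p) cw.
by rewrite -left_invZ //; exact: smooth_on_right_inv.
Qed.

Let commutes_wedge k j (w : diff_form L k) (z : diff_form L j) :
  commutes w -> commutes z -> commutes (wedge_form w z).
Proof.
move=> cw cz y p; rewrite D_wedge.
rewrite -[LHS]/(wedge_form (D k w) z p _ + wedge_form w (D j z) p _) !wedge_formE //.
pose yl (s : 'S_(k + j)) i := y (s (lshift j i)).
pose yr (s : 'S_(k + j)) i := y (s (rshift k i)).
have -> : on_right_inv (wedge_form w z) y = fun q => (k`!%:R * j`!%:R)^-1 *
    \sum_(s : 'S_(k + j)) (-1) ^+ s * (on_right_inv w (yl s) q * on_right_inv z (yr s) q).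
  apply/funext => q; rewrite /on_right_inv wedge_formE //; congr (_ * _).
  by apply: eq_bigr => s _; rewrite mulrA.
have sm s : smooth_fun (fun q => on_right_inv w (yl s) q * on_right_inv z (yr s) q).
  by apply: smooth_funM; exact: smooth_on_right_inv.
have sm' (s : 'S_(k + j)) : smooth_fun (fun q : L =>
    (-1) ^+ s * (on_right_inv w (yl s) q * on_right_inv z (yr s) q)).
  by apply: smooth_funM => //; exact: smooth_fun_cst.
rewrite left_invZ; last exact: smooth_fun_sum.
rewrite left_inv_sum // /wedge_alt -mulrDr; congr (_ * _).
rewrite -big_split /=; apply: eq_bigr => s _.
rewrite left_invZ // left_invM; [|exact: smooth_on_right_inv..].
rewrite -cw -cz /on_right_inv /yl /yr -!mulrA -mulrDr; congr (_ * _).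
by rewrite addrC; congr (_ + _); exact: mulrC.
Qed.

Lemma left_inv_right_inv k (w : diff_form L k) y p :
  on_right_inv (D k w) y p = left_inv x (on_right_inv w y) p.
Proof.
elim: k w y p => [|k IH] w y p; first exact: commutes0.
have [c ac cp] := some_chart mG p.
have [chi [gam [E [[schi sg] sE EE E1 _]]]] := local_frame mG ac cp.
have chi1 : chi p = 1 by have [_ ->] := nbhs_singleton E1.
have := frame_expansion mG w schi sg sE EE => wE.
have : commutes (wedge_form (form0 chi) w : diff_form L k.+1).
  rewrite wE; apply: commutesZ; elim/big_ind: _ => [|w1 w2|l _].
  - by move=> y' p'; rewrite linear0; exact: (esym (tangent_cst mG x 0)).
  - exact: commutesD.
  - apply: (@commutes_wedge 1 k); [exact: commutes_dform|exact: IH].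
move=> /(_ y p); rewrite (D_wedge (form0 chi) w).
rewrite -[LHS]/(form_val (wedge_form (D 0%N (form0 chi)) w : diff_form L k.+1)
    (fun i => right_inv (y i) p) +
  form_val (wedge_form (form0 chi) (D k.+1 w) : diff_form L k.+1)
    (fun i => right_inv (y i) p)).
(* Both sides for [chi] times [w] contain the derivative of [chi] times the value of [w]; cancelling
   it leaves the claim because [chi p = 1]. *)
rewrite D_form0 // !wedge_form0E //; last exact: smooth_left_inv.
rewrite (_ : on_right_inv _ _ = fun q => chi q * on_right_inv w y q); last first.
  by apply/funext => q; rewrite /on_right_inv wedge_form0E.
rewrite left_invM //; last exact: smooth_on_right_inv.
rewrite chi1 !mul1r addrC mulrC => /addIr; apply.
Qed.

End LeftInvariantDerivation.

(** * Algebras spanned by monomials *)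

Section MonomialSpan.
Variables (R : realType) (V : lmodType R) (A : algType R) (f : V -> A).

Definition monomial (s : seq V) : A := \prod_(y <- s) f y.

Definition monomial_span (a : A) :=
  exists r : seq (R * seq V), a = \sum_(t <- r) t.1 *: monomial t.2.

Lemma monomial_spanP s : monomial_span (monomial s).
Proof. by exists [:: (1, s)]; rewrite big_seq1 scale1r. Qed.

Lemma monomial_span_ind (P : A -> Prop) :
  (forall s, P (monomial s)) ->
  (forall c a b, monomial_span a -> P a -> monomial_span b -> P b -> P (c *: a + b)) ->
  forall a, monomial_span a -> P a.
Proof.
move=> Pm PD a [r ->]; elim: r => [|t r IH].
  (* The empty sum is written as minus a monomial plus that monomial, so that the two clauses on [P]
     cover it. *)
  rewrite big_nil -(addNr (monomial [::])) -scaleN1r.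
  by apply: PD => //; exact: monomial_spanP.
by rewrite big_cons; apply: PD => //; [exact: monomial_spanP|exists r].
Qed.

Lemma monomial_span0 : monomial_span 0.
Proof. by exists [::]; rewrite big_nil. Qed.

Lemma monomial_spanD a b : monomial_span a -> monomial_span b -> monomial_span (a + b).
Proof. by move=> [r ->] [t ->]; exists (r ++ t); rewrite big_cat. Qed.

Lemma monomial_spanZ c a : monomial_span a -> monomial_span (c *: a).
Proof.
move=> [r ->]; exists [seq (c * t.1, t.2) | t <- r].
by rewrite big_map scaler_sumr; apply: eq_bigr => t _; rewrite scalerA.
Qed.

Lemma monomial_spanM a b : monomial_span a -> monomial_span b -> monomial_span (a * b).
Proof.
move=> [r ->] [t ->]; rewrite mulr_suml.
elim: r => [|x r IH]; first by rewrite big_nil; exact: monomial_span0.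
rewrite big_cons; apply: monomial_spanD => //; rewrite mulr_sumr.
elim: t {IH} => [|y t IH]; first by rewrite big_nil; exact: monomial_span0.
rewrite big_cons; apply: monomial_spanD => //.
rewrite -scalerAl -scalerAr scalerA /monomial -big_cat.
exact/monomial_spanZ/monomial_spanP.
Qed.

Lemma monomial_span_gen x : monomial_span (f x).
Proof. by have := monomial_spanP [:: x]; rewrite /monomial big_seq1. Qed.

Definition monomial_pred : {pred A} := fun a => `[< monomial_span a >].

Lemma monomial_subalg : GRing.subsemialg_closed monomial_pred.
Proof.
split.
- by apply/asboolP; have := monomial_spanP [::]; rewrite /monomial big_nil.
- split; first by apply/asboolP; exact: monomial_span0.
  by move=> a b /asboolP sa /asboolP sb; apply/asboolP; exact: monomial_spanD.
- by move=> c a /asboolP sa; apply/asboolP; exact: monomial_spanZ.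
- by move=> a b /asboolP sa /asboolP sb; apply/asboolP; exact: monomial_spanM.
Qed.

Definition subalgebra_of_span : Type := {a | monomial_pred a}.
HB.instance Definition _ := SubChoice.on subalgebra_of_span.
HB.instance Definition _ := GRing.SubChoice_isSubAlgebra.Build R A monomial_pred
  subalgebra_of_span monomial_subalg.

End MonomialSpan.

Section Enveloping.
Variables (R : realType) (G : lieGroup R) (U : algType R).
Variable iU : {linear lie_algebra G -> U}.
Hypothesis U_enveloping : is_enveloping iU.

(* The universal property yields a retraction of [U] onto the subalgebra
   generated by the image of [iU]. *)
Lemma enveloping_span (v : U) : monomial_span iU v.
Proof.
have [iU_lie univ] := U_enveloping.
pose S := subalgebra_of_span iU.
pose g x : S := Sub (iU x) (asboolT (monomial_span_gen iU x)).
have lg : linear g by move=> a x y; apply: val_inj; rewrite /= linearP.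
pose gM := GRing.isLinear.Build _ _ _ _ _ lg.
pose gL : {linear lie_algebra G -> S} := HB.pack g gM.
have [|[h hE] _] := univ S gL.
  by move=> x y; apply: val_inj; rewrite /= iU_lie.
have [_ uniq] := univ U iU iU_lie.
pose e : U -> U := \val \o h.
have le : linear e by move=> a x y; rewrite /e /= !linearP.
have me : monoid_morphism e by split=> [|x y]; rewrite /e /= ?rmorph1 ?rmorphM.
pose e1 := GRing.isLinear.Build _ _ _ _ _ le.
pose e2 := GRing.isMonoidMorphism.Build _ _ _ me.
pose H : {lrmorphism U -> U} := HB.pack e e1 e2.
have E := uniq H idfun; rewrite -[v]/(idfun v) -E => [|x]; last by rewrite /= /e /= hE.
exact: asboolW (valP (h v)).
Qed.

End Enveloping.

(** * Currents given by differential operators at a point *)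

Lemma derive_big (R : realType) (V : normedModType R) (I : Type) (r : seq I)
    (f : I -> V -> R) x v : (forall i, derivable (f i) x v) ->
  'D_v (fun y => \sum_(i <- r) f i y) x = \sum_(i <- r) 'D_v (f i) x.
Proof.
move=> df; suff [] : derivable (fun y => \sum_(i <- r) f i y) x v /\
  'D_v (fun y => \sum_(i <- r) f i y) x = \sum_(i <- r) 'D_v (f i) x by [].
elim: r => [|i r [dr IH]].
  have -> : (fun y => \sum_(i <- [::]) f i y) = cst 0.
    by apply/funext => y; rewrite big_nil.
  by split; [exact: derivable_cst|rewrite derive_cst big_nil].
have -> : (fun y => \sum_(j <- i :: r) f j y) = f i + (fun y => \sum_(j <- r) f j y).
  by apply/funext => y; rewrite big_cons.
by split; [exact: derivableD|rewrite deriveD // IH big_cons].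
Qed.

Section PointCurrents.
Variables (R : realType) (M : chartedSpace R).
Hypothesis mM : smooth_manifold M.
Notation n := (space_dim M).
Notation field := (forall p : M, tangent p).

Fixpoint smooth_fields (Xs : seq field) : Prop :=
  if Xs is X :: Xs' then smooth_field X /\ smooth_fields Xs' else True.

Definition apply_fields (Xs : seq field) (f : M -> R) : M -> R :=
  foldr (fun (X : field) g z => val (X z) g) f Xs.

Lemma smooth_apply_fields Xs f :
  smooth_fields Xs -> smooth_fun f -> smooth_fun (apply_fields Xs f).
Proof.
by move=> + sf; elim: Xs => [|X Xs IH] //= [sX sXs]; apply: sX; exact: IH.
Qed.

Lemma apply_fields_linear Xs f g (a : R) : smooth_fields Xs ->
  smooth_fun f -> smooth_fun g ->
  apply_fields Xs (fun z => a * f z + g z) =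
  fun z => a * apply_fields Xs f z + apply_fields Xs g z.
Proof.
move=> + sf sg; elim: Xs => [|X Xs IH] //= [sX sXs].
apply/funext => z; rewrite IH // tangentD ?tangentZ //.
- exact: smooth_apply_fields.
- apply: smooth_funM; [exact: smooth_fun_cst|exact: smooth_apply_fields].
- exact: smooth_apply_fields.
Qed.

(** The fields [Y] are indexed by [nat], so the evaluation makes sense in every degree [k] without a
    cast along [k = d]. *)
Definition field_current (Xs : seq field) (Y : nat -> field) d (z0 : M) : current M :=
  fun k w => if k == d then apply_fields Xs (fun z => w z (fun i => Y i z)) z0 else 0.

Section Representation.
Variables (k : nat) (c : chart R M n) (N : set M).
Hypotheses (ac : atlas c) (oN : open N) (Nc : N `<=` cdom c).

Definition coef (w : diff_form M k) (e : 'I_k -> 'I_n) : 'rV[R]_n -> R :=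
  form_coef w c (fun l => delta_mx 0 (e l)).

(* [F] is, over [N], a differential operator on the coefficients of forms. *)
Definition representable (F : diff_form M k * M -> R) :=
  exists (I : finType) (a : I -> M -> R) (s : I -> seq 'I_n) (e : I -> 'I_k -> 'I_n),
    (forall i, smooth_fun (a i)) /\
    forall w z, N z -> F (w, z) =
      \sum_i a i z * iter_partial (s i) (coef w (e i)) (cmap c z).

Lemma eq_representable F F' : (forall w z, N z -> F (w, z) = F' (w, z)) ->
  representable F -> representable F'.
Proof.
move=> FF' [I [a [s [e [sa FE]]]]]; exists I, a, s, e; split=> // w z Nz.
by rewrite -FF' // FE.
Qed.

Lemma representable0 : representable (fun=> 0).
Proof.
exists 'I_0, (fun=> fun=> 0), (fun=> [::]),
  (fun i : 'I_0 => match notF (ltn_ord i) with end).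
split=> [[]//|w z _]; by rewrite big_ord0.
Qed.

Lemma representableD F F' : representable F -> representable F' ->
  representable (fun y => F y + F' y).
Proof.
move=> [I [a [s [e [sa FE]]]]] [I' [a' [s' [e' [sa' FE']]]]].
exists (I + I')%type, (fun i => match i with inl i => a i | inr i => a' i end),
  (fun i => match i with inl i => s i | inr i => s' i end),
  (fun i => match i with inl i => e i | inr i => e' i end).
split=> [[]//|w z Nz]; by rewrite big_sumType /= FE // FE'.
Qed.

Lemma representableM b F : smooth_fun b -> representable F ->
  representable (fun y => b y.2 * F y).
Proof.
move=> sb [I [a [s [e [sa FE]]]]].
exists I, (fun i z => b z * a i z), s, e; split=> [i|w z Nz].
  exact: smooth_funM.
by rewrite FE // mulr_sumr; apply: eq_bigr => i _; rewrite mulrA.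
Qed.

Lemma representable_sum m (F : 'I_m -> diff_form M k * M -> R) :
  (forall i, representable (F i)) -> representable (fun y => \sum_i F i y).
Proof.
elim: m F => [|m IH] F rF.
  by apply: eq_representable representable0 => w z _; rewrite big_ord0.
apply: eq_representable (representableD (rF ord0) (IH _ (fun i => rF (lift ord0 i)))).
by move=> w z _; rewrite big_ord_recl.
Qed.

Lemma smooth_iter_partial (w : diff_form M k) s e y : ccod c y ->
  smooth_at (iter_partial s (coef w e)) y.
Proof.
move=> cy; elim: s => [|i s IH] /=; last exact: smooth_at_derive.
have [_ _ sw] := diff_formP w.
by apply: smooth_on_at (sw c _ ac) cy; exact: ccod_open.
Qed.

(** Leibniz rule: one copy of the index set differentiates the functions [a i], the other adds a
    partial derivative to the form coefficients. *)
Lemma representable_partial F (E : field) l : representable F ->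
  (forall w, smooth_fun (fun z => F (w, z))) -> smooth_field E ->
  (forall z, N z -> E z = chart_vec c z (delta_mx 0 l)) ->
  representable (fun y => val (E y.2) (fun z => F (y.1, z))).
Proof.
move=> [I [a [s [e [sa FE]]]]] sF sE EN.
apply: (@eq_representable (fun y =>
  (\sum_i val (E y.2) (a i) * iter_partial (s i) (coef y.1 (e i)) (cmap c y.2)) +
  (\sum_i a i y.2 * iter_partial (l :: s i) (coef y.1 (e i)) (cmap c y.2)))); last first.
  by apply: representableD; [exists I, (fun i z => val (E z) (a i)), s, e|
    exists I, a, (fun i => l :: s i), e]; split=> // i; exact: sE.
move=> w z Nz /=; have cz := Nc Nz; rewrite !EN // chart_vecE //.
rewrite (@near_eq_derive _ _ _ _ (fun y => \sum_i (a i \o cinv c) y *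
    iter_partial (s i) (coef w (e i)) y)); last first.
  have nN := near_cinv cz (open_nbhs_nbhs (conj oN Nz)).
  apply: filterS2 nN (near_ccod (cmap_cod cz)) => y Ny cy /=.
  by rewrite FE // cinvK.
have da i : derivable (a i \o cinv c) (cmap c z) (delta_mx 0 l).
  by apply: smooth_at_derivable; exact: smooth_fun_at.
have ds i : derivable (iter_partial (s i) (coef w (e i))) (cmap c z) (delta_mx 0 l).
  by apply: smooth_at_derivable; apply: smooth_iter_partial; exact: cmap_cod.
rewrite derive_big => [|i]; last exact: derivableM.
rewrite -big_split /=; apply: eq_bigr => i _; rewrite chart_vecE //.
have -> : (fun y => (a i \o cinv c) y * iter_partial (s i) (coef w (e i)) y) =
    (a i \o cinv c) * iter_partial (s i) (coef w (e i)) by [].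
by rewrite deriveM // /GRing.scale /= cmapK // addrC; congr (_ + _); exact: mulrC.
Qed.

Hypothesis chi_frame : exists (chi : M -> R) (gam : 'I_n -> M -> R) (E : 'I_n -> field),
  [/\ forall l, smooth_fun (gam l), forall l, smooth_field (E l),
      forall p (v : tangent p), chi p *: v = \sum_l val v (gam l) *: E l p
    & forall z, N z -> chi z = 1 /\ forall l, E l z = chart_vec c z (delta_mx 0 l)].

Lemma representable_field F (X : field) : representable F ->
  (forall w, smooth_fun (fun z => F (w, z))) -> smooth_field X ->
  representable (fun y => val (X y.2) (fun z => F (y.1, z))).
Proof.
move=> rF sF sX; have [chi [gam [E [sg sE EE EN]]]] := chi_frame.
apply: (@eq_representable (fun y => \sum_l val (X y.2) (gam l) *
    val (E l y.2) (fun z => F (y.1, z)))).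
  move=> w z Nz /=; have [chi1 _] := EN z Nz.
  rewrite -[in RHS](scale1r (X z)) -chi1 EE tangent_val_sum.
  by apply: eq_bigr => l _; rewrite tangent_valZ.
apply: representable_sum => l.
apply: (@representableM (fun z => val (X z) (gam l))
  (fun y => val (E l y.2) (fun z => F (y.1, z)))); first exact: sX.
apply: (representable_partial (l := l)) => // z Nz.
by have [_] := EN z Nz; apply.
Qed.

Lemma representable_apply F Xs : representable F ->
  (forall w, smooth_fun (fun z => F (w, z))) -> smooth_fields Xs ->
  representable (fun y => apply_fields Xs (fun z => F (y.1, z)) y.2).
Proof.
move=> rF sF; elim: Xs => [_|X Xs IH /= [sX sXs]].
  by apply: eq_representable rF.
apply: (@representable_field (fun y => apply_fields Xs (fun z => F (y.1, z)) y.2)) => //.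
  exact: IH.
by move=> w /=; apply: (@smooth_apply_fields Xs (fun z => F (w, z))) => //; exact: sF.
Qed.

Lemma representable_eval (Y : 'I_k -> field) : (forall i, smooth_field (Y i)) ->
  representable (fun y => y.1 y.2 (fun i => Y i y.2)).
Proof.
move=> sY; have [chi [gam [E [sg sE EE EN]]]] := chi_frame.
apply: (@eq_representable (fun y => y.1 y.2
    (fun i => \sum_l val (Y i y.2) (gam l) *: E l y.2))).
  move=> w z Nz /=; congr (form_val w _); apply/funext => i.
  by rewrite -EE; have [-> _] := EN z Nz; rewrite scale1r.
(* The parameter is the pair of form and point, so one operator serves all forms; the multipliers
   are functions of the point alone. *)
apply: (@eval_expansion_ind _ _ _ _ fst _ snd E (fun i l y => val (Y i y.2) (gam l))
  representable (fun b => exists2 b', smooth_fun b' & b = b' \o snd)).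
- exact: representable0.
- by move=> f g; exact: representableD.
- by move=> _ f [b sb ->]; exact: representableM.
- move=> i l; exists (fun z => val (Y i z) (gam l)) => //; exact: sY.
move=> e; exists unit, (fun=> fun=> 1), (fun=> [::]), (fun=> e).
split=> [_|w z Nz]; first exact: smooth_fun_cst.
rewrite (big_pred1 tt) => [|[]//]; rewrite mul1r /= /coef /form_coef.
have cz := Nc Nz; have [_ Ez] := EN z Nz.
have -> : (fun i => E (e i) z) = (fun i => chart_vec c z (delta_mx 0 (e i))).
  by apply/funext => i; rewrite Ez.
have H q : q = z -> val w q (fun i => chart_vec c q (delta_mx 0 (e i))) =
  val w z (fun i => chart_vec c z (delta_mx 0 (e i))) by move=> ->.
rewrite -[LHS](H (cinv c (cmap c z))) ?cmapK //; congr (val w _ _).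
by apply/funext => i; rewrite coord_vecE //; exact: cmap_cod.
Qed.

End Representation.

Lemma field_current_is_current Xs Y d z0 :
  smooth_fields Xs -> (forall i, smooth_field (Y i)) ->
  is_current (field_current Xs Y d z0).
Proof.
move=> sXs sY k.
have sev (w : diff_form M k) : smooth_fun (fun z => w z (fun i => Y i z)).
  by apply: (form_fields_smooth mM w (X := fun i => Y i)).
split=> [a w z|].
  rewrite /field_current; case: eqP => _; last by rewrite mulr0 addr0.
  have := apply_fields_linear a sXs (sev w) (sev z).
  by move=> /(congr1 (fun f => f z0)).
have [c ac cz] := some_chart mM z0.
have [chi [gam [E [[schi sg] sE EE E1 _]]]] := local_frame mM ac cz.
have [N [oN Nz NE]] := near_open E1.
have Nc : N `<=` cdom c by move=> z /NE[].
have frame : exists (chi : M -> R) (gam : 'I_n -> M -> R) (E : 'I_n -> field),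
  [/\ forall l, smooth_fun (gam l), forall l, smooth_field (E l),
      forall p (v : tangent p), chi p *: v = \sum_l val v (gam l) *: E l p
    & forall z, N z -> chi z = 1 /\ forall l, E l z = chart_vec c z (delta_mx 0 l)].
  by exists chi, gam, E; split=> // z /NE[].
have [I [a [s [e [_ rE]]]]] := representable_apply ac oN Nc frame
  (representable_eval Nc frame (fun i : 'I_k => sY i)) sev sXs.
(* The current lives at [z0], so one chart and a one-point compact set suffice; the order is the
   longest string of partial derivatives, and the constant comes from the values at [z0] of the
   coefficients of the operator. *)
exists 1%N, (\max_i size (s i))%N, (fun=> c), (fun=> [set cmap c z0]),
  (\sum_i `|a i z0|); split.
  move=> _; split=> //; first exact: compact_set1.
  by move=> _ ->; exact: cmap_cod.
move=> w b b0 wb; rewrite /field_current; case: eqP => _; last first.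
  by rewrite normr0 mulr_ge0 // sumr_ge0.
rewrite [X in `|X|](rE w z0 Nz) mulr_suml (le_trans (ler_norm_sum _ _ _)) //.
apply: ler_sum => i _; rewrite normrM ler_wpM2l //.
apply: (wb ord0 (cmap c z0) (e i)) => //.
exact: (leq_bigmax i).
Qed.

End PointCurrents.

(** * Derivatives of forms evaluated on right-invariant multivectors *)

(** [tensor_eq] is tested on the module [R^o]; taking a bare function with two linearity proofs
    spares packaging a bilinear map at each use. *)
Lemma tensor_eq_sum (R : realType) (V : lmodType R) (s t : seq (V * V)) (b : V -> V -> R) :
  (forall z a u v, b (a *: u + v) z = a * b u z + b v z) ->
  (forall z a u v, b z (a *: u + v) = a * b z u + b z v) ->
  tensor_eq s t -> \sum_(x <- s) b x.1 x.2 = \sum_(x <- t) b x.1 x.2.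
Proof.
move=> bl br st.
pose b' : V -> V -> R^o := b.
have bb : bilinear_for (GRing.Scale.Law.clone _ _ *:%R _)
    (GRing.Scale.Law.clone _ _ *:%R _) b'.
  by split=> z a u v; [exact: bl|exact: br].
pose bM := bilinear_isBilinear.Build R V V R^o _ _ b' bb.
pose bL : {bilinear V -> V -> R^o} := HB.pack b' bM.
exact: (st R^o bL).
Qed.

Section RightInvariantEvaluation.
Variables (R : realType) (G : lieGroup R).
Notation L := (lie_space G).
Notation gg := (lie_algebra G).
Let mG := lie_smooth_manifold G.
Variables (U : algType R) (iU : {linear gg -> U}).
Hypothesis U_enveloping : is_enveloping iU.
Variables (E : algType R) (iE : {linear gg -> E}).
Variables (Delta : U -> seq (U * U)).
Hypothesis Delta_coproduct : is_coproduct iU Delta.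
Variables (AdU : G -> {lrmorphism U -> U}).
Hypothesis AdU_extends : forall g x, AdU g (iU x) = iU (Ad g x).
Variables (AdE : G -> {lrmorphism E -> E}).
Hypothesis AdE_extends : forall g x, AdE g (iE x) = iE (Ad g x).
Variables (br : U -> {linear E -> E}).
Hypothesis br_extends : extends_bracket iU iE br.
Variables (rho : forall k, U -> {linear diff_form L k -> diff_form L k}).
Hypothesis rho_lie : is_lie_derivative iU rho.
Variables (ev : forall k, diff_form L k -> G -> {scalar E}).
Hypothesis ev_right_inv : is_right_inv_eval iE ev.

Lemma ev_monomial k (w : diff_form L k) (p : L) s :
  ev w p (monomial iE s) =
  if k == size s then on_right_inv w (fun i => nth 0 s i) p else 0.
Proof.
have [evk evn] := ev_right_inv w p.
rewrite /monomial (big_nth 0) big_mkord.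
case: eqP => [kE|/nesym kN]; last exact: evn.
by case: _ / kE; rewrite evk.
Qed.

Lemma ev_linear k (w : diff_form L k) p c (a b : E) :
  ev w p (c *: a + b) = c * ev w p a + ev w p b.
Proof. by rewrite linearP. Qed.

(** Linearity in the form is read off the values on monomials, which [is_right_inv_eval] prescribes,
    and extends to their span. *)
Lemma ev_form_linear k (w z : diff_form L k) (p : L) c a : monomial_span iE a ->
  ev (c *: w + z) p a = c * ev w p a + ev z p a.
Proof.
move=> sa; elim/monomial_span_ind: a / sa => [s|d a b sa IHa sb IHb].
- rewrite !ev_monomial; case: eqP => _; first by [].
  by rewrite mulr0 addr0.
- by rewrite !ev_linear IHa IHb; ring.
Qed.

Lemma smooth_ev k (w : diff_form L k) a : monomial_span iE a ->
  smooth_fun (fun p : L => ev w p a).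
Proof.
move=> sa; elim/monomial_span_ind: a / sa => [s|d a b sa IHa sb IHb].
- under eq_fun do rewrite ev_monomial.
  by case: eqP => _; [exact: smooth_on_right_inv|exact: smooth_fun_cst].
- under eq_fun do rewrite ev_linear.
  apply: (@smooth_funD _ _ (fun p : L => d * ev w p a) (fun p : L => ev w p b)) => //.
  by apply: (@smooth_funM _ _ (fun=> d)) => //; exact: smooth_fun_cst.
Qed.

Lemma left_inv_ev x k (w : diff_form L k) a (p : L) : monomial_span iE a ->
  left_inv x (fun p : L => ev w p a) p = ev (rho k (iU x) w) p a.
Proof.
have [_ rho0 rhoW rhoD] := rho_lie.
move=> sa; elim/monomial_span_ind: a / sa => [s|d a b sa IHa sb IHb].
- rewrite ev_monomial.
  rewrite (_ : (fun p => _) = fun p => if k == size s then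
      on_right_inv w (fun i => nth 0 s i) p else 0); last first.
    by apply/funext => q; rewrite ev_monomial.
  case: eqP => _; last exact: (tangent_cst mG).
  apply/esym; apply: (@left_inv_right_inv _ _ x (fun k => rho k (iU x))).
  + exact: rho0.
  + by move=> *; exact: rhoW.
  + by move=> *; exact: rhoD.
- rewrite ev_linear -IHa -IHb.
  rewrite (_ : (fun p => _) = fun p => d * ev w p a + ev w p b); last first.
    by apply/funext => q; rewrite ev_linear.
  rewrite left_invD ?left_invZ //; try exact: smooth_ev.
  by apply: smooth_funM; [exact: smooth_fun_cst|exact: smooth_ev].
Qed.

Fixpoint left_invs (xs : seq gg) (f : L -> R) : L -> R :=
  if xs is x :: xs' then left_inv x (left_invs xs' f) else f.

Lemma rho1 k (w : diff_form L k) : rho k 1 w = w.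
Proof. by have [/(_ k) [_ + _] _ _ _] := rho_lie; apply. Qed.

Lemma rhoM k u v (w : diff_form L k) : rho k (u * v) w = rho k u (rho k v w).
Proof. by have [/(_ k) [_ _ +] _ _ _] := rho_lie; apply. Qed.

Lemma rho_linear k c u v (w : diff_form L k) :
  rho k (c *: u + v) w = c *: rho k u w + rho k v w.
Proof. by have [/(_ k) [+ _ _] _ _ _] := rho_lie; apply. Qed.

Lemma left_invs_ev xs k (w : diff_form L k) a : monomial_span iE a ->
  left_invs xs (fun p : L => ev w p a) = fun p => ev (rho k (monomial iU xs) w) p a.
Proof.
move=> sa; elim: xs => [|x xs IH] /=.
  by apply/funext => p; rewrite /monomial big_nil rho1.
by apply/funext => p; rewrite IH left_inv_ev // /monomial big_cons rhoM.
Qed.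

Lemma brM u v a : br (u * v) a = br u (br v a).
Proof. by have [[_ _ +] _ _] := br_extends; apply. Qed.

Lemma br1 a : br 1 a = a.
Proof. by have [[_ + _] _ _] := br_extends; apply. Qed.

Lemma br_linear c u v a : br (c *: u + v) a = c *: br u a + br v a.
Proof. by have [[+ _ _] _ _] := br_extends; apply. Qed.

Lemma br_gen1 x : br (iU x) 1 = 0.
Proof.
have [_ /(_ x 1 1) + _] := br_extends.
by rewrite !mulr1 mul1r => /eqP; rewrite -subr_eq0 opprD addrA subrr sub0r oppr_eq0 => /eqP.
Qed.

Lemma br_monomial_cons x y s : br (iU x) (monomial iE (y :: s)) =
  iE (bracket x y) * monomial iE s + iE y * br (iU x) (monomial iE s).
Proof.
have [_ brd brg] := br_extends.
by rewrite /monomial big_cons brd brg.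
Qed.

Lemma br_gen_span x a : monomial_span iE a -> monomial_span iE (br (iU x) a).
Proof.
move=> sa; elim/monomial_span_ind: a / sa => [s|d a b sa IHa sb IHb].
- elim: s => [|y s IH].
    by rewrite /monomial big_nil br_gen1; exact: monomial_span0.
  rewrite br_monomial_cons; apply: monomial_spanD; apply: monomial_spanM => //.
  + exact: monomial_span_gen.
  + exact: monomial_spanP.
  + exact: monomial_span_gen.
- by rewrite linearP; apply: monomial_spanD => //; exact: monomial_spanZ.
Qed.

Lemma br_span u a : monomial_span iE a -> monomial_span iE (br u a).
Proof.
move=> sa; elim/monomial_span_ind: u / (enveloping_span U_enveloping u)
  => [s|d u v _ IHu _ IHv].
- elim: s => [|x s IH]; first by rewrite /monomial big_nil br1.
  by rewrite /monomial big_cons brM; exact: br_gen_span.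
- by rewrite br_linear; apply: monomial_spanD => //; exact: monomial_spanZ.
Qed.

Lemma AdE_monomial g s : AdE g (monomial iE s) = monomial iE (map (Ad g) s).
Proof.
rewrite /monomial big_map rmorph_prod; apply: eq_bigr => y _; exact: AdE_extends.
Qed.

Lemma AdE_span g a : monomial_span iE a -> monomial_span iE (AdE g a).
Proof.
move=> sa; elim/monomial_span_ind: a / sa => [s|d a b sa IHa sb IHb].
- by rewrite AdE_monomial; exact: monomial_spanP.
- by rewrite linearP; apply: monomial_spanD => //; exact: monomial_spanZ.
Qed.

(* Expanding in finitely many fixed monomials gives a meaning to the derivative
   of an [E]-valued function without a topology on [E]. *)
Definition left_derivative x (c c' : L -> E) :=
  exists (I : finType) (m : I -> L -> R) (s : I -> seq gg),
    [/\ forall i, smooth_fun (m i),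
        forall g, c g = \sum_i m i g *: monomial iE (s i)
      & forall g, c' g = \sum_i left_inv x (m i) g *: monomial iE (s i)].

Lemma left_derivative_cst x s :
  left_derivative x (fun=> monomial iE s) (fun=> 0).
Proof.
exists unit, (fun=> fun=> 1), (fun=> s); split=> [_|g|g].
- exact: smooth_fun_cst.
- by rewrite (big_pred1 tt) => [|[]//]; rewrite scale1r.
- rewrite (big_pred1 tt) => [|[]//].
  by rewrite /left_inv (tangent_cst mG) scale0r.
Qed.

Lemma left_derivativeM x c c' d d' :
  left_derivative x c c' -> left_derivative x d d' ->
  left_derivative x (fun g => c g * d g) (fun g => c' g * d g + c g * d' g).
Proof.
move=> [I [m [s [sm cE cE']]]] [J [m' [s' [sm' dE dE']]]].
have mm i j : smooth_fun (fun g => m i g * m' j g) by exact: smooth_funM.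
exists (I * J)%type, (fun ij g => m ij.1 g * m' ij.2 g), (fun ij => s ij.1 ++ s' ij.2).
have mon i j : monomial iE (s i ++ s' j) = monomial iE (s i) * monomial iE (s' j).
  by rewrite /monomial big_cat.
have prodE (u v : E) (a b : R) i j : u = a *: monomial iE (s i) ->
    v = b *: monomial iE (s' j) -> u * v = (a * b) *: monomial iE (s i ++ s' j).
  by move=> -> ->; rewrite mon -scalerAl -scalerAr scalerA.
have distr (a : I -> R) (b : J -> R) :
    (\sum_i a i *: monomial iE (s i)) * (\sum_j b j *: monomial iE (s' j)) =
    \sum_(ij : I * J) (a ij.1 * b ij.2) *: monomial iE (s ij.1 ++ s' ij.2).
  rewrite big_distrlr pair_bigA /=; apply: eq_bigr => -[i j] _ /=.
  exact: prodE.
split=> [[i j]//|g|g]; first by rewrite cE dE distr.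
rewrite cE' dE cE dE' !distr -big_split /=.
apply: eq_bigr => -[i j] _ /=; rewrite left_invM // -scalerDl; congr (_ *: _).
by rewrite addrC; congr (_ + _); exact: mulrC.
Qed.

Lemma left_derivativeD x a c c' d d' :
  left_derivative x c c' -> left_derivative x d d' ->
  left_derivative x (fun g => a *: c g + d g) (fun g => a *: c' g + d' g).
Proof.
move=> [I [m [s [sm cE cE']]]] [J [m' [s' [sm' dE dE']]]].
have sam i : smooth_fun (fun g => a * m i g).
  by apply: smooth_funM => //; exact: smooth_fun_cst.
exists (I + J)%type,
  (fun ij => match ij with inl i => fun g => a * m i g | inr j => m' j end),
  (fun ij => match ij with inl i => s i | inr j => s' j end).
split=> [[]//|g|g]; rewrite big_sumType /=.
  by rewrite cE dE scaler_sumr; congr (_ + _); apply: eq_bigr => i _; rewrite scalerA.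
rewrite cE' dE' scaler_sumr; congr (_ + _); apply: eq_bigr => i _.
by rewrite left_invZ // scalerA.
Qed.

Lemma left_derivative_ext x c1 c1' c2 c2' : c1 =1 c2 -> c1' =1 c2' ->
  left_derivative x c1 c1' -> left_derivative x c2 c2'.
Proof. by move=> /funext -> /funext ->. Qed.

(** A frame at 1 expands [Ad g y] into fixed vectors with coefficients [val (Ad g y) (gam l)], whose
    left derivatives are given by [left_inv_Ad]. *)
Lemma left_derivative_Ad x y :
  left_derivative x (fun g => iE (Ad g y)) (fun g => iE (Ad g (bracket x y))).
Proof.
have [c ac c1] := some_chart mG (1%g : L).
have [chi [gam [F [[_ sg] _ FE F1 _]]]] := local_frame mG ac c1.
have chi1 : chi (1%g : L) = 1 by have [_ ->] := nbhs_singleton F1.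
have expand (z : gg) : z = \sum_l val z (gam l) *: F l (1%g : L).
  by rewrite -FE chi1 scale1r.
have iE_expand (z : gg) : iE z = \sum_l val z (gam l) *: monomial iE [:: F l (1%g : L)].
  rewrite {1}(expand z) linear_sum; apply: eq_bigr => l _.
  by rewrite linearZ /monomial big_seq1.
exists _, (fun l (g : L) => val (Ad g y) (gam l)), (fun l => [:: F l (1%g : L)]).
split=> [l|g|g]; first exact: smooth_Ad_val.
  exact: iE_expand.
by rewrite iE_expand; apply: eq_bigr => l _; rewrite left_inv_Ad.
Qed.

(** On words the product rule matches on both sides: [AdE g] is multiplicative and [br (iU x)] is a
    derivation. *)
Lemma left_derivative_AdE x a : monomial_span iE a ->
  left_derivative x (fun g => AdE g a) (fun g => AdE g (br (iU x) a)).
Proof.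
move=> sa; elim/monomial_span_ind: a / sa => [s|d a b _ IHa _ IHb].
- elim: s => [|y s IH].
    apply: left_derivative_ext (left_derivative_cst x [::]) => g.
      by rewrite /monomial big_nil rmorph1.
    by rewrite /monomial big_nil br_gen1 linear0.
  apply: left_derivative_ext (left_derivativeM (left_derivative_Ad x y) IH) => g.
    by rewrite /monomial big_cons rmorphM /= AdE_extends.
  by rewrite br_monomial_cons linearD !rmorphM /= !AdE_extends.
- apply: left_derivative_ext (left_derivativeD d IHa IHb) => g; by rewrite !linearP.
Qed.

Lemma smooth_ev_derivative x c c' k (w : diff_form L k) (q : L) :
  left_derivative x c c' -> smooth_fun (fun g : L => ev w (g * q)%g (c g)).
Proof.
move=> [I [m [s [sm cE _]]]].
rewrite (_ : (fun g => _) = fun g : L => \sum_i m i g * ev w (g * q)%g (monomial iE (s i))).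
  apply: smooth_fun_sum => i _; apply: smooth_funM => //.
  apply: (@smooth_mulr _ _ q (fun g : L => ev w g (monomial iE (s i)))).
  exact/smooth_ev/monomial_spanP.
by apply/funext => g; rewrite cE linear_sum; apply: eq_bigr => i _; rewrite linearZ.
Qed.

(** Product rule for the two occurrences of [g]: the base point contributes through
    [left_inv_translate], the multivector through [c']. *)
Lemma left_inv_ev_derivative x c c' k (w : diff_form L k) (p q : L) :
  left_derivative x c c' ->
  left_inv x (fun g : L => ev w (g * q)%g (c g)) p =
  ev (rho k (iU (Ad q^-1%g x)) w) (p * q)%g (c p) + ev w (p * q)%g (c' p).
Proof.
move=> [I [m [s [sm cE cE']]]].
have se i : smooth_fun (fun g : L => ev w g (monomial iE (s i))).
  exact/smooth_ev/monomial_spanP.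
have seq i : smooth_fun (fun g : L => ev w (g * q)%g (monomial iE (s i))).
  exact: (@smooth_mulr _ _ q (fun g : L => ev w g (monomial iE (s i)))).
rewrite (_ : (fun g => _) = fun g : L => \sum_i m i g * ev w (g * q)%g (monomial iE (s i)));
  last by apply/funext => g; rewrite cE linear_sum; apply: eq_bigr => i _; rewrite linearZ.
rewrite left_inv_sum => [|i]; last exact: smooth_funM.
rewrite cE cE' !linear_sum -big_split /=; apply: eq_bigr => i _.
rewrite left_invM // !linearZ /=; congr (_ * _ + _); last exact: mulrC.
rewrite (@left_inv_translate _ _ x q (fun g : L => ev w g (monomial iE (s i)))) //.
by rewrite left_inv_ev //; exact: monomial_spanP.
Qed.

Variables (p q : L) (s : seq gg).

Let value k (w : diff_form L k) b (g : L) : R :=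
  ev w (g * q)%g (monomial iE s * AdE g b).

Let value_span g b : monomial_span iE b -> monomial_span iE (monomial iE s * AdE g b).
Proof. by move=> sb; apply: monomial_spanM; [exact: monomial_spanP|exact: AdE_span]. Qed.

Let value_derivative x b : monomial_span iE b ->
  left_derivative x (fun g => monomial iE s * AdE g b)
    (fun g => monomial iE s * AdE g (br (iU x) b)).
Proof.
move=> sb; apply: left_derivative_ext
  (left_derivativeM (left_derivative_cst x s) (left_derivative_AdE x sb)) => // g.
by rewrite mul0r add0r.
Qed.

(** Each further derivative splits every term in two, as [iU x] is primitive for [Delta], and
    multiplicativity of [Delta] collects the terms. Bilinearity of [B] permits replacing the chosen
    representatives of coproducts. *)
Lemma left_invs_convolution xs k (w : diff_form L k) b (g : L) : monomial_span iE b ->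
  left_invs xs (value w b) g =
  \sum_(t <- Delta (monomial iU xs)) value (rho k (AdU q^-1%g t.1) w) (br t.2 b) g.
Proof.
have [_ D1 DM Dx] := Delta_coproduct.
move=> sb; pose B g (u v : U) := value (rho k (AdU q^-1%g u) w) (br v b) g.
have Bl g' z a u v : B g' (a *: u + v) z = a * B g' u z + B g' v z.
  rewrite /B /value linearP rho_linear ev_form_linear //.
  by apply: value_span; exact: br_span.
have Br g' z a u v : B g' z (a *: u + v) = a * B g' z u + B g' z v.
  by rewrite /B /value br_linear linearP mulrDr -scalerAr ev_linear.
elim: xs g => [|x xs IH] g /=.
  rewrite /monomial big_nil (tensor_eq_sum (Bl g) (Br g) D1) big_seq1.
  by rewrite /B rmorph1 rho1 br1.
rewrite (_ : left_invs xs _ = fun g => \sum_(t <- Delta (monomial iU xs)) B g t.1 t.2);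
  last by apply/funext => h; exact: IH.
have sB t : smooth_fun (fun g => B g t.1 t.2).
  (* Smoothness only asks for some finite expansion of the multivector, so any direction does; 0 is
     taken. *)
  exact: (smooth_ev_derivative _ _ (value_derivative 0 (br_span t.2 sb))).
rewrite left_inv_sum //.
have -> : monomial iU (x :: xs) = iU x * monomial iU xs by rewrite /monomial big_cons.
rewrite (tensor_eq_sum (Bl g) (Br g) (DM _ _)) big_allpairs_dep /=.
(* The coproduct of the tail is frozen, so that the coproduct of the generator can be replaced by
   its two terms. *)
pose B' (u v : U) := \sum_(t <- Delta (monomial iU xs)) B g (u * t.1) (v * t.2).
have -> : \sum_(i <- Delta (iU x)) \sum_(j <- Delta (monomial iU xs))
    B g (i.1 * j.1) (i.2 * j.2) = \sum_(i <- Delta (iU x)) B' i.1 i.2 by [].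
rewrite (@tensor_eq_sum _ _ _ _ B' _ _ (Dx x)); last 2 first.
- move=> z a u v; rewrite /B' mulr_sumr -big_split; apply: eq_bigr => t _.
  by rewrite mulrDl -scalerAl Bl.
- move=> z a u v; rewrite /B' mulr_sumr -big_split; apply: eq_bigr => t _.
  by rewrite mulrDl -scalerAl Br.
rewrite big_cons big_seq1 /B' -big_split /=; apply: eq_bigr => t _.
rewrite (left_inv_ev_derivative _ _ _ (value_derivative x (br_span t.2 sb))).
rewrite !mul1r /B /value; congr (_ + _).
  by rewrite rmorphM /= AdU_extends rhoM.
by rewrite brM.
Qed.

End RightInvariantEvaluation.

(** * Exterior products of forms on two factors *)

Section BlockPermutations.
Variables (k j : nat).

Definition block_fun (s : 'S_k * 'S_j) (x : 'I_(k + j)) : 'I_(k + j) :=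
  match fintype.split x with
  | inl i => lshift j (s.1 i)
  | inr i => rshift k (s.2 i)
  end.

Lemma block_fun_lshift s i : block_fun s (lshift j i) = lshift j (s.1 i).
Proof. by rewrite /block_fun -[lshift j i]/(unsplit (inl i)) unsplitK. Qed.

Lemma block_fun_rshift s i : block_fun s (rshift k i) = rshift k (s.2 i).
Proof. by rewrite /block_fun -[rshift k i]/(unsplit (inr i)) unsplitK. Qed.

Lemma block_fun_inj s : injective (block_fun s).
Proof.
move=> x y; case: (split_ordP x) => i ->; case: (split_ordP y) => i' ->;
  rewrite ?block_fun_lshift ?block_fun_rshift => /eqP.
- by rewrite eq_lshift (inj_eq perm_inj) => /eqP ->.
- by rewrite eq_lrshift.
- by rewrite eq_rlshift.
- by rewrite eq_rshift (inj_eq perm_inj) => /eqP ->.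
Qed.

Definition block_perm s : 'S_(k + j) := perm (@block_fun_inj s).

Lemma block_perm_inj : injective block_perm.
Proof.
move=> [s1 s2] [t1 t2] /permP st; congr pair; apply/permP => i.
  by have := st (lshift j i); rewrite !permE !block_fun_lshift => /lshift_inj.
by have := st (rshift k i); rewrite !permE !block_fun_rshift => /rshift_inj.
Qed.

(* Compare determinants: the permutation matrix is block diagonal. *)
Lemma sign_block_perm (R : comPzRingType) s :
  (-1) ^+ block_perm s = (-1) ^+ s.1 * (-1) ^+ s.2 :> R.
Proof.
rewrite -!det_perm -(det_lblock _ 0); congr (\det _).
apply/matrixP => x y.
case: (split_ordP x) => i ->; case: (split_ordP y) => i' ->;
  rewrite ?block_mxEul ?block_mxEur ?block_mxEdl ?block_mxEdr !mxE permE
    ?block_fun_lshift ?block_fun_rshift.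
- by rewrite eq_lshift.
- by rewrite eq_lrshift.
- by rewrite eq_rlshift.
- by rewrite eq_rshift.
Qed.

Lemma block_permP (t : 'S_(k + j)) :
  (forall i, (t (lshift j i) < k)%N) -> (forall i, (k <= t (rshift k i))%N) ->
  exists s, t = block_perm s.
Proof.
move=> tl tr.
have tl' i : exists i', t (lshift j i) = lshift j i'.
  by exists (Ordinal (tl i)); apply: val_inj.
have tr' i : exists i', t (rshift k i) = rshift k i'.
  case: (split_ordP (t (rshift k i))) (tr i) => i' -> /=.
    by rewrite leqNgt ltn_ord.
  by exists i'.
have /choice[f fE] := tl'; have /choice[g gE] := tr'.
have fi : injective f.
  by move=> x y xy; apply: (@lshift_inj k j); apply: (@perm_inj _ t); rewrite !fE xy.
have gi : injective g.
  by move=> x y xy; apply: (@rshift_inj k j); apply: (@perm_inj _ t); rewrite !gE xy.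
exists (perm fi, perm gi); apply/permP => x; rewrite permE.
by case: (split_ordP x) => i ->; rewrite ?block_fun_lshift ?block_fun_rshift /= permE.
Qed.

End BlockPermutations.

Section WedgeBlocks.
Variables (R : realType) (V : lmodType R).

(** A permutation contributes only if it sends the first block below [m] and the second to [m] or
    above; counting both blocks forces [k = m], and the permutation preserves the blocks. These all
    contribute equally, and their number cancels the normalisation. *)
Lemma wedge_block k j m (f : ('I_k -> V) -> R) (g : ('I_j -> V) -> R)
    (v : 'I_(k + j) -> V) : (m <= k + j)%N ->
  is_alternating f -> is_alternating g ->
  (forall u : 'I_k -> 'I_(k + j), (exists i, (m <= u i)%N) -> f (v \o u) = 0) ->
  (forall u : 'I_j -> 'I_(k + j), (exists i, (u i < m)%N) -> g (v \o u) = 0) ->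
  wedge_alt f g v =
  if k == m then f (v \o lshift j) * g (v \o @rshift k j) else 0.
Proof.
move=> mkj fa ga f0 g0.
pose F (t : 'S_(k + j)) := (-1) ^+ t * f (fun i => v (t (lshift j i))) *
  g (fun i => v (t (rshift k i))).
have F0 (t : 'S_(k + j)) :
    ~ ((forall i, (t (lshift j i) < m)%N) /\ (forall i, (m <= t (rshift k i))%N)) ->
    F t = 0.
  move=> nt; have [|/forallNP fn] := pselect (exists i, (m <= t (lshift j i))%N).
    by move=> /(f0 (fun i => t (lshift j i))) E; rewrite /F (E : f _ = 0) mulr0 mul0r.
  have [|/forallNP gn] := pselect (exists i, (t (rshift k i) < m)%N).
    by move=> /(g0 (fun i => t (rshift k i))) E; rewrite /F (E : g _ = 0) mulr0.
  case: nt; split=> i; first by rewrite ltnNge; apply/negP; exact: fn.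
  by rewrite leqNgt; apply/negP; exact: gn.
rewrite /wedge_alt -/(F _); case: eqP => [km|km]; last first.
  rewrite big1 ?mulr0 // => t _; apply: F0 => -[tl tr]; apply: km.
  apply/eqP; rewrite eqn_leq; apply/andP; split.
    have hi : injective (fun i => Ordinal (tl i)).
      by move=> x y /(congr1 val)/= /val_inj/perm_inj/lshift_inj.
    by have := leq_card _ hi; rewrite !card_ord.
  have tr' i : (t (rshift k i) - m < k + j - m)%N.
    by rewrite ltn_sub2r // (leq_ltn_trans (tr i)).
  have hi : injective (fun i => Ordinal (tr' i)).
    move=> x y /(congr1 val)/= /eqP; rewrite eqn_sub2rE //.
    by move=> /eqP/val_inj/perm_inj/rshift_inj.
  have := leq_card _ hi; rewrite !card_ord leq_subRL //.
  by rewrite leq_add2r.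
subst m.
pose B : {set 'S_(k + j)} := (@block_perm k j @: [set: 'S_k * 'S_j])%SET.
rewrite (bigID (mem B)) /=.
rewrite [X in _ + X]big1 => [|t nt]; last first.
  apply: F0 => -[tl tr]; have [s tE] := block_permP tl tr.
  by move/negP: nt; apply; apply/imsetP; exists s.
rewrite addr0 big_imset /= => [|s s' _ _]; last exact: block_perm_inj.
rewrite (eq_bigr (fun=> f (v \o lshift j) * g (v \o @rshift k j))) => [|s _]; last first.
  rewrite /F sign_block_perm.
  rewrite (_ : (fun i => v (block_perm s (lshift j i))) = (v \o lshift j) \o s.1);
    last by apply/funext => i; rewrite /= permE block_fun_lshift.
  rewrite (_ : (fun i => v (block_perm s (rshift k i))) = (v \o @rshift k j) \o s.2);
    last by apply/funext => i; rewrite /= permE block_fun_rshift.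
  rewrite !alternating_perm //.
  have cancel (a b x y : R) : a * a = 1 -> b * b = 1 -> a * b * (a * x) * (b * y) = x * y.
    move=> aa bb; have -> : a * b * (a * x) * (b * y) = (a * a) * (b * b) * (x * y) by ring.
    by rewrite aa bb !mul1r.
  by apply: cancel; rewrite -expr2 sqrr_sign.
rewrite sumr_const.
rewrite cardsT card_prod !card_Sn -[_ *+ (_ * _)]mulr_natl natrM mulKf //.
Qed.

End WedgeBlocks.

(** * Invariant fields on the product of the group with itself *)

Section ProductFields.
Variables (R : realType) (G : lieGroup R).
Notation L := (lie_space G).
Notation gg := (lie_algebra G).
Notation LL := (prod_space L L).
Let mG := lie_smooth_manifold G.
Let mGG := prod_manifold mG mG.

Section ActionField.
Variables (M : chartedSpace R) (mu : prod_space M L -> M).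
Hypotheses (mM : smooth_manifold M) (smu : smap mu).
Hypothesis mu1 : forall z, mu (z, 1%g) = z.

Definition action_field (x : gg) (z : M) : tangent z :=
  Defs.pushforward (fun h : L => mu (z, h)) z x.

Lemma action_fieldE x z f : smooth_fun f ->
  val (action_field x z) f = val x (fun h : L => f (mu (z, h))).
Proof.
move=> sf; rewrite pushforwardE //.
exact: (smap_comp (smap_pair mM mG (smap_cst L z) (smap_id L)) smu).
Qed.

Lemma smooth_action_field x : smooth_field (action_field x).
Proof.
move=> f sf; under eq_fun do rewrite action_fieldE //.
apply: (@smooth_partial_snd _ _ _ (f \o mu)) => //.
by have [_] := smu; apply.
Qed.

End ActionField.

(** The names refer to invariance: multiplying on the right by the group variable generates the
    left-invariant fields of a factor, and multiplying on the left the right-invariant ones. *)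
Definition left1 (u : prod_space LL L) : LL := ((u.1.1 * u.2)%g, u.1.2).
Definition left2 (u : prod_space LL L) : LL := (u.1.1, (u.1.2 * u.2)%g).
Definition right1 (u : prod_space LL L) : LL := ((u.2 * u.1.1)%g, u.1.2).
Definition right2 (u : prod_space LL L) : LL := (u.1.1, (u.2 * u.1.2)%g).

Let s11 := smap_comp (smap_fst LL L) (smap_fst L L).
Let s12 := smap_comp (smap_fst LL L) (smap_snd L L).
Let s2 := smap_snd LL L.

Lemma smap_left1 : smap left1.
Proof. exact: (smap_pair mG mG (smap_mul s11 s2) s12). Qed.

Lemma smap_left2 : smap left2.
Proof. exact: (smap_pair mG mG s11 (smap_mul s12 s2)). Qed.

Lemma smap_right1 : smap right1.
Proof. exact: (smap_pair mG mG (smap_mul s2 s11) s12). Qed.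

Lemma smap_right2 : smap right2.
Proof. exact: (smap_pair mG mG s11 (smap_mul s2 s12)). Qed.

Lemma left1_1 z : left1 (z, 1%g) = z.
Proof. by case: z => g h; rewrite /left1 /= mulg1. Qed.

Lemma left2_1 z : left2 (z, 1%g) = z.
Proof. by case: z => g h; rewrite /left2 /= mulg1. Qed.

Lemma right1_1 z : right1 (z, 1%g) = z.
Proof. by case: z => g h; rewrite /right1 /= mul1g. Qed.

Lemma right2_1 z : right2 (z, 1%g) = z.
Proof. by case: z => g h; rewrite /right2 /= mul1g. Qed.

Definition left_fields (xs ys : seq gg) : seq (forall z : LL, tangent z) :=
  [seq action_field left1 x | x <- xs] ++ [seq action_field left2 y | y <- ys].

Definition right_field (s t : seq gg) (i : nat) : forall z : LL, tangent z :=
  if (i < size s)%N then action_field right1 (nth 0 s i)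
  else action_field right2 (nth 0 t (i - size s)).

Lemma smooth_left_fields xs ys : smooth_fields (left_fields xs ys).
Proof.
elim: xs => [|x xs IH] /=; last first.
  by split=> //; exact: (smooth_action_field mGG smap_left1 left1_1).
elim: ys => [|y ys IH] //=.
by split=> //; exact: (smooth_action_field mGG smap_left2 left2_1).
Qed.

Lemma smooth_right_field s t i : smooth_field (right_field s t i).
Proof.
rewrite /right_field; case: ifP => _.
  exact: (smooth_action_field mGG smap_right1 right1_1).
exact: (smooth_action_field mGG smap_right2 right2_1).
Qed.

Lemma apply_left_fields xs ys (f : LL -> R) (p q : L) : smooth_fun f ->
  apply_fields (left_fields xs ys) f (p, q) =
  left_invs xs (fun g => left_invs ys (fun h => f (g, h)) q) p.
Proof.
move=> sf; have E2 : apply_fields [seq action_field left2 y | y <- ys] f =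
    fun z => left_invs ys (fun h => f (z.1, h)) z.2.
  elim: ys => [|y ys IH] /=; first by apply/funext => -[].
  have sf' : smooth_fun (apply_fields [seq action_field left2 y | y <- ys] f).
    apply: smooth_apply_fields => //.
    by have := smooth_left_fields [::] ys.
  by apply/funext => z; rewrite (action_fieldE mGG smap_left2 left2_1) // IH.
elim: xs p => [|x xs IH] p /=; first by rewrite E2.
rewrite (action_fieldE mGG smap_left1 left1_1); last first.
  by apply: smooth_apply_fields => //; exact: smooth_left_fields.
by apply: (congr1 (val x)); apply/funext => h; rewrite /left1 /= IH.
Qed.

Lemma left_invs_translate xs (f : L -> R) (g h : L) :
  left_invs xs (fun h => f (g * h)%g) h = left_invs xs f (g * h)%g.
Proof.
elim: xs h => [//|x xs IH] h /=; rewrite /left_inv.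
by apply: (congr1 (val x)); apply/funext => t; rewrite IH mulgA.
Qed.

Let mul (z : LL) : L := (z.1 * z.2)%g.

Let smul : smap mul.
Proof. exact: (smap_mul (smap_fst L L) (smap_snd L L)). Qed.

(** A right-invariant field of the second factor is carried over by [g (h k) = (g h g^-1) (g k)],
    which produces the adjoint action of the first component. *)
Lemma mul_right_field s t i (z : LL) : (i < size s + size t)%N ->
  Defs.pushforward mul (mul z) (right_field s t i z) =
  right_inv (nth 0 (s ++ map (Ad z.1) t) i) (mul z).
Proof.
move=> ist; apply: tangent_ext => f sf.
have sfm : smooth_fun (f \o mul) by have [_] := smul; apply.
rewrite pushforwardE // right_invE // nth_cat /right_field; case: ltnP => ics.
  rewrite (action_fieldE mGG smap_right1 right1_1) //.
  by rewrite /mul /=; apply: (congr1 (val (nth 0 s i))); apply/funext => h; rewrite mulgA.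
rewrite (action_fieldE mGG smap_right2 right2_1) // (nth_map 0) ?ltn_subLR //.
rewrite Ad_val; last exact: smooth_mulr.
rewrite /mul /=; apply: (congr1 (val (nth 0 t (i - size s)))); apply/funext => h.
by rewrite !mulgA mulgVK.
Qed.

Lemma fst_right_field s t i (z : LL) :
  Defs.pushforward (fst : LL -> L) z.1 (right_field s t i z) =
  if (i < size s)%N then right_inv (nth 0 s i) z.1 else 0.
Proof.
have sF := smap_fst L L.
apply: tangent_ext => f sf; rewrite pushforwardE //.
have sfm : smooth_fun (f \o (fst : LL -> L)) by have [_] := sF; apply.
rewrite /right_field; case: ifP => _.
  rewrite (action_fieldE mGG smap_right1 right1_1) // right_invE //.
rewrite (action_fieldE mGG smap_right2 right2_1) //.
exact: (tangent_cst mG (nth 0 t (i - size s)) (f z.1)).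
Qed.

Lemma snd_right_field s t i (z : LL) :
  Defs.pushforward (snd : LL -> L) z.2 (right_field s t i z) =
  if (i < size s)%N then 0 else right_inv (nth 0 t (i - size s)) z.2.
Proof.
have sF := smap_snd L L.
apply: tangent_ext => f sf; rewrite pushforwardE //.
have sfm : smooth_fun (f \o (snd : LL -> L)) by have [_] := sF; apply.
rewrite /right_field; case: ifP => _.
  rewrite (action_fieldE mGG smap_right1 right1_1) //.
  exact: (tangent_cst mG (nth 0 s i) (f z.2)).
by rewrite (action_fieldE mGG smap_right2 right2_1) // right_invE.
Qed.

Definition tensor_current xs ys s t (p q : L) : current LL :=
  field_current (left_fields xs ys) (right_field s t) (size s + size t) (p, q).

Lemma tensor_current_is_current xs ys s t p q :
  is_current (tensor_current xs ys s t p q).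
Proof.
apply: field_current_is_current => //; first exact: smooth_left_fields.
by move=> i; exact: smooth_right_field.
Qed.

(** The degree test is moved inside the differentiated function [H], because [ev] itself vanishes
    off its degree. *)
Lemma tensor_currentE xs ys s t p q n (Om : diff_form LL n) (H : LL -> R) :
  (forall z, H z = if n == (size s + size t)%N then
     Om z (fun i => right_field s t i z) else 0) ->
  tensor_current xs ys s t p q Om =
  left_invs xs (fun g => left_invs ys (fun h => H (g, h)) q) p.
Proof.
move=> HE; have -> : H = fun z => if n == (size s + size t)%N then
  Om z (fun i => right_field s t i z) else 0 by exact/funext.
rewrite /tensor_current /field_current; case: ifP => _.
  rewrite apply_left_fields //.
  apply: (form_fields_smooth mGG Om (X := fun (i : 'I_n) z => right_field s t i z)) => i.
  exact: smooth_right_field.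
have zero zs : left_invs zs (fun=> 0) = (fun=> 0) :> (L -> R).
  elim: zs => [//|x zs IH] /=; rewrite IH; apply/funext => g.
  exact: (tangent_cst mG).
by rewrite zero zero.
Qed.

End ProductFields.

(** * Convolution *)

Section CurrentCombinations.
Variables (R : realType) (M : chartedSpace R).

(** The shape [c *: a + b] of the inductive clause in [monomial_span_ind], transported to
    currents. *)
Definition current_comb c (A B : current M) : current M :=
  fun k w => c * A k w + B k w.

Lemma is_current_comb c (A B : current M) :
  is_current A -> is_current B -> is_current (current_comb c A B).
Proof.
move=> cA cB k; have [lA [r [m [ch [K [C [chK AC]]]]]]] := cA k.
have [lB [r' [m' [ch' [K' [C' [chK' BC]]]]]]] := cB k.
split=> [a w z|]; first by rewrite /current_comb lA lB; ring.
exists (r + r')%N, (maxn m m').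
exists (fun i => match fintype.split i with inl i => ch i | inr i => ch' i end).
exists (fun i => match fintype.split i with inl i => K i | inr i => K' i end).
exists (`|c| * C + C'); split=> [i|w b b0 wb].
  by case: (fintype.split i).
rewrite /current_comb (le_trans (ler_normD _ _)) // mulrDl lerD //.
  rewrite normrM -mulrA ler_wpM2l // AC // => i y e s Ky sm.
  have := wb (lshift r' i) y e s; rewrite -[lshift r' i]/(unsplit (inl i)) unsplitK.
  by apply => //; rewrite leq_max sm.
apply: BC => // i y e s Ky sm.
have := wb (rshift r i) y e s; rewrite -[rshift r i]/(unsplit (inr i)) unsplitK.
by apply => //; rewrite leq_max sm orbT.
Qed.

End CurrentCombinations.

Section Convolution.
Variables (R : realType) (G : lieGroup R).
Notation L := (lie_space G).
Notation LL := (prod_space L L).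

Lemma is_tensor_combl (M N : chartedSpace R) c (A A' : current M) (B : current N) T T' :
  is_tensor A B T -> is_tensor A' B T' ->
  is_tensor (current_comb c A A') B (current_comb c T T').
Proof.
move=> [cT tT] [cT' tT']; split; first exact: is_current_comb.
by move=> k j w z; rewrite /current_comb tT tT'; ring.
Qed.

Lemma is_tensor_combr (M N : chartedSpace R) c (A : current M) (B B' : current N) T T' :
  is_tensor A B T -> is_tensor A B' T' ->
  is_tensor A (current_comb c B B') (current_comb c T T').
Proof.
move=> [cT tT] [cT' tT']; split; first exact: is_current_comb.
by move=> k j w z; rewrite /current_comb tT tT'; ring.
Qed.

Lemma is_convolution_combl c (A A' B C C' : current L) :
  is_convolution A B C -> is_convolution A' B C' ->
  is_convolution (current_comb c A A') B (current_comb c C C').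
Proof.
move=> [T tT CT] [T' tT' CT']; exists (current_comb c T T'); first exact: is_tensor_combl.
by move=> k w; rewrite /current_comb CT CT'.
Qed.

Lemma is_convolution_combr c (A B B' C C' : current L) :
  is_convolution A B C -> is_convolution A B' C' ->
  is_convolution A (current_comb c B B') (current_comb c C C').
Proof.
move=> [T tT CT] [T' tT' CT']; exists (current_comb c T T'); first exact: is_tensor_combr.
by move=> k w; rewrite /current_comb CT CT'.
Qed.

Lemma current_ext (M : chartedSpace R) (A B : current M) :
  (forall k w, A k w = B k w) -> A = B.
Proof.
by move=> AB; apply: functional_extensionality_dep => k; apply/funext => w.
Qed.

End Convolution.

Lemma homogeneous_monomial_span (R : realType) (G : lieGroup R) (E : algType R)
    (iE : {linear lie_algebra G -> E}) k (a : E) :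
  is_homogeneous iE k a -> monomial_span iE a.
Proof.
move=> [r ->]; exists [seq (t.1, [seq t.2 i | i <- enum 'I_k]) | t <- r].
rewrite big_map; apply: eq_bigr => t _; congr (_ *: _).
by rewrite /monomial /= big_map enumT.
Qed.

(** * Convolution of two point currents, on words and then by linearity *)

Section PointCurrentConvolution.
Variables (R : realType) (G : lieGroup R).
Notation L := (lie_space G).
Notation gg := (lie_algebra G).
Notation LL := (prod_space L L).
Let mG := lie_smooth_manifold G.
Let mGG := prod_manifold mG mG.
Variables (U : algType R) (iU : {linear gg -> U}).
Hypothesis U_enveloping : is_enveloping iU.
Variables (E : algType R) (iE : {linear gg -> E}).
Variables (Delta : U -> seq (U * U)).
Hypothesis Delta_coproduct : is_coproduct iU Delta.
Variables (AdU : G -> {lrmorphism U -> U}).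
Hypothesis AdU_extends : forall g x, AdU g (iU x) = iU (Ad g x).
Variables (AdE : G -> {lrmorphism E -> E}).
Hypothesis AdE_extends : forall g x, AdE g (iE x) = iE (Ad g x).
Variables (br : U -> {linear E -> E}).
Hypothesis br_extends : extends_bracket iU iE br.
Variables (rho : forall k, U -> {linear diff_form L k -> diff_form L k}).
Hypothesis rho_lie : is_lie_derivative iU rho.
Variables (ev : forall k, diff_form L k -> G -> {scalar E}).
Hypothesis ev_right_inv : is_right_inv_eval iE ev.
Variables (p q : L).

Notation pc := (point_current rho ev).

Definition twisted_current (v w : U) (a b : E) : current L :=
  fun n om => \sum_(t <- Delta v)
    pc (p * q)%g (AdU q^-1%g t.1 * w) (a * AdE p (br t.2 b)) om.

Lemma tensor_current_tensor xs ys s t :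
  is_tensor (pc p (monomial iU xs) (monomial iE s))
    (pc q (monomial iU ys) (monomial iE t)) (tensor_current xs ys s t p q).
Proof.
split=> [|k j w z]; first exact: tensor_current_is_current.
rewrite (@tensor_currentE _ _ _ _ _ _ _ _ _ _
  (fun u => ev w u.1 (monomial iE s) * ev z u.2 (monomial iE t))).
  rewrite /point_current.
  (* A factor that is constant in the differentiated variable is absorbed into the multivector, so
     that [left_invs_ev] applies. *)
  have inner g : left_invs ys (fun h => ev w g (monomial iE s) * ev z h (monomial iE t)) q =
      ev w g (monomial iE s) * ev (rho j (monomial iU ys) z) q (monomial iE t).
    rewrite (_ : (fun h => _) = fun h => ev z h (ev w g (monomial iE s) *: monomial iE t));
      last by apply/funext => h; rewrite linearZ.
    rewrite (left_invs_ev rho_lie ev_right_inv); last exact/monomial_spanZ/monomial_spanP.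
    by rewrite linearZ.
  rewrite (_ : (fun g => _) = fun g => ev w g
     (ev (rho j (monomial iU ys) z) q (monomial iE t) *: monomial iE s)); last first.
    by apply/funext => g; rewrite inner linearZ mulrC.
  rewrite (left_invs_ev rho_lie ev_right_inv); last exact/monomial_spanZ/monomial_spanP.
  by rewrite linearZ; exact: mulrC.
move=> u; rewrite !(ev_monomial ev_right_inv).
case: (k + j =P size s + size t)%N => [kj|kj]; last first.
  case: (k =P size s) => [ks|_]; last by rewrite mul0r.
  case: (j =P size t) => [jt|_]; last by rewrite mulr0.
  by case: kj; rewrite ks jt.
have sF := smap_fst L L; have sS := smap_snd L L.
(* The cut is at [size s]: a form pulled back from one factor vanishes as soon as one argument is a
   field of the other factor. *)
rewrite wedge_formE // (@wedge_block _ _ _ _ (size s)).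
- case: (k =P size s) => [ks|_]; last by rewrite mul0r.
  have -> : j == size t by rewrite -(eqn_add2l k) kj ks.
  rewrite !pullbackE //; congr (_ * _); rewrite /on_right_inv.
    congr (form_val w _); apply/funext => i.
    by rewrite /= fst_right_field /= -ks ltn_ord.
  congr (form_val z _); apply/funext => i.
  by rewrite /= snd_right_field /= -ks ltnNge leq_addr addKn.
- by rewrite kj leq_addr.
- exact: form_alternating.
- exact: form_alternating.
- move=> h [i si]; rewrite pullbackE //.
  apply: (alternating0 (i := i) (form_alternating w _)).
  by rewrite /= fst_right_field ltnNge si.
- move=> h [i si]; rewrite pullbackE //.
  apply: (alternating0 (i := i) (form_alternating z _)).
  by rewrite /= snd_right_field si.
Qed.

Lemma convolution_monomial xs ys s t :
  is_convolution (pc p (monomial iU xs) (monomial iE s))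
    (pc q (monomial iU ys) (monomial iE t))
    (twisted_current (monomial iU xs) (monomial iU ys) (monomial iE s) (monomial iE t)).
Proof.
exists (tensor_current xs ys s t p q); first exact: tensor_current_tensor.
move=> k w; have smul := smap_mul (smap_fst L L) (smap_snd L L).
rewrite (@tensor_currentE _ _ _ _ _ _ _ _ _ _ (fun z : LL =>
    ev w (z.1 * z.2)%g (monomial iE s * AdE z.1 (monomial iE t)))); last first.
  move=> z; have -> : monomial iE s * AdE z.1 (monomial iE t) =
      monomial iE (s ++ map (Ad z.1) t).
    by rewrite (AdE_monomial AdE_extends) /monomial big_cat.
  rewrite (ev_monomial ev_right_inv) size_cat size_map; case: eqP => // kst.
  rewrite pullbackE //; congr (form_val w _); apply/funext => i.
  by rewrite mul_right_field // -kst.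
have span_t := monomial_spanP iE t; have span_s := monomial_spanP iE s.
(* For fixed [g] the function of [h] is a left translate, with a multivector independent of [h], so
   the derivatives along [ys] become the action on the form at [g * q]. *)
rewrite (_ : (fun g => _) = fun g : L => ev (rho k (monomial iU ys) w) (g * q)%g
    (monomial iE s * AdE g (monomial iE t))); last first.
  apply/funext => g.
  rewrite (left_invs_translate ys (fun h => ev w h (monomial iE s * AdE g (monomial iE t)))).
  rewrite (left_invs_ev rho_lie ev_right_inv) //.
  by apply: monomial_spanM => //; exact: (AdE_span AdE_extends).
rewrite (left_invs_convolution U_enveloping Delta_coproduct AdU_extends AdE_extends
  br_extends rho_lie ev_right_inv) //.
by apply: eq_bigr => u _; rewrite /point_current (rhoM rho_lie).
Qed.

Lemma point_current_combU g c u v a : monomial_span iE a ->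
  pc g (c *: u + v) a = current_comb c (pc g u a) (pc g v a).
Proof.
move=> sa; apply: current_ext => k w; rewrite /point_current /current_comb.
by rewrite (rho_linear rho_lie) (ev_form_linear ev_right_inv).
Qed.

Lemma point_current_combE g v c a b :
  pc g v (c *: a + b) = current_comb c (pc g v a) (pc g v b).
Proof. by apply: current_ext => k w; rewrite /point_current ev_linear. Qed.

Let twist_span a b u : monomial_span iE a -> monomial_span iE b ->
  monomial_span iE (a * AdE p (br u b)).
Proof.
move=> sa sb; apply: monomial_spanM => //; apply: (AdE_span AdE_extends).
exact: (br_span U_enveloping br_extends).
Qed.

(** [Delta] is linear up to [tensor_eq] only, so the summand is treated as a bilinear function [B]
    of the two coproduct factors. *)
Lemma twisted_current_comb1 c u v w a b : monomial_span iE a -> monomial_span iE b ->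
  twisted_current (c *: u + v) w a b =
  current_comb c (twisted_current u w a b) (twisted_current v w a b).
Proof.
move=> sa sb; apply: current_ext => k om; rewrite /twisted_current /current_comb.
pose B (u1 u2 : U) :=
  pc (p * q)%g (AdU q^-1%g u1 * w) (a * AdE p (br u2 b)) om.
have Bl z d u1 u2 : B (d *: u1 + u2) z = d * B u1 z + B u2 z.
  rewrite /B linearP mulrDl -scalerAl point_current_combU //; exact: twist_span.
have Br z d u1 u2 : B z (d *: u1 + u2) = d * B z u1 + B z u2.
  by rewrite /B (br_linear br_extends) linearP mulrDr -scalerAr point_current_combE.
have B0 z : B 0 z = 0.
  by have := Bl z 1 0 0; rewrite scale1r addr0 mul1r => /eqP; rewrite -subr_eq0 opprD addrA
    subrr sub0r oppr_eq0 => /eqP.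
have [/(_ c u v) Dl _ _ _] := Delta_coproduct.
have := tensor_eq_sum Bl Br Dl; rewrite big_cat big_map mulr_sumr => E'.
rewrite [LHS]E'; congr (_ + _); apply: eq_bigr => t _ /=.
by have := Bl t.2 c t.1 0; rewrite addr0 B0 addr0.
Qed.

Lemma twisted_current_comb2 v c w w' a b : monomial_span iE a -> monomial_span iE b ->
  twisted_current v (c *: w + w') a b =
  current_comb c (twisted_current v w a b) (twisted_current v w' a b).
Proof.
move=> sa sb; apply: current_ext => k om; rewrite /twisted_current /current_comb.
rewrite mulr_sumr -big_split /=; apply: eq_bigr => t _.
by rewrite mulrDr -scalerAr point_current_combU //; exact: twist_span.
Qed.

Lemma twisted_current_comb3 v w c a a' b :
  twisted_current v w (c *: a + a') b =
  current_comb c (twisted_current v w a b) (twisted_current v w a' b).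
Proof.
apply: current_ext => k om; rewrite /twisted_current /current_comb.
rewrite mulr_sumr -big_split /=; apply: eq_bigr => t _.
by rewrite mulrDl -scalerAl point_current_combE.
Qed.

Lemma twisted_current_comb4 v w a c b b' :
  twisted_current v w a (c *: b + b') =
  current_comb c (twisted_current v w a b) (twisted_current v w a b').
Proof.
apply: current_ext => k om; rewrite /twisted_current /current_comb.
rewrite mulr_sumr -big_split /=; apply: eq_bigr => t _.
by rewrite !linearP mulrDr -scalerAr point_current_combE.
Qed.

Lemma convolution_point_currents v w a b :
  monomial_span iE a -> monomial_span iE b ->
  is_convolution (pc p v a) (pc q w b) (twisted_current v w a b).
Proof.
move=> sa sb.
elim/monomial_span_ind: v / (enveloping_span U_enveloping v)
  => [xs|c v v' _ IH _ IH']; last first.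
  rewrite point_current_combU // twisted_current_comb1 //.
  exact: is_convolution_combl.
elim/monomial_span_ind: w / (enveloping_span U_enveloping w)
  => [ys|c w w' _ IH _ IH']; last first.
  rewrite point_current_combU // twisted_current_comb2 //.
  exact: is_convolution_combr.
elim/monomial_span_ind: a / sa => [s|c a a' _ IH _ IH']; last first.
  rewrite point_current_combE twisted_current_comb3.
  exact: is_convolution_combl.
elim/monomial_span_ind: b / sb => [t|c b b' _ IH _ IH']; last first.
  rewrite point_current_combE twisted_current_comb4.
  exact: is_convolution_combr.
exact: convolution_monomial.
Qed.

End PointCurrentConvolution.

Theorem lemma4 (R : realType) (G : lieGroup R)
  (U : algType R) (iU : {linear lie_algebra G -> U})
  (U_enveloping : is_enveloping iU)
  (E : algType R) (iE : {linear lie_algebra G -> E})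
  (E_exterior : is_exterior iE)
  (Delta : U -> seq (U * U))
  (Delta_coproduct : is_coproduct iU Delta)
  (AdU : G -> {lrmorphism U -> U})
  (AdU_extends : forall g x, AdU g (iU x) = iU (Ad g x))
  (AdE : G -> {lrmorphism E -> E})
  (AdE_extends : forall g x, AdE g (iE x) = iE (Ad g x))
  (br : U -> {linear E -> E})
  (br_extends : extends_bracket iU iE br)
  (rho : forall k, U -> {linear diff_form (lie_space G) k -> diff_form (lie_space G) k})
  (rho_lie : is_lie_derivative iU rho)
  (ev : forall k, diff_form (lie_space G) k -> G -> {scalar E})
  (ev_right_inv : is_right_inv_eval iE ev)
  (p q : G) (v w : U) (k j : nat) (a b : E)
  (a_homogeneous : is_homogeneous iE k a)
  (b_homogeneous : is_homogeneous iE j b) :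
  is_convolution (point_current rho ev p v a) (point_current rho ev q w b)
    (fun n om => \sum_(t <- Delta v)
       point_current rho ev (p * q)%g
         (AdU q^-1%g t.1 * w) (a * AdE p (br t.2 b)) om).

Proof.
have sa := homogeneous_monomial_span a_homogeneous.
have sb := homogeneous_monomial_span b_homogeneous.
exact: (convolution_point_currents U_enveloping Delta_coproduct AdU_extends AdE_extends
  br_extends rho_lie ev_right_inv p q v w sa sb).
Qed.
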